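(* Let $(f,\xi)$ be an equiaffine pair representing a line congruence, let $p$ be a point of the parameter domain with $\delta(p)>0$, and let $\lambda_i$ ($i\in\{1,2\}$) be an eigenvalue of the shape operator with $\lambda_i(p)\neq0$. Put $Z_i=f(p)+\lambda_i(p)^{-1}\xi(p)$. Assume that the $i$-ridge set is a regular curve, in the sense that the function $d\lambda_i(w_i)$ has non-zero differential at each of its zeros, where $w_i$ is a smooth nowhere zero field of eigenvectors of $S$ for $\lambda_i$. Then $p$ is an $A_4$ point of the support function $\rho(\cdot,Z_i)$ if and only if $p$ is an $i$-ridge point, the principal direction associated with $\lambda_i$ at $p$ is tangent to the $i$-ridge curve, and the contact at $p$ between the principal line of $\lambda_i$ through $p$ and the $i$-ridge curve is of order exactly $2$.
   Context: A line congruence is given by a pair $(f,\xi)$, where $f:U\to\mathbb{R}^3$ is a smooth immersion of an open set $U\subset\mathbb{R}^2$ and $\xi:U\to\mathbb{R}^3$ is smooth and transversal to $f$; the lines are $t\mapsto f(u,v)+t\xi(u,v)$. Write $D_X\xi=-f_*(SX)+\tau(X)\xi$ and $D_Xf_*Y=f_*(\nabla_XY)+h(X,Y)\xi$, with shape operator $S=\begin{pmatrix}a&b\\ c&d\end{pmatrix}$, $1$-form $\tau$ and symmetric bilinear form $h$. The pair is equiaffine if $\tau=0$ and $h$ is non-degenerate. Let $\delta=(a-d)^2+4bc$; where $\delta>0$, $S$ has two distinct real eigenvalues $\lambda_1,\lambda_2$, smooth functions on $\{\delta>0\}$, whose eigenvectors are called principal directions; the principal lines of $\lambda_i$ are the integral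 curves of the field of $\lambda_i$-eigendirections. A point is an $i$-ridge point if $F_i=f+\lambda_i^{-1}\xi$ is not an immersion there; equivalently (since $\tau=0$) $d\lambda_i(X)=0$ for $X$ an eigenvector of $S$ for $\lambda_i$. The $i$-ridge curve is the set of $i$-ridge points. Order of contact: two regular plane curves through $p$, written near $p$ as graphs $y=y_1(x)$, $y=y_2(x)$ over a common axis, have contact of order exactly $k$ at $p$ if $y_1-y_2$ vanishes to order exactly $k$ at $p$ (so transversal curves have contact $1$, and tangent curves have contact at least $2$). For an equiaffine pair, the co-normal $\nu$ is defined by $\nu\cdot f_u=\nu\cdot f_v=0$, $\nu\cdot\xi=1$, and the support function is $\rho(u,v,Z)=\nu(u,v)\cdot(Z-f(u,v))$, $Z\in\mathbb{R}^3$. The point $p$ is an $A_k$ point of $\rho(\cdot,Z)$ if $p$ is a critical point of $(u,v)\mapsto\rho(u,v,Z)$ and the germ at $p$ is, up to an additive constant and a smooth change of coordinates in the source, $\pm x^{k+1}\pm y^2$. *)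

(* Defs.v *)
From Stdlib Require Export Reals.
From Coquelicot Require Export Coquelicot.

Open Scope R_scope.

Notation R2 := (R * R)%type.
Notation R3 := (R * R * R)%type.

(** * Calculus on R^2 *)

(* [deriv X g p] is dg_p(X), written with the two partial derivatives. *)
Definition deriv (X : R2) (g : R2 -> R) (p : R2) : R :=
  fst X * Derive (fun x => g (x, snd p)) (fst p)
  + snd X * Derive (fun y => g (fst p, y)) (snd p).

Definition deriv3 (X : R2) (g : R2 -> R3) (p : R2) : R3 :=
  (deriv X (fun q => fst (fst (g q))) p,
   deriv X (fun q => snd (fst (g q))) p,
   deriv X (fun q => snd (g q)) p).

(* All iterated partial derivatives exist and are continuous at [p]; this is
   C^infinity once it is required at all points of an open set. *)
Definition smooth_at (g : R2 -> R) (p : R2) : Prop :=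
  forall n : nat, ex_diff_n (fun x y => g (x, y)) n (fst p) (snd p).

Definition smooth_on (U : R2 -> Prop) (g : R2 -> R) : Prop :=
  forall p, U p -> smooth_at g p.

Definition smooth2_on (U : R2 -> Prop) (g : R2 -> R2) : Prop :=
  smooth_on U (fun q => fst (g q)) /\ smooth_on U (fun q => snd (g q)).

Definition smooth3_on (U : R2 -> Prop) (g : R2 -> R3) : Prop :=
  smooth_on U (fun q => fst (fst (g q))) /\
  smooth_on U (fun q => snd (fst (g q))) /\
  smooth_on U (fun q => snd (g q)).

Definition immersion_at (g : R2 -> R3) (p : R2) : Prop :=
  forall X : R2, deriv3 X g p = zero -> X = zero.

Definition dot (v w : R3) : R :=
  fst (fst v) * fst (fst w) + snd (fst v) * snd (fst w) + snd v * snd w.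

(** * Line congruences *)

Record line_congruence (U : R2 -> Prop) (f xi : R2 -> R3) : Prop := {
  lc_open : open U;
  lc_smooth_f : smooth3_on U f;
  lc_smooth_xi : smooth3_on U xi;
  lc_immersion : forall p, U p -> immersion_at f p;
  lc_transversal : forall p, U p -> ~ exists X : R2, xi p = deriv3 X f p
}.

Record mat2 := Mat2 { m11 : R; m12 : R; m21 : R; m22 : R }.

Definition mat2_app (A : mat2) (X : R2) : R2 :=
  (m11 A * fst X + m12 A * snd X, m21 A * fst X + m22 A * snd X).

(* The structure equations determine [S p], [tau p] and [h p] for p in U,
   because f_u, f_v, xi form a basis of R^3 there; in particular they force
   [tau p] to be linear and [h p] to be bilinear and symmetric.
   The vector [Z] is (nabla_X Y)(p). *)
Definition structure_equations (U : R2 -> Prop) (f xi : R2 -> R3)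
    (S : R2 -> mat2) (tau : R2 -> R2 -> R) (h : R2 -> R2 -> R2 -> R) : Prop :=
  (forall p, U p -> forall X : R2,
     deriv3 X xi p
     = plus (opp (deriv3 (mat2_app (S p) X) f p)) (scal (tau p X) (xi p))) /\
  (forall p, U p -> forall (X : R2) (Y : R2 -> R2), smooth2_on U Y ->
     exists Z : R2,
       deriv3 X (fun q => deriv3 (Y q) f q) p
       = plus (deriv3 Z f p) (scal (h p X (Y p)) (xi p))).

Definition equiaffine (U : R2 -> Prop)
    (tau : R2 -> R2 -> R) (h : R2 -> R2 -> R2 -> R) : Prop :=
  (forall p, U p -> forall X, tau p X = 0) /\
  (forall p, U p -> forall X : R2, (forall Y, h p X Y = 0) -> X = zero).

(** * Principal curvatures and principal lines *)

Definition delta (S : R2 -> mat2) (p : R2) : R :=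
  (m11 (S p) - m22 (S p)) ^ 2 + 4 * m12 (S p) * m21 (S p).

Definition hyperbolic (U : R2 -> Prop) (S : R2 -> mat2) (p : R2) : Prop :=
  U p /\ 0 < delta S p.

Definition principal_direction (S : R2 -> mat2) (lam : R2 -> R)
    (p X : R2) : Prop :=
  X <> zero /\ mat2_app (S p) X = scal (lam p) X.

(* [lam] is one of the two smooth branches of eigenvalues of [S]
   on {delta > 0}. *)
Definition principal_curvature (U : R2 -> Prop) (S : R2 -> mat2)
    (lam : R2 -> R) : Prop :=
  smooth_on (hyperbolic U S) lam /\
  forall p, hyperbolic U S p -> exists X, principal_direction S lam p X.

Definition smooth_curve_at (y : R -> R) (t : R) : Prop :=
  forall n : nat, ex_derive_n y n t.

Definition velocity (gamma : R -> R2) (t : R) : R2 :=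
  (Derive (fun s => fst (gamma s)) t, Derive (fun s => snd (gamma s)) t).

Definition smooth_arc (gamma : R -> R2) (eps : R) : Prop :=
  forall t, Rabs t < eps ->
    smooth_curve_at (fun s => fst (gamma s)) t /\
    smooth_curve_at (fun s => snd (gamma s)) t.

Definition arc_image (gamma : R -> R2) (eps : R) (q : R2) : Prop :=
  exists t, Rabs t < eps /\ gamma t = q.

(* [gamma], restricted to ]-eps, eps[, is an arc through [p] of the principal
   line of [lam]. *)
Definition principal_arc (U : R2 -> Prop) (S : R2 -> mat2) (lam : R2 -> R)
    (p : R2) (gamma : R -> R2) (eps : R) : Prop :=
  0 < eps /\ gamma 0 = p /\ smooth_arc gamma eps /\
  forall t, Rabs t < eps ->
    hyperbolic U S (gamma t) /\
    principal_direction S lam (gamma t) (velocity gamma t).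

(** * Ridges *)

Definition focal_map (f xi : R2 -> R3) (lam : R2 -> R) (q : R2) : R3 :=
  plus (f q) (scal (/ lam q) (xi q)).

Definition ridge_point (U : R2 -> Prop) (f xi : R2 -> R3) (S : R2 -> mat2)
    (lam : R2 -> R) (q : R2) : Prop :=
  hyperbolic U S q /\ lam q <> 0 /\ ~ immersion_at (focal_map f xi lam) q.

(* The eigenvector field [w] is chosen locally, since the line field of
   eigendirections need not be orientable on the whole of {delta > 0}; the
   condition does not depend on the choice, as replacing w by g w, g <> 0,
   multiplies the differential of d lam (w) at its zeros by g. *)
Definition regular_ridge (U : R2 -> Prop) (S : R2 -> mat2)
    (lam : R2 -> R) : Prop :=
  forall q, hyperbolic U S q ->
  exists (W : R2 -> Prop) (w : R2 -> R2),
    open W /\ W q /\ (forall r, W r -> hyperbolic U S r) /\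
    smooth2_on W w /\
    (forall r, W r -> principal_direction S lam r (w r)) /\
    (forall r, W r -> deriv (w r) lam r = 0 ->
       exists X : R2, deriv X (fun s => deriv (w s) lam s) r <> 0).

(** * Tangency and contact of plane curves, given as subsets of R^2 *)

Definition tangent_to (C : R2 -> Prop) (p X : R2) : Prop :=
  exists (alpha : R -> R2) (eps : R),
    0 < eps /\ smooth_arc alpha eps /\
    (forall t, Rabs t < eps -> C (alpha t)) /\
    alpha 0 = p /\ velocity alpha 0 = X.

(* Near [p] the set [C] is the graph of the smooth function [y], in the affine
   coordinates with origin [p] and basis [e1], [e2]. *)
Definition graph_near (C : R2 -> Prop) (p e1 e2 : R2) (y : R -> R) : Prop :=
  y 0 = 0 /\
  exists eps : R, 0 < eps /\
    (forall x, Rabs x < eps -> smooth_curve_at y x) /\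
    (forall x z, Rabs x < eps -> Rabs z < eps ->
       (C (plus p (plus (scal x e1) (scal z e2))) <-> z = y x)).

Definition vanishes_exactly (y : R -> R) (k : nat) : Prop :=
  (forall j, (j < k)%nat -> Derive_n y j 0 = 0) /\ Derive_n y k 0 <> 0.

Definition contact_order (C1 C2 : R2 -> Prop) (p : R2) (k : nat) : Prop :=
  exists (e1 e2 : R2) (y1 y2 : R -> R),
    fst e1 * snd e2 - snd e1 * fst e2 <> 0 /\
    graph_near C1 p e1 e2 y1 /\ graph_near C2 p e1 e2 y2 /\
    vanishes_exactly (fun x => y1 x - y2 x) k.

(** * Support function and its singularities *)

Definition conormal (U : R2 -> Prop) (f xi nu : R2 -> R3) : Prop :=
  forall p, U p ->
    (forall X, dot (nu p) (deriv3 X f p) = 0) /\ dot (nu p) (xi p) = 1.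

Definition support (f nu : R2 -> R3) (q : R2) (Z : R3) : R :=
  dot (nu q) (minus Z (f q)).

(* Germ at [p] of a diffeomorphism onto a neighbourhood of [q], with inverse
   the germ of [psi] at [q]. *)
Definition local_diffeo (phi psi : R2 -> R2) (p q : R2) : Prop :=
  phi p = q /\ psi q = p /\
  (exists V, open V /\ V p /\ smooth2_on V phi) /\
  (exists V, open V /\ V q /\ smooth2_on V psi) /\
  locally p (fun r => psi (phi r) = r) /\
  locally q (fun r => phi (psi r) = r).

Definition A_point (k : nat) (g : R2 -> R) (p : R2) : Prop :=
  (forall X, deriv X g p = 0) /\
  exists (phi psi : R2 -> R2) (c s1 s2 : R),
    local_diffeo phi psi (0, 0) p /\
    (s1 = 1 \/ s1 = -1) /\ (s2 = 1 \/ s2 = -1) /\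
    locally ((0, 0) : R2) (fun z =>
      g (phi z) = c + s1 * fst z ^ (k + 1) + s2 * snd z ^ 2).

(* Main.v *)
From Stdlib Require Import ssreflect ssrfun ssrbool Lra Lia Classical ClassicalEpsilon.
Require Import Defs.

(** Let gamma be the principal line of lam through p, r = 1 / lam along gamma,
    E = Z - f - r xi the vector from the focal point F = f + r xi to Z, and g the
    support function. Since xi' = - lam f', we have E' = - r' xi and E(0) = 0; as
    nu.xi = 1 and nu'.xi = 0, the function g = nu.E + r along gamma has g' = nu'.E,
    g'' = nu''.E and g''' = nu'''.E - r' kappa, where kappa = lam nu'.f' does not
    vanish. Hence g - g(p) vanishes to order k + 3 iff
    r' vanishes to order k, and every other derivative of g vanishes to order 3
    along gamma as soon as r'(0) = 0. The Hessian of g at p has rank one and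
    kernel gamma'(0), so the splitting lemma makes p an A4 point iff g - g(p) has
    order exactly 5 along gamma, that is, iff r', or equivalently
    R = dlam(w), has order exactly 2 along gamma. As dR is nonzero on {R = 0},
    this order is that of the contact of gamma with the ridge curve. *)

(** * Germs of smooth functions *)

(** The geometry supplies the principal line, whereas the splitting lemma works along the curve
    where the transverse derivative of the support function vanishes. The two curves differ, but
    agreement to order 3 suffices: the gap enters the function through a square, hence only from
    order 6 on, and orders 5 and 6 remain distinguishable. This is the origin of the three orders of
    transverse flatness required throughout.

    Conversely, an A4 point comes with a normal form s1 u^5 + s2 v^2 in unknown coordinates. There
    the flatness of v along the line is raised step by step: order 2 because a square vanishes to
    even order, then order 3 from the transverse derivative.

    Contact is stated with graphs over an arbitrary affine basis. All orders are compared in one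
    affine chart, where the derivative of the focal radius, the ridge function along the line and
    the difference of the two graphs are multiples of one another by functions that do not vanish at
    p.

    [Derive] is total, so an identity between derivatives has content only with differentiability
    nearby; hence the work with germs. Hadamard's lemma plays the part of Taylor expansions with
    smooth remainders. *)

Definition dx (g : R2 -> R) (q : R2) : R := Derive (fun x => g (x, snd q)) (fst q).
Definition dy (g : R2 -> R) (q : R2) : R := Derive (fun y => g (fst q, y)) (snd q).

Definition partials (g gx gy : R2 -> R) (q : R2) : Prop :=
  is_derive (fun x => g (x, snd q)) (fst q) (gx q) /\
  is_derive (fun y => g (fst q, y)) (snd q) (gy q).

(* The partial derivatives are quantified existentially, and all conditions are
   imposed near q: unlike [smooth_at g q], this is stable under composition. *)
Fixpoint Ck (n : nat) (g : R2 -> R) (q : R2) : Prop :=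
  locally q (fun r => continuous g r) /\
  match n with
  | O => True
  | S m => exists gx gy, Ck m gx q /\ Ck m gy q /\ locally q (partials g gx gy)
  end.

(** One neighbourhood serves all n. With [Ck n g q] for every n at the single point [q], the
    neighbourhoods could shrink with n, and the property would not spread to nearby points. *)
Definition Cinf (g : R2 -> R) (q : R2) : Prop :=
  locally q (fun r => forall n, Ck n g r).

Lemma Ck_cont n g q : Ck n g q -> locally q (fun r => continuous g r).
Proof. by case: n => [|n] []. Qed.

Lemma Ck_pred n g q : Ck (S n) g q -> Ck n g q.
Proof.
elim: n g => [|n IH] g [Hc [gx [gy [Hx [Hy H]]]]]; first by [].
split=> //; exists gx, gy; split; [|split] => //; exact: IH.
Qed.

Lemma slice_x (P : R2 -> Prop) (q : R2) :
  locally q P -> locally (fst q) (fun x => P (x, snd q)).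
Proof.
move=> [e He]; exists e => x Hx; apply: He; split => //=; exact: ball_center.
Qed.

Lemma slice_y (P : R2 -> Prop) (q : R2) :
  locally q P -> locally (snd q) (fun y => P (fst q, y)).
Proof.
move=> [e He]; exists e => x Hx; apply: He; split => //=; exact: ball_center.
Qed.

Lemma continuous_ext_germ (f g : R2 -> R) (q : R2) :
  locally q (fun r => f r = g r) -> continuous f q -> continuous g q.
Proof.
move=> H Hf; apply: (continuous_ext_loc _ f) => //.
Qed.

Lemma partials_ext (f g gx gy : R2 -> R) (q : R2) :
  locally q (fun r => f r = g r) -> partials f gx gy q -> partials g gx gy q.
Proof.
move=> H [H1 H2]; split.
- apply: is_derive_ext_loc H1; exact: (slice_x (fun r => f r = g r)).
- apply: is_derive_ext_loc H2; exact: (slice_y (fun r => f r = g r)).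
Qed.

Lemma Ck_ext n (f g : R2 -> R) (q : R2) :
  locally q (fun r => f r = g r) -> Ck n f q -> Ck n g q.
Proof.
move=> H.
have Hc : locally q (fun r => continuous f r) -> locally q (fun r => continuous g r).
  move=> Hf; apply: filter_imp (filter_and _ _ (locally_locally _ _ H) Hf) => r [].
  exact: continuous_ext_germ.
case: n => [|n] [Hf H']; split=> //; try exact: Hc.
case: H' => gx [gy [Hx [Hy Hd]]]; exists gx, gy; split; [|split] => //.
apply: filter_imp (filter_and _ _ (locally_locally _ _ H) Hd) => r [].
exact: partials_ext.
Qed.

Lemma partialsE (g gx gy : R2 -> R) (q : R2) :
  partials g gx gy q -> dx g q = gx q /\ dy g q = gy q.
Proof. by move=> [H1 H2]; split; apply: is_derive_unique. Qed.

Lemma Ck_dx n g q : Ck (S n) g q -> Ck n (dx g) q.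
Proof.
move=> [_ [gx [gy [Hx [Hy Hd]]]]]; apply: Ck_ext Hx.
by apply: filter_imp Hd => r /partialsE [].
Qed.

Lemma Ck_dy n g q : Ck (S n) g q -> Ck n (dy g) q.
Proof.
move=> [_ [gx [gy [Hx [Hy Hd]]]]]; apply: Ck_ext Hy.
by apply: filter_imp Hd => r /partialsE [].
Qed.

Lemma Ck_partials n g q : Ck (S n) g q -> locally q (partials g (dx g) (dy g)).
Proof.
move=> [_ [gx [gy [Hx [Hy Hd]]]]]; apply: filter_imp Hd => r Hr.
by case: (partialsE _ _ _ _ Hr) => E1 E2; case: Hr; split; rewrite ?E1 ?E2.
Qed.

Lemma Cinf_ext (f g : R2 -> R) (q : R2) :
  locally q (fun r => f r = g r) -> Cinf f q -> Cinf g q.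
Proof.
move=> H Hf; apply: filter_imp (filter_and _ _ (locally_locally _ _ H) Hf).
by move=> r [Hr Hn] n; apply: Ck_ext (Hn n).
Qed.

Lemma Cinf_Ck n g q : Cinf g q -> Ck n g q.
Proof. by move=> /locally_singleton H; apply: H. Qed.

Lemma Cinf_dx g q : Cinf g q -> Cinf (dx g) q.
Proof. by apply: filter_imp => r H n; apply: Ck_dx. Qed.

Lemma Cinf_dy g q : Cinf g q -> Cinf (dy g) q.
Proof. by apply: filter_imp => r H n; apply: Ck_dy. Qed.

Lemma Cinf_locally g q : Cinf g q -> locally q (Cinf g).
Proof. exact: locally_locally. Qed.

Lemma Cinf_cont g q : Cinf g q -> continuous g q.
Proof. by move=> /(Cinf_Ck 0) /Ck_cont /locally_singleton. Qed.

Lemma Cinf_partials g q : Cinf g q -> partials g (dx g) (dy g) q.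
Proof. by move=> /(Cinf_Ck 1) /Ck_partials /locally_singleton. Qed.

(** [ex_diff_n] speaks of one point only. Holding it on a neighbourhood lets the induction pass to
    the partial derivatives, which satisfy it there at one order less. *)
Lemma smooth_at_Ck g q : locally q (smooth_at g) -> forall n, Ck n g q.
Proof.
move=> H n; have {H} : locally q (fun r => ex_diff_n (fun x y => g (x, y)) n (fst r) (snd r)).
  by apply: filter_imp H => r; apply.
elim: n g q => [|n IH] g q H; split=> //.
- apply: filter_imp H => -[x y] /= [H _].
  by move/continuity_2d_pt_filterlim: H; apply: filterlim_ext => -[].
- apply: filter_imp H => -[x y] /= [H _].
  by move/continuity_2d_pt_filterlim: H; apply: filterlim_ext => -[].
exists (dx g), (dy g); split; [|split].
- by apply: IH; apply: filter_imp H => r /= [_ [_ [_ [H _]]]].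
- by apply: IH; apply: filter_imp H => r /= [_ [_ [_ [_ H]]]].
- by apply: filter_imp H => r /= [_ [H1 [H2 _]]]; split; apply: Derive_correct.
Qed.

Lemma Ck_ex_diff n g q : Ck n g q -> ex_diff_n (fun x y => g (x, y)) n (fst q) (snd q).
Proof.
elim: n g q => [|n IH] g q H.
  split=> //; move/Ck_cont/locally_singleton: H => H.
  apply/continuity_2d_pt_filterlim.
  by case: q H => x y H; apply: filterlim_ext H => -[].
split; [|split; [|split; [|split]]].
- move/Ck_cont/locally_singleton: H => H.
  apply/continuity_2d_pt_filterlim.
  by case: q H => x y H; apply: filterlim_ext H => -[].
- by move/Ck_partials/locally_singleton: H => [H _]; eexists; exact: H.
- by move/Ck_partials/locally_singleton: H => [_ H]; eexists; exact: H.
- by move/Ck_dx/IH: H.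
- by move/Ck_dy/IH: H.
Qed.

(** The bridge from the smoothness used in the statement to germs, and back when witnesses have to
    be exhibited. *)
Lemma Cinf_smooth_at g q : Cinf g q <-> locally q (smooth_at g).
Proof.
split=> H.
- by apply: filter_imp H => r H n; apply: Ck_ex_diff.
- by apply: filter_imp (locally_locally _ _ H) => r; apply: smooth_at_Ck.
Qed.

Lemma smooth_on_Cinf U g q : open U -> U q -> smooth_on U g -> Cinf g q.
Proof.
move=> HU Hq H; apply/Cinf_smooth_at; apply: filter_imp (HU q Hq) => r; exact: H.
Qed.

(** * Algebra of smooth germs *)

Lemma Ck_const n c q : Ck n (fun _ => c) q.
Proof.
elim: n c => [|n IH] c; split=> //; try (apply: filter_forall => r; exact: continuous_const).
exists (fun _ => 0), (fun _ => 0); split; [|split] => //.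
by apply: filter_forall => r; split; apply: is_derive_const.
Qed.

Lemma Cinf_const c q : Cinf (fun _ => c) q.
Proof. by apply: filter_forall => r n; apply: Ck_const. Qed.

Lemma Cinf_fst q : Cinf fst q.
Proof.
apply: filter_forall => r n.
case: n => [|n]; split=> //; try (apply: filter_forall => s; exact: continuous_fst).
exists (fun _ => 1), (fun _ => 0); split; [|split]; try exact: Ck_const.
by apply: filter_forall => s; split; [exact: is_derive_id|exact: is_derive_const].
Qed.

Lemma Cinf_snd q : Cinf snd q.
Proof.
apply: filter_forall => r n.
case: n => [|n]; split=> //; try (apply: filter_forall => s; exact: continuous_snd).
exists (fun _ => 0), (fun _ => 1); split; [|split]; try exact: Ck_const.
by apply: filter_forall => s; split; [exact: is_derive_const|exact: is_derive_id].
Qed.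

Lemma Ck_plus n f g q : Ck n f q -> Ck n g q -> Ck n (fun r => f r + g r) q.
Proof.
elim: n f g => [|n IH] f g Hf Hg; split => //;
  try (apply: filter_imp (filter_and _ _ (Ck_cont _ _ _ Hf) (Ck_cont _ _ _ Hg)) => r [];
       exact: continuous_plus).
exists (fun r => dx f r + dx g r), (fun r => dy f r + dy g r); split; [|split].
- by apply: IH; apply: Ck_dx.
- by apply: IH; apply: Ck_dy.
apply: filter_imp (filter_and _ _ (Ck_partials _ _ _ Hf) (Ck_partials _ _ _ Hg)).
by move=> r [[H1 H2] [H3 H4]]; split; apply: is_derive_plus.
Qed.

Lemma Ck_mult n f g q : Ck n f q -> Ck n g q -> Ck n (fun r => f r * g r) q.
Proof.
elim: n f g => [|n IH] f g Hf Hg; split => //;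
  try (apply: filter_imp (filter_and _ _ (Ck_cont _ _ _ Hf) (Ck_cont _ _ _ Hg)) => r [];
       exact: (@continuous_mult _ R_AbsRing)).
exists (fun r => dx f r * g r + f r * dx g r), (fun r => dy f r * g r + f r * dy g r); split; [|split].
- by apply: Ck_plus; apply: IH; (exact: Ck_dx || exact: Ck_pred).
- by apply: Ck_plus; apply: IH; (exact: Ck_dy || exact: Ck_pred).
apply: filter_imp (filter_and _ _ (Ck_partials _ _ _ Hf) (Ck_partials _ _ _ Hg)).
move=> [x y] [[/= H1 H2] [/= H3 H4]]; split => /=.
- by apply: (@is_derive_mult R_AbsRing) => // *; apply: Rmult_comm.
- by apply: (@is_derive_mult R_AbsRing) => // *; apply: Rmult_comm.
Qed.

Lemma Cinf_plus f g q : Cinf f q -> Cinf g q -> Cinf (fun r => f r + g r) q.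
Proof. by move=> Hf Hg; apply: filter_imp (filter_and _ _ Hf Hg) => r [H1 H2] n; apply: Ck_plus. Qed.

Lemma Cinf_mult f g q : Cinf f q -> Cinf g q -> Cinf (fun r => f r * g r) q.
Proof. by move=> Hf Hg; apply: filter_imp (filter_and _ _ Hf Hg) => r [H1 H2] n; apply: Ck_mult. Qed.

Lemma Cinf_opp f q : Cinf f q -> Cinf (fun r => - f r) q.
Proof.
move=> H; apply: (Cinf_ext (fun r => (-1) * f r)).
- by apply: filter_forall => r; ring.
- apply: Cinf_mult => //; exact: Cinf_const.
Qed.

Lemma Cinf_minus f g q : Cinf f q -> Cinf g q -> Cinf (fun r => f r - g r) q.
Proof. by move=> Hf Hg; apply: Cinf_plus => //; apply: Cinf_opp. Qed.

Lemma Cinf_pow f k q : Cinf f q -> Cinf (fun r => f r ^ k) q.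
Proof.
move=> H; elim: k => [|k IH] /=; [exact: Cinf_const|exact: Cinf_mult].
Qed.

(** * Total differentiability, composition, elementary functions *)

Lemma continuous_pair (u v : R2 -> R) (q : R2) :
  continuous u q -> continuous v q -> continuous (fun r => (u r, v r)) q.
Proof.
move=> Hu Hv P [e He].
have Hu1 : locally q (fun r => ball (u q) e (u r)) := Hu _ (locally_ball (u q) e).
have Hv1 : locally q (fun r => ball (v q) e (v r)) := Hv _ (locally_ball (v q) e).
by apply: filter_imp (filter_and _ _ Hu1 Hv1) => r [H1 H2]; apply: He.
Qed.

Lemma filterlim_pair_locally (u v : R2 -> R) (q : R2) (P : R2 -> Prop) :
  continuous u q -> continuous v q -> locally (u q, v q) P ->
  locally q (fun r => P (u r, v r)).
Proof.
move=> Hu Hv HP; have := continuous_pair _ _ _ Hu Hv; apply; exact: HP.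
Qed.

Lemma partials_differentiable (g gx gy : R2 -> R) (q : R2) :
  locally q (partials g gx gy) -> continuous gx q ->
  differentiable_pt_lim (fun x y => g (x, y)) (fst q) (snd q) (gx q) (gy q).
Proof.
case: q => x y H Hc; apply/filterdiff_differentiable_pt_lim => /=.
apply: (is_derive_filterdiff (fun a b => g (a, b)) x y (fun a b => gx (a, b)) (gy (x, y))).
- by apply: filter_imp H => -[a b] [].
- by move/locally_singleton: H => [].
- by apply: continuous_ext Hc => -[].
Qed.

Lemma partials_comp (K Kx Ky u ux uy v vx vy : R2 -> R) (q : R2) :
  differentiable_pt_lim (fun x y => K (x, y)) (u q) (v q) (Kx (u q, v q)) (Ky (u q, v q)) ->
  partials u ux uy q -> partials v vx vy q ->
  partials (fun r => K (u r, v r))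
    (fun r => Kx (u r, v r) * ux r + Ky (u r, v r) * vx r)
    (fun r => Kx (u r, v r) * uy r + Ky (u r, v r) * vy r) q.
Proof.
case: q => x y HK [/= Hu1 Hu2] [/= Hv1 Hv2]; split => /=; apply/is_derive_Reals;
  apply: (derivable_pt_lim_comp_2d (fun a b => K (a, b))) => //; exact/is_derive_Reals.
Qed.

Lemma Ck_differentiable n g q : Ck (S n) g q ->
  locally q (fun r => differentiable_pt_lim (fun x y => g (x, y)) (fst r) (snd r) (dx g r) (dy g r)).
Proof.
move=> H; apply: filter_imp (filter_and _ _ (locally_locally _ _ (Ck_partials _ _ _ H))
  (Ck_cont _ _ _ (Ck_dx _ _ _ H))) => r [H1 H2].
exact: partials_differentiable.
Qed.

Lemma Ck_comp n K u v q :
  Ck n K (u q, v q) -> Ck n u q -> Ck n v q -> Ck n (fun r => K (u r, v r)) q.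
Proof.
elim: n K u v => [|n IH] K u v HK Hu Hv.
- split => //.
  have Cu := locally_singleton _ _ (Ck_cont _ _ _ Hu).
  have Cv := locally_singleton _ _ (Ck_cont _ _ _ Hv).
  have := filterlim_pair_locally _ _ _ _ Cu Cv (Ck_cont _ _ _ HK).
  move/(filter_and _ _ (filter_and _ _ (Ck_cont _ _ _ Hu) (Ck_cont _ _ _ Hv))).
  apply: filter_imp => r [[H1 H2] H3]; apply: (continuous_comp (fun r => (u r, v r)) K) => //.
  exact: continuous_pair.
have Cu := locally_singleton _ _ (Ck_cont _ _ _ Hu).
have Cv := locally_singleton _ _ (Ck_cont _ _ _ Hv).
split.
  have := filterlim_pair_locally _ _ _ _ Cu Cv (Ck_cont _ _ _ HK).
  move/(filter_and _ _ (filter_and _ _ (Ck_cont _ _ _ Hu) (Ck_cont _ _ _ Hv))).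
  apply: filter_imp => r [[H1 H2] H3]; apply: (continuous_comp (fun r => (u r, v r)) K) => //.
  exact: continuous_pair.
exists (fun r => dx K (u r, v r) * dx u r + dy K (u r, v r) * dx v r),
       (fun r => dx K (u r, v r) * dy u r + dy K (u r, v r) * dy v r); split; [|split].
- apply: Ck_plus; apply: Ck_mult; try (by apply: Ck_dx); apply: IH; try (by apply: Ck_pred);
  [exact: Ck_dx|exact: Ck_dy].
- apply: Ck_plus; apply: Ck_mult; try (by apply: Ck_dy); apply: IH; try (by apply: Ck_pred);
  [exact: Ck_dx|exact: Ck_dy].
have := filterlim_pair_locally _ _ _ _ Cu Cv (Ck_differentiable _ _ _ HK).
move/(filter_and _ _ (filter_and _ _ (Ck_partials _ _ _ Hu) (Ck_partials _ _ _ Hv))).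
apply: filter_imp => r [[H1 H2] H3]; exact: partials_comp.
Qed.

Lemma Cinf_comp K u v q :
  Cinf K (u q, v q) -> Cinf u q -> Cinf v q -> Cinf (fun r => K (u r, v r)) q.
Proof.
move=> HK Hu Hv.
have := filterlim_pair_locally _ _ _ _ (Cinf_cont _ _ Hu) (Cinf_cont _ _ Hv) HK.
move/(filter_and _ _ (filter_and _ _ Hu Hv)).
by apply: filter_imp => r [[H1 H2] H3] n; apply: Ck_comp.
Qed.

Lemma Cinf_differentiable g q : Cinf g q ->
  differentiable_pt_lim (fun x y => g (x, y)) (fst q) (snd q) (dx g q) (dy g q).
Proof. by move=> /(Cinf_Ck 1) /Ck_differentiable /locally_singleton. Qed.

(** Bootstrap: if the partial derivatives are as regular as the function itself, regularity climbs
    by one order at each step. It serves for functions defined by an equation, such as implicit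
    functions, whose derivatives are expressed through the function. *)
Lemma Cinf_of_partials g gx gy q :
  locally q (partials g gx gy) -> (forall n, Ck n g q -> Ck n gx q /\ Ck n gy q) ->
  Ck 0 g q -> forall n, Ck n g q.
Proof.
move=> Hd H H0; elim=> [|n IH] //; split; first exact: (Ck_cont _ _ _ H0).
by case: (H n IH) => Hx Hy; exists gx, gy.
Qed.

(** The same bootstrap for one variable, used for inverse, exponential, logarithm and solutions of
    differential equations. [P] is a region where the formula for the derivative is valid and
    regular, for instance 0 < t for the logarithm. *)
Lemma Cinf_lift (P : R -> Prop) (a a' : R -> R) (q : R2) :
  locally (fst q) (fun t => P t /\ is_derive a t (a' t)) ->
  (forall n r, P (fst r) -> Ck n (fun s => a (fst s)) r -> Ck n (fun s => a' (fst s)) r) ->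
  Cinf (fun s => a (fst s)) q.
Proof.
move=> Hd H.
have Hd2 : locally q (fun r => P (fst r) /\ is_derive a (fst r) (a' (fst r))).
  exact: (@continuous_fst _ _ (fst q) (snd q) _ Hd).
apply: filter_imp (locally_locally _ _ Hd2) => r Hr.
have Hr0 := locally_singleton _ _ Hr.
apply: (Cinf_of_partials _ (fun s => a' (fst s)) (fun _ => 0)).
- apply: filter_imp Hr => s [_ Hs]; split => /=; [exact: Hs|exact: is_derive_const].
- move=> n Hn; split; [apply: H => //; tauto|exact: Ck_const].
- split => //; apply: filter_imp Hr => s [_ Hs].
  apply: (continuous_comp fst a); first exact: continuous_fst.
  by apply: ex_derive_continuous; eexists; exact: Hs.
Qed.

Lemma Cinf_inv1 q : fst q <> 0 -> Cinf (fun s => / fst s) q.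
Proof.
move=> Hq; apply: (Cinf_lift (fun _ => True) Rinv (fun x => - / x * / x)).
- apply: filter_imp (open_neq 0 _ Hq) => t Ht; split=> //; auto_derive => //; field; exact: Ht.
- move=> n r _ Hr; apply: Ck_mult => //.
  apply: (Ck_ext n (fun s => (-1) * / fst s)).
    by apply: filter_forall => s; ring.
  apply: Ck_mult => //; exact: Ck_const.
Qed.

Lemma Cinf_inv f q : Cinf f q -> f q <> 0 -> Cinf (fun r => / f r) q.
Proof.
move=> Hf H0; apply: (Cinf_comp (fun s => / fst s) f (fun _ => 0)) => //; last exact: Cinf_const.
exact: Cinf_inv1.
Qed.

Lemma Cinf_div f g q : Cinf f q -> Cinf g q -> g q <> 0 -> Cinf (fun r => f r / g r) q.
Proof. by move=> Hf Hg H0; apply: Cinf_mult => //; apply: Cinf_inv. Qed.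

Lemma Cinf_exp f q : Cinf f q -> Cinf (fun r => exp (f r)) q.
Proof.
move=> Hf; apply: (Cinf_comp (fun s => exp (fst s)) f (fun _ => 0)) => //; last exact: Cinf_const.
apply: (Cinf_lift (fun _ => True) exp exp) => //.
apply: filter_forall => t; split => //; exact: is_derive_exp.
Qed.

Lemma Cinf_ln f q : Cinf f q -> 0 < f q -> Cinf (fun r => ln (f r)) q.
Proof.
move=> Hf H0; apply: (Cinf_comp (fun s => ln (fst s)) f (fun _ => 0)) => //; last exact: Cinf_const.
apply: (Cinf_lift (fun t => 0 < t) ln Rinv) => /=.
- apply: filter_imp (open_gt 0 _ H0) => t Ht; split=> //; exact: is_derive_ln.
- move=> n r Hr _; apply: Cinf_Ck; apply: Cinf_inv1; lra.
Qed.

(** * Smooth functions of one variable near 0 and their order of vanishing *)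

(* Functions of one variable are handled as functions of the first coordinate. *)
Definition smooth0 (u : R -> R) : Prop := Cinf (fun s => u (fst s)) (0, 0).

Lemma locally_fst (P : R -> Prop) (q : R2) :
  locally (fst q) P -> locally q (fun s => P (fst s)).
Proof. by move=> H; exact: (@continuous_fst _ _ (fst q) (snd q) _ H). Qed.

Lemma locally_along (P : R2 -> Prop) (a b : R -> R) (t : R) :
  continuous a t -> continuous b t -> locally ((a t, b t) : R2) P ->
  locally t (fun s => P (a s, b s)).
Proof.
move=> Ha Hb [e He].
have Ha1 : locally t (fun r => ball (a t) e (a r)) := Ha _ (locally_ball (a t) e).
have Hb1 : locally t (fun r => ball (b t) e (b r)) := Hb _ (locally_ball (b t) e).
by apply: filter_imp (filter_and _ _ Ha1 Hb1) => r [H1 H2]; apply: He.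
Qed.

Lemma locally_axis (P : R2 -> Prop) (x y : R) :
  locally ((x, y) : R2) P -> locally x (fun t => P (t, y)).
Proof.
move=> H; apply: (locally_along P (fun t => t) (fun _ => y)) => //;
  exact: continuous_const.
Qed.

Lemma smooth0_Derive u : smooth0 u -> smooth0 (Derive u).
Proof. by move/Cinf_dx. Qed.

Lemma smooth0_locally u : smooth0 u -> locally 0 (fun t => is_derive u t (Derive u t)).
Proof.
move/Cinf_locally/locally_axis; apply: filter_imp => t /Cinf_partials [] //.
Qed.

Lemma smooth0_is_derive u : smooth0 u -> is_derive u 0 (Derive u 0).
Proof. by move/smooth0_locally/locally_singleton. Qed.

Lemma smooth0_cont u : smooth0 u -> continuous u 0.
Proof. by move/smooth0_is_derive => H; apply: ex_derive_continuous; eexists; exact: H. Qed.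

Lemma smooth0_id : smooth0 (fun t => t).
Proof. exact: Cinf_fst. Qed.

Lemma smooth0_const c : smooth0 (fun _ => c).
Proof. exact: Cinf_const. Qed.

Lemma smooth0_plus u v : smooth0 u -> smooth0 v -> smooth0 (fun t => u t + v t).
Proof. exact: Cinf_plus. Qed.

Lemma smooth0_mult u v : smooth0 u -> smooth0 v -> smooth0 (fun t => u t * v t).
Proof. exact: Cinf_mult. Qed.

Lemma smooth0_opp u : smooth0 u -> smooth0 (fun t => - u t).
Proof. exact: Cinf_opp. Qed.

Lemma smooth0_minus u v : smooth0 u -> smooth0 v -> smooth0 (fun t => u t - v t).
Proof. exact: Cinf_minus. Qed.

Lemma smooth0_pow u k : smooth0 u -> smooth0 (fun t => u t ^ k).
Proof. exact: Cinf_pow. Qed.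

Lemma smooth0_inv u : smooth0 u -> u 0 <> 0 -> smooth0 (fun t => / u t).
Proof. exact: Cinf_inv. Qed.

Lemma smooth0_div u v : smooth0 u -> smooth0 v -> v 0 <> 0 -> smooth0 (fun t => u t / v t).
Proof. exact: Cinf_div. Qed.

Lemma smooth0_comp K a b : Cinf K (a 0, b 0) -> smooth0 a -> smooth0 b -> smooth0 (fun t => K (a t, b t)).
Proof. exact: Cinf_comp. Qed.

Lemma chain_rule K a b t : Cinf K (a t, b t) -> ex_derive a t -> ex_derive b t ->
  is_derive (fun s => K (a s, b s)) t (deriv (Derive a t, Derive b t) K (a t, b t)).
Proof.
move=> /Cinf_differentiable /= HK /Derive_correct Ha /Derive_correct Hb.
rewrite /deriv /=; apply/is_derive_Reals.
have -> : Derive a t * Derive (fun x => K (x, b t)) (a t) +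
  Derive b t * Derive (fun y => K (a t, y)) (b t) =
  dx K (a t, b t) * Derive a t + dy K (a t, b t) * Derive b t by rewrite /dx /dy /=; ring.
by apply: (derivable_pt_lim_comp_2d (fun a b => K (a, b))) => //; apply/is_derive_Reals.
Qed.

Ltac solve_smooth0 := repeat first [assumption | apply smooth0_const | apply smooth0_id | apply smooth0_plus
  | apply smooth0_minus | apply smooth0_mult | apply smooth0_opp | apply smooth0_pow | apply smooth0_Derive ].

Lemma Derive_n_Derive u n t : Derive_n (Derive u) n t = Derive_n u (S n) t.
Proof. by elim: n t => [|n IH] t //=; apply: Derive_ext => s; rewrite IH. Qed.

Lemma Ck_smooth_curve u n r :
  locally (fst r) (smooth_curve_at u) -> Ck n (fun s => u (fst s)) r.
Proof.
elim: n u => [|n IH] u H.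
all: have Hd : locally (fst r) (fun t => is_derive u t (Derive u t))
  by apply: filter_imp H => t Ht; apply: Derive_correct; exact: (Ht 1%nat).
all: have Hc : locally r (fun s => continuous (fun q : R2 => u (fst q)) s)
  by apply: filter_imp (locally_fst _ r Hd) => s Hs;
  apply: (continuous_comp fst u); [exact: continuous_fst|
  apply: ex_derive_continuous; eexists; exact: Hs].
  by [].
split=> //.
exists (fun s => Derive u (fst s)), (fun _ => 0); split; [|split; [exact: Ck_const|]].
- apply: IH; apply: filter_imp H => t Ht [|m] //=.
  have := Ht (S (S m)); rewrite /ex_derive_n.
  by apply: ex_derive_ext => s; rewrite Derive_n_Derive.
- apply: filter_imp (locally_fst _ r Hd) => s Hs.
  by split => /=; [exact: Hs|exact: is_derive_const].
Qed.

Lemma smooth_curve_Ck u t :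
  (forall n, Ck n (fun s => u (fst s)) (t, 0)) -> smooth_curve_at u t.
Proof.
move=> H n; have {H} := H n.
elim: n u => [|n IH] u H //=.
case: n IH H => [|n] IH H.
  by move/Ck_partials/locally_singleton: H => -[H _]; eexists; exact: H.
have := IH (Derive u) (Ck_dx _ _ _ H); rewrite /ex_derive_n.
by apply: ex_derive_ext => s; rewrite Derive_n_Derive.
Qed.

Lemma smooth0_smooth_curve u : smooth0 u <-> locally 0 (smooth_curve_at u).
Proof.
split.
- by move/locally_axis; apply: filter_imp => t H; apply: smooth_curve_Ck.
- move=> /locally_locally /(locally_fst _ (0, 0)); apply: filter_imp => r H n.
  exact: Ck_smooth_curve.
Qed.

(** For smooth germs this is membership in the ideal generated by t^k (see [flat_factor]). The
    recursion peels off the innermost derivative, so that an induction on k replaces u by its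
    derivative. *)
Fixpoint flat (k : nat) (u : R -> R) : Prop :=
  match k with
  | O => True
  | S j => u 0 = 0 /\ flat j (Derive u)
  end.

Lemma Derive_ext_germ (u v : R -> R) :
  locally 0 (fun t => u t = v t) -> locally 0 (fun t => Derive u t = Derive v t).
Proof.
move/locally_locally; apply: filter_imp => t; exact: Derive_ext_loc.
Qed.

Lemma flat_ext k (u v : R -> R) : locally 0 (fun t => u t = v t) -> flat k u -> flat k v.
Proof.
elim: k u v => [|k IH] u v H //= [H0 HV]; split.
- by rewrite -(locally_singleton _ _ H).
- exact: IH (Derive_ext_germ _ _ H) HV.
Qed.

Lemma flat_le j k u : (j <= k)%nat -> flat k u -> flat j u.
Proof.
elim: k j u => [|k IH] [|j] u //=; try lia.
move=> Hj [H0 H]; split=> //; apply: IH H; lia.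
Qed.

Lemma Derive_plus_germ u v : smooth0 u -> smooth0 v ->
  locally 0 (fun t => Derive u t + Derive v t = Derive (fun s => u s + v s) t).
Proof.
move=> Hu Hv; apply: filter_imp (filter_and _ _ (smooth0_locally _ Hu) (smooth0_locally _ Hv)) => t [H1 H2].
by symmetry; apply: is_derive_unique; apply: is_derive_plus.
Qed.

Lemma Derive_mult_germ u v : smooth0 u -> smooth0 v ->
  locally 0 (fun t => Derive u t * v t + u t * Derive v t = Derive (fun s => u s * v s) t).
Proof.
move=> Hu Hv; apply: filter_imp (filter_and _ _ (smooth0_locally _ Hu) (smooth0_locally _ Hv)) => t [H1 H2].
symmetry; apply: is_derive_unique; apply: (@is_derive_mult R_AbsRing) => // *; exact: Rmult_comm.
Qed.

Lemma flat_plus k u v : smooth0 u -> smooth0 v -> flat k u -> flat k v -> flat k (fun t => u t + v t).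
Proof.
elim: k u v => [|k IH] u v Hu Hv //= [Hu0 HVu] [Hv0 HVv]; split; first by rewrite Hu0 Hv0; ring.
apply: (flat_ext _ _ _ (Derive_plus_germ u v Hu Hv)).
by apply: IH => //; solve_smooth0.
Qed.

(** By Leibniz' rule: differentiating the product costs one order on one of the two factors only,
    and truncated orders are covered by the inequality on n. *)
Lemma flat_mult j k n u v : (n <= j + k)%nat -> smooth0 u -> smooth0 v -> flat j u -> flat k v ->
  flat n (fun t => u t * v t).
Proof.
elim: n j k u v => [|n IH] j k u v Hn Hu Hv HVu HVv //=; split.
- case: j HVu Hn => [|j] /= HVu Hn; last by case: HVu => -> _; ring.
  by case: k HVv Hn => [|k] /= HVv Hn; [lia|case: HVv => -> _; ring].
apply: (flat_ext _ _ _ (Derive_mult_germ u v Hu Hv)).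
apply: flat_plus; solve_smooth0.
- case: j HVu Hn => [|j] HVu Hn.
  + by apply: (IH 0%nat n) => //; solve_smooth0; apply: flat_le HVv; lia.
  + by case: HVu => _ HVu; apply: (IH j k) => //; solve_smooth0; lia.
- case: k HVv Hn => [|k] HVv Hn.
  + by apply: (IH n 0%nat) => //; solve_smooth0; [lia|apply: flat_le HVu; lia].
  + by case: HVv => _ HVv; apply: (IH j k) => //; solve_smooth0; lia.
Qed.

Lemma flat_mult_l k u v : smooth0 u -> smooth0 v -> flat k u -> flat k (fun t => u t * v t).
Proof. by move=> Hu Hv H; apply: (flat_mult k 0) => //; lia. Qed.

Lemma flat_mult_r k u v : smooth0 u -> smooth0 v -> flat k v -> flat k (fun t => u t * v t).
Proof. by move=> Hu Hv H; apply: (flat_mult 0 k) => //; lia. Qed.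

Lemma flat_opp k u : smooth0 u -> flat k u -> flat k (fun t => - u t).
Proof.
move=> Hu HV; apply: (flat_ext _ (fun t => (-1) * u t)).
- by apply: filter_forall => t; ring.
- by apply: flat_mult_r => //; solve_smooth0.
Qed.

Lemma flat_minus k u v : smooth0 u -> smooth0 v -> flat k u -> flat k v -> flat k (fun t => u t - v t).
Proof. by move=> Hu Hv H1 H2; apply: flat_plus => //; solve_smooth0; apply: flat_opp. Qed.

Lemma smooth0_neq0 u : smooth0 u -> u 0 <> 0 -> locally 0 (fun t => u t <> 0).
Proof. by move=> /smooth0_cont H H0; apply: (H (fun x => x <> 0)); exact: open_neq. Qed.

Lemma flat_unit k u v : smooth0 u -> smooth0 v -> v 0 <> 0 -> flat k (fun t => u t * v t) -> flat k u.
Proof.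
move=> Hu Hv H0 H; apply: (flat_ext _ (fun t => (u t * v t) * / v t)).
- by apply: filter_imp (smooth0_neq0 _ Hv H0) => t Ht; field.
- by apply: flat_mult_l => //; solve_smooth0; apply: smooth0_inv.
Qed.

(* (t v)^(j+1) (0) = (j+1) v^(j) (0) *)
Lemma flat_id_mult k v : smooth0 v -> flat (S k) (fun t => t * v t) -> flat k v.
Proof.
(* Differentiating (c + 1) v + t v' gives (c + 2) v' + t v'', which has the same shape with c raised
   by one. The induction therefore keeps c free, and [u] stands for a function that agrees with v'
   near 0. *)
suff G : forall k u v, smooth0 u -> smooth0 v -> forall c : nat, flat k (fun t => INR (S c) * v t + t * u t) ->
   locally 0 (fun t => u t = Derive v t) -> flat k v.
  move=> Hv [_ H]; apply: (G k (Derive v) v _ _ 0%nat) => //; solve_smooth0; last exact: filter_forall.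
  apply: flat_ext H; apply: filter_imp (smooth0_locally _ Hv) => t Ht.
  apply: is_derive_unique.
  evar_last. apply: (@is_derive_mult R_AbsRing). exact: is_derive_id. exact: Ht. exact: Rmult_comm.
  rewrite /plus /mult /one /=; ring.
move=> {}k; elim: k => [|k IH] u {}v Hu Hv c // [H0 H] E.
split.
  have Hc : INR (S c) <> 0 by apply: not_0_INR.
  by apply: (Rmult_eq_reg_l (INR (S c))) => //; rewrite -/(INR (S c)) in H0; lra.
apply: (IH (Derive u) (Derive v) _ _ (S c)); solve_smooth0; last exact: Derive_ext_germ.
apply: flat_ext H.
apply: filter_imp (filter_and _ _ E (filter_and _ _ (smooth0_locally _ Hu) (smooth0_locally _ Hv))) => t [Et [H1 H2]].
apply: is_derive_unique; rewrite -/(INR (S c)).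
evar_last.
  apply: is_derive_plus; first by apply: is_derive_scal; exact: H2.
  apply: (@is_derive_mult R_AbsRing); [exact: is_derive_id|exact: H1|exact: Rmult_comm].
rewrite /plus /mult /one /= Et; case: c {H0} => [|c]; ring.
Qed.

Lemma flat_vanishes k u : flat k u <-> forall j, (j < k)%nat -> Derive_n u j 0 = 0.
Proof.
elim: k u => [|k IH] u /=; first by split=> // _ j; lia.
split.
- move=> [H0 /IH H] [|j] Hj //; rewrite -Derive_n_Derive; apply: H; lia.
- move=> H; split; first by apply: (H 0%nat); lia.
  apply/IH => j Hj; rewrite Derive_n_Derive; apply: H; lia.
Qed.

Lemma vanishes_exactlyE k u : vanishes_exactly u k <-> flat k u /\ ~ flat (S k) u.
Proof.
rewrite /vanishes_exactly; split.
- move=> [H H0]; split; first exact/flat_vanishes.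
  by move/flat_vanishes => H1; apply: H0; apply: H1; lia.
- move=> [/flat_vanishes H H0]; split=> // E; apply: H0; apply/flat_vanishes => j Hj.
  by case: (PeanoNat.Nat.eq_dec j k) => [->//|Hjk]; apply: H; lia.
Qed.

(** * Hadamard's lemma *)

Definition box (r : R) (q : R2) : Prop := Rabs (fst q) < r /\ Rabs (snd q) < r.

Lemma box_open r : open (box r).
Proof.
move=> [x y] [/= Hx Hy].
have He : 0 < Rmin (r - Rabs x) (r - Rabs y) by apply: Rmin_pos; lra.
exists (mkposreal _ He) => -[u v] [/= H1 H2].
move: H1 H2; rewrite /ball /= /AbsRing_ball /= /abs /minus /plus /opp /= => H1 H2.
have := Rmin_l (r - Rabs x) (r - Rabs y); have := Rmin_r (r - Rabs x) (r - Rabs y).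
have := Rabs_triang (u + - x) x; have := Rabs_triang (v + - y) y.
rewrite !Rplus_assoc !Rplus_opp_l !Rplus_0_r => *; split => /=; lra.
Qed.

Lemma locally_box (P : R2 -> Prop) :
  locally ((0, 0) : R2) P -> exists r, 0 < r /\ forall q, box r q -> P q.
Proof.
move=> [e He]; exists e; split; first exact: cond_pos.
move=> [x y] [/= Hx Hy]; apply: He.
by split; rewrite /ball /= /AbsRing_ball /= /abs /minus /plus /opp /= Ropp_0 Rplus_0_r.
Qed.

Lemma box_locally r (P : R2 -> Prop) : 0 < r -> (forall q, box r q -> P q) -> locally ((0, 0) : R2) P.
Proof.
move=> Hr H; apply: filter_imp (box_open r (0, 0) _) => //.
by split => /=; rewrite Rabs_R0.
Qed.

Lemma interval_locally r (P : R -> Prop) : 0 < r -> (forall t, Rabs t < r -> P t) -> locally 0 P.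
Proof.
move=> Hr H; exists (mkposreal r Hr) => t.
rewrite /ball /= /AbsRing_ball /= /abs /minus /plus /opp /= Ropp_0 Rplus_0_r; exact: H.
Qed.

Lemma locally_interval (P : R -> Prop) :
  locally 0 P -> exists r, 0 < r /\ forall t, Rabs t < r -> P t.
Proof.
move=> [e He]; exists e; split; first exact: cond_pos.
move=> t Ht; apply: He.
by rewrite /ball /= /AbsRing_ball /= /abs /minus /plus /opp /= Ropp_0 Rplus_0_r.
Qed.

Lemma Rmin_01 : Rmin 0 1 = 0. Proof. by apply: Rmin_left; lra. Qed.

Lemma Rmax_01 : Rmax 0 1 = 1. Proof. by apply: Rmax_right; lra. Qed.

(* The integrals of t^j k(x, t y) over [0, 1], for all j and k, are closed under
   both partial derivatives; this makes the quotient in Hadamard's lemma smooth. *)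
Definition ray_moment (j : nat) (k : R2 -> R) (q : R2) : R :=
  RInt (fun s => s ^ j * k (fst q, s * snd q)) 0 1.


Lemma Cinf_continuity_2d g x y : Cinf g (x, y) -> continuity_2d_pt (fun u v => g (u, v)) x y.
Proof.
move=> /Cinf_cont H; apply/continuity_2d_pt_filterlim.
by apply: filterlim_ext H => -[].
Qed.

Lemma box_ray r q s : box r q -> 0 <= s <= 1 -> box r (fst q, s * snd q).
Proof.
move=> [H1 H2] Hs; split=> //=; rewrite Rabs_mult (Rabs_pos_eq s); last lra.
have := Rabs_pos (snd q); nra.
Qed.

Lemma Cinf_ray_integrand r j k q s : (forall q, box r q -> Cinf k q) -> box r q -> 0 <= s <= 1 ->
  Cinf (fun z => snd z ^ j * k (fst z, snd z * snd q)) (fst q, s).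
Proof.
move=> Hk Hq Hs; apply: Cinf_mult; first by apply: Cinf_pow; exact: Cinf_snd.
apply: (Cinf_comp k fst (fun z => snd z * snd q)).
- by apply: Hk; exact: box_ray.
- exact: Cinf_fst.
- by apply: Cinf_mult; [exact: Cinf_snd|exact: Cinf_const].
Qed.

Lemma continuous_ray_integrand r j k q s :
  (forall q, box r q -> Cinf k q) -> box r q -> 0 <= s <= 1 ->
  continuous (fun s => s ^ j * k (fst q, s * snd q)) s.
Proof.
move=> Hk Hq Hs; have [_ H] := Cinf_partials _ _ (Cinf_ray_integrand r j k q s Hk Hq Hs).
by apply: ex_derive_continuous; eexists; exact: H.
Qed.

Lemma ex_RInt_ray r j k q : (forall q, box r q -> Cinf k q) -> box r q ->
  ex_RInt (fun s => s ^ j * k (fst q, s * snd q)) 0 1.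
Proof.
move=> Hk Hq; apply: (@ex_RInt_continuous R_CompleteNormedModule) => s.
rewrite Rmin_01 Rmax_01; exact: (continuous_ray_integrand r).
Qed.

(** [k] is uniformly continuous on a compact box and s^j is at most 1 on [0, 1], so the integrands
    at [z] and [q] differ by less than eps / 2 everywhere; halving eps restores the strict
    inequality after integration. *)
Lemma ray_moment_continuous r j k q : (forall q, box r q -> Cinf k q) -> box r q ->
  continuous (ray_moment j k) q.
Proof.
move=> Hk Hq.
set m := Rmax (Rabs (fst q)) (Rabs (snd q)).
have Hm : m < r by apply: Rmax_lub_lt; case: Hq.
(* A radius strictly between the sup norm of [q] and [r]: the closed box of radius [r1] is compact,
   lies in the domain of smoothness and contains a neighbourhood of [q]. *)
pose r1 := (m + r) / 2.
have Hr1 : m < r1 < r by rewrite /r1; lra.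
have Hin : forall z, box r1 z -> box r z by move=> z [H1 H2]; split; lra.
have Hq1 : box r1 q.
  by split; [have := Rmax_l (Rabs (fst q)) (Rabs (snd q))|have := Rmax_r (Rabs (fst q)) (Rabs (snd q))];
     rewrite -/m; lra.
have Huc := uniform_continuity_2d (fun x y => k (x, y)) (-r1) r1 (-r1) r1.
apply/filterlim_locally => eps.
have He : 0 < eps / 2 by have := cond_pos eps; lra.
case: (Huc _ (mkposreal _ He)) => [x y Hx Hy|d Hd].
  apply: Cinf_continuity_2d; apply: Hk; split => /=; apply: Rabs_def1; lra.
have Hbox : locally q (fun z => box r1 z /\ ball q d z).
  by apply: filter_and; [exact: box_open|exact: locally_ball].
apply: filter_imp Hbox => z [Hz [Hb1 Hb2]].
rewrite /ball /= /AbsRing_ball /= /abs /minus /plus /opp /=.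
have Hzr := Hin _ Hz.
have -> : ray_moment j k z + - ray_moment j k q =
  RInt (fun s => minus (s ^ j * k (fst z, s * snd z)) (s ^ j * k (fst q, s * snd q))) 0 1.
  rewrite (@RInt_minus R_CompleteNormedModule) //; exact: (ex_RInt_ray r).
apply: (Rle_lt_trans _ ((1 - 0) * (eps / 2))); last by have := cond_pos eps; lra.
apply: abs_RInt_le_const; first lra.
  by apply: (@ex_RInt_minus R_CompleteNormedModule); exact: (ex_RInt_ray r).
move=> s Hs; rewrite /minus /plus /opp /=.
have -> : s ^ j * k (fst z, s * snd z) + - (s ^ j * k (fst q, s * snd q)) =
  s ^ j * (k (fst z, s * snd z) - k (fst q, s * snd q)) by ring.
rewrite Rabs_mult.
have Hsj : 0 <= s ^ j <= 1.
  by split; [apply: pow_le; lra|rewrite -(pow1 j); apply: pow_incr; lra].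
rewrite (Rabs_pos_eq (s ^ j)); last lra.
have [/Rabs_def2 A1 /Rabs_def2 A2] := box_ray _ _ s Hz Hs.
have [/Rabs_def2 A3 /Rabs_def2 A4] := box_ray _ _ s Hq1 Hs.
move: Hb1 Hb2; rewrite /ball /= /AbsRing_ball /= /abs /minus /plus /opp /= => Hb1 Hb2.
have : Rabs (k (fst z, s * snd z) - k (fst q, s * snd q)) < eps / 2.
  apply: Hd; move=> /=; move: A1 A2 A3 A4 => /= *; try lra.
  + exact: Hb1.
  have -> : s * snd z - s * snd q = s * (snd z + - snd q) by ring.
  rewrite Rabs_mult (Rabs_pos_eq s); last lra.
  apply: (Rle_lt_trans _ (1 * Rabs (snd z + - snd q))); last by rewrite Rmult_1_l.
  by apply: Rmult_le_compat_r; [exact: Rabs_pos|lra].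
move=> Hlt; apply: (Rle_trans _ (1 * Rabs (k (fst z, s * snd z) - k (fst q, s * snd q)))).
- by apply: Rmult_le_compat_r; [exact: Rabs_pos|lra].
- by rewrite Rmult_1_l; apply: Rlt_le.
Qed.

Lemma ray_moment_partials r j k q : (forall q, box r q -> Cinf k q) -> box r q ->
  partials (ray_moment j k) (ray_moment j (dx k)) (ray_moment (S j) (dy k)) q.
Proof.
move=> Hk Hq.
have Hdx : forall q, box r q -> Cinf (dx k) q by move=> z Hz; apply: Cinf_dx; exact: Hk.
have Hdy : forall q, box r q -> Cinf (dy k) q by move=> z Hz; apply: Cinf_dy; exact: Hk.
have Hbox := box_open r q Hq.
split.
- rewrite /ray_moment /=.
  evar_last.
    apply: (is_derive_RInt_param (fun u t => t ^ j * k (u, t * snd q)) 0 1).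
  + apply: filter_imp (slice_x _ _ Hbox) => x Hx t.
    rewrite Rmin_01 Rmax_01 => Ht.
    have [H _] := Cinf_partials _ _ (Cinf_ray_integrand r j k _ t Hk Hx Ht).
    by eexists; exact: H.
  + move=> t; rewrite Rmin_01 Rmax_01 => Ht.
    apply: (continuity_2d_pt_ext (fun u v => v ^ j * dx k (u, v * snd q))).
      by move=> u v; rewrite Derive_scal.
    exact: Cinf_continuity_2d (Cinf_ray_integrand r j _ q t Hdx Hq Ht).
  + apply: filter_imp (slice_x _ _ Hbox) => x Hx; exact: (ex_RInt_ray r j k (x, snd q)).
  + by apply: RInt_ext => s _; rewrite Derive_scal.
- rewrite /ray_moment /=.
  have Hd : forall u t, box r (fst q, t * u) ->
     is_derive (fun z => t ^ j * k (fst q, t * z)) u (t ^ S j * dy k (fst q, t * u)).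
    move=> u t Hu.
    have [_ H] := Cinf_partials _ _ (Hk _ Hu).
    evar_last.
      apply: is_derive_scal; apply: (is_derive_comp (fun y => k (fst q, y)) (fun z => t * z)).
      exact: H.
      by apply: is_derive_scal; exact: is_derive_id.
    rewrite /scal /= /mult /one /=; ring.
  evar_last.
    apply: (is_derive_RInt_param (fun u t => t ^ j * k (fst q, t * u)) 0 1).
  + apply: filter_imp (slice_y _ _ Hbox) => y Hy t.
    rewrite Rmin_01 Rmax_01 => Ht.
    by eexists; apply: Hd; exact: (box_ray r (fst q, y)).
  + move=> t; rewrite Rmin_01 Rmax_01 => Ht.
    apply: (continuity_2d_pt_ext_loc (fun u v => v ^ S j * dy k (fst q, v * u))).
      apply/locally_2d_locally.
      have : locally ((snd q, t) : R2) (fun z => box r (fst q, snd z * fst z)).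
        apply: (filterlim_pair_locally (fun _ => fst q) (fun z => snd z * fst z)).
        - exact: continuous_const.
        - by apply: Cinf_cont; apply: Cinf_mult; [exact: Cinf_snd|exact: Cinf_fst].
        - by apply: box_open; exact: box_ray.
      apply: filter_imp => -[u v] /= Huv; symmetry; apply: is_derive_unique.
      exact: Hd.
    apply: (Cinf_continuity_2d (fun z => snd z ^ S j * dy k (fst q, snd z * fst z))).
    apply: Cinf_mult; first by apply: Cinf_pow; exact: Cinf_snd.
    apply: (Cinf_comp (dy k) (fun _ => fst q) (fun z => snd z * fst z)).
    * by apply: Hdy; exact: box_ray.
    * exact: Cinf_const.
    * by apply: Cinf_mult; [exact: Cinf_snd|exact: Cinf_fst].
  + apply: filter_imp (slice_y _ _ Hbox) => y Hy; exact: (ex_RInt_ray r j k (fst q, y)).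
  + apply: RInt_ext => s; rewrite Rmin_01 Rmax_01 => Hs.
    by apply: is_derive_unique; apply: Hd; apply: box_ray => //; lra.
Qed.

Lemma Ck_ray_moment r n j k q : (forall q, box r q -> Cinf k q) -> box r q ->
  Ck n (ray_moment j k) q.
Proof.
elim: n j k q => [|n IH] j k q Hk Hq.
all: have Hc : locally q (fun z => continuous (ray_moment j k) z)
  by apply: filter_imp (box_open r q Hq) => z; exact: (ray_moment_continuous r).
  by [].
split=> //; exists (ray_moment j (dx k)), (ray_moment (S j) (dy k)); split; [|split].
- by apply: IH => // z Hz; apply: Cinf_dx; exact: Hk.
- by apply: IH => // z Hz; apply: Cinf_dy; exact: Hk.
- by apply: filter_imp (box_open r q Hq) => z; exact: (ray_moment_partials r).
Qed.

(** The fundamental theorem of calculus on the vertical segment from (x, 0) to (x, y) gives k(x, y)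
    = y times the integral of k_y(x, s y) over s in [0, 1]. On the axis the integrand is constant,
    hence the value of B there. *)
Lemma hadamard k : Cinf k (0, 0) -> locally 0 (fun x => k (x, 0) = 0) ->
  exists B, [/\ Cinf B (0, 0), locally 0 (fun x => B (x, 0) = dy k (x, 0)) &
    locally ((0, 0) : R2) (fun q => k q = snd q * B q)].
Proof.
move=> Hk H0.
have [r [Hr Hbox]] := locally_box _ (filter_and _ _ (Cinf_locally _ _ Hk) (locally_fst _ (0, 0) H0)).
have Hk1 : forall q, box r q -> Cinf k q by move=> q /Hbox [].
have Hdy : forall q, box r q -> Cinf (dy k) q by move=> q Hq; apply: Cinf_dy; exact: Hk1.
exists (ray_moment 0 (dy k)); split.
- by apply: (box_locally r) => // q Hq n; exact: (Ck_ray_moment r).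
- apply: filter_forall => x; rewrite /ray_moment -[RHS]Rmult_1_l -{2}(Rminus_0_r 1) -[RHS](@RInt_const R_CompleteNormedModule).
  by apply: RInt_ext => s _ /=; rewrite Rmult_0_r Rmult_1_l.
apply: (box_locally r) => // q Hq.
have E : is_RInt (fun s => scal (snd q) (s ^ 0 * dy k (fst q, s * snd q))) 0 1
   (minus (k (fst q, 1 * snd q)) (k (fst q, 0 * snd q))).
  apply: (is_RInt_derive (fun s => k (fst q, s * snd q))) => s;
    rewrite Rmin_01 Rmax_01 => Hs.
  - have [_ H] := Cinf_partials _ _ (Hk1 _ (box_ray _ _ s Hq Hs)).
    evar_last.
      apply: (is_derive_comp (fun y => k (fst q, y)) (fun z => z * snd q)).
      exact: H.
      by auto_derive.
    rewrite /scal /= /mult /=; ring.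
  - apply: continuous_scal_r; exact: (continuous_ray_integrand r).
have := is_RInt_unique _ _ _ _ E.
rewrite RInt_scal; last exact: (ex_RInt_ray r).
rewrite /ray_moment Rmult_1_l Rmult_0_l.
have -> : k (fst q, 0) = 0 by case: (Hbox q Hq).
have -> : k (fst q, snd q) = k q by case: (q).
by rewrite /minus /plus /opp /scal /= /mult /= => ->; ring.
Qed.

(** * Implicit functions *)

Lemma continuous_slice_x (g : R2 -> R) q :
  continuous g q -> continuous (fun x => g (x, snd q)) (fst q).
Proof. by case: q => x y H P HP; exact: (slice_x (fun s => P (g s)) (x, y) (H P HP)). Qed.

Lemma continuous_slice_y (g : R2 -> R) q :
  continuous g q -> continuous (fun y => g (fst q, y)) (snd q).
Proof. by case: q => x y H P HP; exact: (slice_y (fun s => P (g s)) (x, y) (H P HP)). Qed.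

Lemma Cinf_neq0 g q : Cinf g q -> g q <> 0 -> locally q (fun s => g s <> 0).
Proof. by move=> /Cinf_cont H H0; apply: (H (fun x => x <> 0)); exact: open_neq. Qed.

Lemma Cinf_gt0 g q : Cinf g q -> 0 < g q -> locally q (fun s => 0 < g s).
Proof. by move=> /Cinf_cont H H0; apply: (H (fun x => 0 < x)); exact: open_gt. Qed.

(** Hadamard's lemma applied k times, with u read as a function of the second coordinate. The
    quotient stays flat to one order less by [flat_id_mult]. *)
Lemma flat_factor k u : smooth0 u -> flat k u ->
  exists v, smooth0 v /\ locally 0 (fun t => u t = t ^ k * v t).
Proof.
elim: k u => [|k IH] u Hu HV.
  by exists u; split=> //; apply: filter_forall => t /=; ring.
have [||B [HB B0 E]] := hadamard (fun q => u (snd q)).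
- by apply: (Cinf_comp (fun s => u (fst s)) snd (fun _ => 0)) => //; [exact: Cinf_snd|exact: Cinf_const].
- by apply: filter_forall => t /=; case: HV.
have Hv : smooth0 (fun t => B (0, t)) by apply: smooth0_comp => //; solve_smooth0.
have E' : locally 0 (fun t => u t = t * B (0, t)).
  have := locally_along _ (fun _ => 0) (fun t => t) 0 _ _ E; apply; last exact: continuous_id.
  exact: continuous_const.
have HV' : flat k (fun t => B (0, t)) by apply: flat_id_mult => //; exact: flat_ext E' HV.
have [v [Hvs Ev]] := IH _ Hv HV'.
exists v; split=> //; apply: filter_imp (filter_and _ _ E' Ev) => t [-> ->] /=; ring.
Qed.

Lemma lipschitz_continuous M (f : R -> R) x :
  (forall y z, Rabs (f y - f z) <= M * Rabs (y - z)) -> continuous f x.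
Proof.
move=> H; apply/filterlim_locally => eps.
have HM : 0 <= M by have := H 1 0; have := Rabs_pos (f 1 - f 0); rewrite Rminus_0_r Rabs_R1; lra.
(* [M + 1] rather than [M] keeps the divisor positive when M = 0. *)
have He : 0 < eps / (M + 1) by apply: Rdiv_lt_0_compat; [exact: cond_pos|lra].
exists (mkposreal _ He) => y.
rewrite /ball /= /AbsRing_ball /= /abs /minus /plus /opp /= => Hy.
apply: (Rle_lt_trans _ _ _ (H y x)).
apply: (Rle_lt_trans _ ((M + 1) * Rabs (y + - x))).
  by apply: Rmult_le_compat_r; [exact: Rabs_pos|lra].
apply: (Rlt_le_trans _ ((M + 1) * (eps / (M + 1)))); first by apply: Rmult_lt_compat_l => //; lra.
by right; field; lra.
Qed.

(** Retraction of the line onto [-b, b]. Precomposing with it turns a function controlled only on a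
    box into one that is continuous, bounded or Lipschitz everywhere, as the intermediate value
    theorem and the Picard iteration below require. *)
Definition clamp (b z : R) : R := Rmax (- b) (Rmin b z).

Lemma clamp_bound b z : 0 <= b -> Rabs (clamp b z) <= b.
Proof.
move=> Hb; apply: Rabs_le; split; first exact: Rmax_l.
by apply: Rmax_lub; [lra|exact: Rmin_l].
Qed.

Lemma clamp_id b z : Rabs z <= b -> clamp b z = z.
Proof. by move=> /Rabs_le_between H; rewrite /clamp Rmin_right ?Rmax_right; lra. Qed.

Lemma clamp_lipschitz b z z' : Rabs (clamp b z - clamp b z') <= 1 * Rabs (z - z').
Proof.
by rewrite /clamp /Rmax /Rmin Rmult_1_l; repeat destruct Rle_dec; split_Rabs; lra.
Qed.

Lemma clamp_continuous b z : continuous (clamp b) z.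
Proof. by apply: (lipschitz_continuous 1) => y y'; exact: clamp_lipschitz. Qed.

(** Since a(x) = 0, the difference quotient of the product is that of a times e(x + h), so mere
    continuity of e is enough. This is how differentiability is extracted for factors known only to
    be continuous. *)
Lemma is_derive_mult_zero (a e : R -> R) (x l : R) :
  is_derive a x l -> a x = 0 -> continuous e x ->
  is_derive (fun t => a t * e t) x (l * e x).
Proof.
move=> /is_derive_Reals Ha H0 He; apply/is_derive_Reals.
have L1 : is_lim (fun h => (a (x + h) - a x) / h) 0 l.
  apply/is_lim_spec => eps; have [d Hd] := Ha eps (cond_pos eps).
  exists d => h; rewrite /ball /= /AbsRing_ball /= /abs /minus /plus /opp /= Ropp_0 Rplus_0_r => Hh Hh0.
  exact: Hd.
have L2 : is_lim (fun h => e (x + h)) 0 (e x).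
  apply: (is_lim_comp_continuous (fun h => x + h) e 0 x) => //.
  have H : continuous (fun h => x + h) 0.
    by apply: (continuous_plus (fun _ => x) (fun h => h)); [exact: continuous_const|exact: continuous_id].
  by have := is_lim_continuity _ _ (proj2 (continuity_pt_filterlim _ _) H); rewrite Rplus_0_r.
have L := is_lim_mult _ _ _ _ _ L1 L2 I.
move=> eps Heps; have /is_lim_spec/(_ (mkposreal _ Heps)) [d Hd] := L.
exists d => h Hh0 Hh; have := Hd h.
rewrite /ball /= /AbsRing_ball /= /abs /minus /plus /opp /= Ropp_0 Rplus_0_r => /(_ Hh Hh0).
by rewrite H0 /Rdiv; congr (Rabs _ < _); ring.
Qed.

(** Mean value theorem on a vertical segment. The lower bound makes roots on a fibre unique and,
    with the parameters varying, continuous. *)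
Lemma fibre_lipschitz K r m x z z' :
  (forall q, box r q -> Cinf K q) -> (forall q, box r q -> m <= dy K q) ->
  Rabs x < r -> Rabs z < r -> Rabs z' < r -> z' <= z ->
  m * (z - z') <= K (x, z) - K (x, z').
Proof.
move=> HK Hm Hx /Rabs_def2 Hz /Rabs_def2 Hz' Hle.
have Hd : forall y, z' <= y <= z -> is_derive (fun y => K (x, y)) y (dy K (x, y)).
  move=> y Hy; have Hb : box r (x, y) by split => //=; apply: Rabs_def1; lra.
  by have [_] := Cinf_partials _ _ (HK _ Hb).
have [| |c [Hc ->]] := MVT_gen (fun y => K (x, y)) z' z (fun y => dy K (x, y)).
- by rewrite Rmin_left // Rmax_right // => y Hy; apply: Hd; lra.
- rewrite Rmin_left // Rmax_right // => y Hy; apply/continuity_pt_filterlim.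
  by apply: ex_derive_continuous; eexists; exact: Hd.
move: Hc; rewrite Rmin_left // Rmax_right // => Hc.
apply: Rmult_le_compat_r; first lra.
by apply: Hm; split => //=; apply: Rabs_def1; lra.
Qed.

Lemma fibre_lipschitz_abs K r m x z z' :
  (forall q, box r q -> Cinf K q) -> (forall q, box r q -> m <= dy K q) -> 0 < m ->
  Rabs x < r -> Rabs z < r -> Rabs z' < r ->
  m * Rabs (z - z') <= Rabs (K (x, z) - K (x, z')).
Proof.
move=> HK Hm Hm0 Hx Hz Hz'.
case: (Rle_or_lt z' z) => H.
- have := fibre_lipschitz K r m x z z' HK Hm Hx Hz Hz' H.
  rewrite (Rabs_pos_eq (z - z')); last lra.
  by move/Rle_trans; apply; exact: Rle_abs.
- have := fibre_lipschitz K r m x z' z HK Hm Hx Hz' Hz (Rlt_le _ _ H).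
  rewrite Rabs_minus_sym (Rabs_minus_sym (K _)) (Rabs_pos_eq (z' - z)); last lra.
  by move/Rle_trans; apply; exact: Rle_abs.
Qed.

Lemma fibre_root K r b x Y :
  (forall q, box r q -> Cinf K q) -> 0 < b < r -> Rabs x < r ->
  K (x, - b) < Y < K (x, b) -> exists z, Rabs z < r /\ K (x, z) = Y.
Proof.
move=> HK Hb Hx HY.
have Hbox : forall z, box r (x, clamp b z).
  by move=> z; split => //=; have := clamp_bound b z; lra.
have Eb : clamp b b = b by apply: clamp_id; rewrite Rabs_pos_eq; lra.
have Eb' : clamp b (- b) = - b by apply: clamp_id; rewrite Rabs_Ropp Rabs_pos_eq; lra.
have [| |z [Hz HzY]] := IVT_gen (fun z => K (x, clamp b z) - Y) (-b) b 0.
- move=> z; apply/continuity_pt_filterlim.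
  apply: (continuous_minus (fun z => K (x, clamp b z)) (fun _ => Y)); last exact: continuous_const.
  apply: (continuous_comp (clamp b) (fun y => K (x, y))); first exact: clamp_continuous.
  by apply: ex_derive_continuous; eexists; case: (Cinf_partials _ _ (HK _ (Hbox z))) => _ H; exact: H.
- by rewrite Eb Eb' Rmin_left ?Rmax_right; lra.
by exists (clamp b z); split; [case: (Hbox z)|lra].
Qed.

(* The local root depends on the parameters as smoothly as K: psi solves the
   differential system psi_x = - K_x / K_y, psi_y = 1 / K_y along its graph. *)
Lemma root_partials K psi q :
  Cinf K (fst q, psi q) -> dy K (fst q, psi q) <> 0 -> continuous psi q ->
  locally q (fun s => K (fst s, psi s) = snd s) ->
  partials psi (fun s => - dx K (fst s, psi s) * / dy K (fst s, psi s))
               (fun s => / dy K (fst s, psi s)) q.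
Proof.
case: q => x0 y0 /=; set z0 := psi (x0, y0) => HK Hnz Hc Hroot.
have [||B [HB B0 E]] := hadamard (fun s => K (x0 + fst s, z0 + snd s) - K (x0 + fst s, z0)).
- apply: Cinf_minus.
  + apply: (Cinf_comp K (fun s => x0 + fst s) (fun s => z0 + snd s)).
    * by rewrite /= !Rplus_0_r.
    * by apply: Cinf_plus; [exact: Cinf_const|exact: Cinf_fst].
    * by apply: Cinf_plus; [exact: Cinf_const|exact: Cinf_snd].
  + apply: (Cinf_comp K (fun s => x0 + fst s) (fun s => z0)).
    * by rewrite /= !Rplus_0_r.
    * by apply: Cinf_plus; [exact: Cinf_const|exact: Cinf_fst].
    * exact: Cinf_const.
- by apply: filter_forall => x /=; rewrite Rplus_0_r; ring.
have [HKx HKy] := Cinf_partials _ _ HK.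
have {}B0 : B (0, 0) = dy K (x0, z0).
  rewrite (locally_singleton _ _ B0) /dy /=; apply: is_derive_unique.
  evar_last.
    apply: (is_derive_minus (fun y => K (x0 + 0, z0 + y)) (fun _ => K (x0 + 0, z0))); last exact: is_derive_const.
    apply: (is_derive_comp (fun y => K (x0 + 0, y)) (fun y => z0 + y)).
      by rewrite !Rplus_0_r; exact: HKy.
    by auto_derive.
  by rewrite /minus /plus /opp /scal /zero /= /mult /dy /=; ring.
(* On the graph, D = K(x, psi) - K(x, z0) = (psi - z0) B, so psi = z0 + D e with e = 1 / B evaluated
   along psi. Here D has explicit partial derivatives and vanishes at the base point, while e is
   continuous because psi is; [is_derive_mult_zero] then differentiates psi. *)
pose D s := snd s - K (fst s, z0).
pose e s := / B (fst s - x0, psi s - z0).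
have C1 : continuous (fun s : R2 => fst s - x0) (x0, y0).
  apply: (@continuous_minus _ R_AbsRing R_NormedModule fst (fun _ => x0)); [exact: continuous_fst|exact: continuous_const].
have C2 : continuous (fun s : R2 => psi s - z0) (x0, y0).
  apply: (@continuous_minus _ R_AbsRing R_NormedModule psi (fun _ => z0)); [exact: Hc|exact: continuous_const].
have Ce : continuous e (x0, y0).
  apply: (continuous_comp (fun s => B (fst s - x0, psi s - z0)) Rinv); last first.
    by apply: continuous_Rinv; rewrite /= -/z0 !Rminus_eq_0 B0.
  apply: (continuous_comp (fun s => (fst s - x0, psi s - z0)) B); last first.
    by rewrite /= -/z0 !Rminus_eq_0; exact: Cinf_cont.
  exact: continuous_pair.
have E0 : e (x0, y0) = / dy K (x0, z0) by rewrite /e /= -/z0 !Rminus_eq_0 B0.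
have D0 : D (x0, y0) = 0 by have /= := locally_singleton _ _ Hroot; rewrite /D /= -/z0 => ->; ring.
have Eps : locally ((x0, y0) : R2) (fun s => z0 + D s * e s = psi s).
  have L0 : locally ((x0, y0) : R2) (fun s => B (fst s - x0, psi s - z0) <> 0).
    apply: (filterlim_pair_locally (fun s => fst s - x0) (fun s => psi s - z0) _ (fun r => B r <> 0)) => //=.
    by rewrite -/z0 !Rminus_eq_0; apply: Cinf_neq0 => //; rewrite B0.
  have L1 : locally ((x0, y0) : R2) (fun s => K (x0 + (fst s - x0), z0 + (psi s - z0)) -
      K (x0 + (fst s - x0), z0) = (psi s - z0) * B (fst s - x0, psi s - z0)).
    have := filterlim_pair_locally (fun s => fst s - x0) (fun s => psi s - z0) (x0, y0) _ C1 C2.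
    by move=> /= H; apply: (H (fun r => K (x0 + fst r, z0 + snd r) - K (x0 + fst r, z0) = snd r * B r));
      rewrite -/z0 !Rminus_eq_0.
  apply: filter_imp (filter_and _ _ Hroot (filter_and _ _ L0 L1)) => s [Hs [H0 H1]].
  have E2 : D s = (psi s - z0) * B (fst s - x0, psi s - z0).
    have -> : D s = K (fst s, psi s) - K (fst s, z0) by rewrite /D Hs.
    rewrite -H1 (_ : x0 + (fst s - x0) = fst s); last ring.
    by rewrite (_ : z0 + (psi s - z0) = psi s); last ring.
  have -> : e s = / B (fst s - x0, psi s - z0) by [].
  by rewrite E2; field.
apply: (partials_ext _ _ _ _ _ Eps).
have HD1 : is_derive (fun x => D (x, y0)) x0 (- dx K (x0, z0)).
  rewrite /D /=; evar_last.
    apply: (is_derive_minus (fun _ => y0) (fun x => K (x, z0))); [exact: is_derive_const|exact: HKx].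
  by rewrite /minus /plus /opp /zero /=; ring.
have HD2 : is_derive (fun y => D (x0, y)) y0 1.
  rewrite /D /=; auto_derive => //; ring.
split => /=.
- evar_last.
    apply: (is_derive_plus (fun _ => z0) (fun x => D (x, y0) * e (x, y0))); first exact: is_derive_const.
    apply: is_derive_mult_zero; [exact: HD1|exact: D0|].
    exact: (continuous_slice_x e (x0, y0)).
  by rewrite /plus /zero /= E0 -/z0; ring.
- evar_last.
    apply: (is_derive_plus (fun _ => z0) (fun y => D (x0, y) * e (x0, y))); first exact: is_derive_const.
    apply: is_derive_mult_zero; [exact: HD2|exact: D0|].
    exact: (continuous_slice_y e (x0, y0)).
  by rewrite /plus /zero /= E0 -/z0; ring.
Qed.

(** Inverse function theorem for the map (x, y) to (x, K(x, y)): monotonicity on the fibres reduces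
    it to the intermediate value theorem. Treating one coordinate at a time is enough, because every
    coordinate change below is triangular. *)
Lemma shear_inverse K :
  Cinf K (0, 0) -> K (0, 0) = 0 -> 0 < dy K (0, 0) ->
  exists psi, [/\ Cinf psi (0, 0), psi (0, 0) = 0,
    locally ((0, 0) : R2) (fun q => K (fst q, psi q) = snd q) &
    locally ((0, 0) : R2) (fun q => psi (fst q, K q) = snd q)].
Proof.
move=> HK K0 Hy; set m := dy K (0, 0) / 2.
have Hm : 0 < m by rewrite /m; lra.
have HKm : Cinf (fun q => dy K q - m) (0, 0).
  by apply: Cinf_minus; [exact: Cinf_dy|exact: Cinf_const].
have Hgt : 0 < dy K (0, 0) - m by rewrite /m; lra.
have [r [Hr Hbox]] := locally_box _ (filter_and _ _ (Cinf_locally _ _ HK) (Cinf_gt0 _ _ HKm Hgt)).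
have HKr : forall q, box r q -> Cinf K q by move=> q /Hbox [].
have Hmr : forall q, box r q -> m <= dy K q by move=> q /Hbox [_]; lra.
have inj : forall x z z', Rabs x < r -> Rabs z < r -> Rabs z' < r ->
    K (x, z) = K (x, z') -> z = z'.
  move=> x z z' Hx Hz Hz' E.
  have := fibre_lipschitz_abs K r m x z z' HKr Hmr Hm Hx Hz Hz'.
  rewrite E Rminus_eq_0 Rabs_R0 => H.
  have := Rabs_pos (z - z'); case: (Req_dec (z - z') 0) => [|/Rabs_pos_lt]; [lra|nra].
(* The root of modulus below r is unique by [inj]. Where no such root exists the value is arbitrary,
   which does no harm outside the box of radius [r2] below. *)
pose psi q := epsilon (inhabits 0) (fun z => Rabs z < r /\ K (fst q, z) = snd q).
have psi_spec : forall q, (exists z, Rabs z < r /\ K (fst q, z) = snd q) ->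
    Rabs (psi q) < r /\ K (fst q, psi q) = snd q.
  by move=> q H; exact: (epsilon_spec (inhabits 0) _ H).
have psiK : forall q, box r q -> psi (fst q, K q) = snd q.
  move=> q [Hq1 Hq2]; have [|H1 H2] := psi_spec (fst q, K q).
    by exists (snd q); split=> //=; case: (q).
  by apply: (inj (fst q)) => //; rewrite H2; case: (q).
pose b := r / 2; have Hb : 0 < b < r by rewrite /b; lra.
have R0 : Rabs 0 < r by rewrite Rabs_R0.
have Hbr : Rabs b < r by rewrite Rabs_pos_eq; lra.
have Hbr' : Rabs (- b) < r by rewrite Rabs_Ropp.
have Kb : 0 < K (0, b).
  by have := fibre_lipschitz K r m 0 b 0 HKr Hmr R0 Hbr R0; rewrite K0; nra.
have Kb' : K (0, - b) < 0.
  by have := fibre_lipschitz K r m 0 0 (- b) HKr Hmr R0 R0 Hbr'; rewrite K0; nra.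
(* The inequalities K(0, -b) < 0 < K(0, b) are strict and so persist near the origin; they supply
   the sign change for the intermediate value theorem. *)
have Hnear : locally ((0, 0) : R2) (fun q => box r q /\ K (fst q, - b) < snd q < K (fst q, b)).
  have C : forall c, Rabs c < r -> Cinf (fun q => K (fst q, c)) (0, 0).
    move=> c Hc; apply: (Cinf_comp K fst (fun _ => c)); [|exact: Cinf_fst|exact: Cinf_const].
    exact: HKr.
  have C1 := Cinf_gt0 _ _ (Cinf_minus _ _ _ (C b Hbr) (Cinf_snd (0, 0))).
  have C2 := Cinf_gt0 _ _ (Cinf_minus _ _ _ (Cinf_snd (0, 0)) (C _ Hbr')).
  have Hb0 : locally ((0, 0) : R2) (box r) by apply: (box_locally r).
  apply: filter_imp (filter_and _ _ Hb0 (filter_and _ _ (C1 _) (C2 _))) => /=; try lra.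
  by move=> q [H1 [H2 H3]]; split=> //; lra.
have [r2 [Hr2 Hbox2]] := locally_box _ Hnear.
have spec2 : forall q, box r2 q -> Rabs (psi q) < r /\ K (fst q, psi q) = snd q.
  move=> q /Hbox2 [[H1 _] H2]; apply: psi_spec; exact: (fibre_root K r b).
have cont : forall q, box r2 q -> continuous psi q.
  move=> q Hq; have [H1 H2] := spec2 q Hq; have [[Hx _] _] := Hbox2 q Hq.
  (* With the ordinate frozen at psi(q), this function vanishes at q, and its modulus at s is at
     least m |psi(s) - psi(q)|. Its continuity thus gives that of psi. *)
  have CK : continuous (fun s => snd s - K (fst s, psi q)) q.
    apply: Cinf_cont; apply: Cinf_minus; first exact: Cinf_snd.
    apply: (Cinf_comp K fst (fun _ => psi q)); [exact: HKr|exact: Cinf_fst|exact: Cinf_const].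
  apply/filterlim_locally => eps.
  have He : 0 < m * eps by apply: Rmult_lt_0_compat => //; exact: cond_pos.
  have L : locally q (fun s => ball (snd q - K (fst q, psi q)) (m * eps) (snd s - K (fst s, psi q))) :=
    CK _ (locally_ball _ (mkposreal _ He)).
  apply: filter_imp (filter_and _ _ L (box_open r2 q Hq)) => s.
  rewrite /ball /= /AbsRing_ball /= /abs /minus /plus /opp /= => -[L1 Hs].
  have [H3 H4] := spec2 s Hs; have [[Hx2 _] _] := Hbox2 s Hs.
  have := fibre_lipschitz_abs K r m (fst s) (psi s) (psi q) HKr Hmr Hm Hx2 H3 H1.
  move: L1; rewrite H2 Rminus_eq_0 Ropp_0 Rplus_0_r H4 => L1 L2.
  by apply: (Rmult_lt_reg_l m) => //; apply: Rle_lt_trans L1; exact: L2.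
have part : forall q, box r2 q -> partials psi (fun s => - dx K (fst s, psi s) * / dy K (fst s, psi s))
               (fun s => / dy K (fst s, psi s)) q.
  move=> q Hq; have [H1 H2] := spec2 q Hq; have [[Hx _] _] := Hbox2 q Hq.
  have Hbq : box r (fst q, psi q) by [].
  apply: root_partials; [exact: HKr|by apply: Rgt_not_eq; apply: Rlt_le_trans (Hmr _ Hbq)|exact: cont|].
  by apply: filter_imp (box_open r2 q Hq) => s /spec2 [].
exists psi; split.
(* Bootstrap: the partial derivatives of psi are smooth functions of (x, psi), hence of class C^n as
   soon as psi is. *)
- apply: (box_locally r2) => // q Hq; apply: Cinf_of_partials.
  + by apply: filter_imp (box_open r2 q Hq) => s; exact: part.
  + move=> n Hn; have [H1 H2] := spec2 q Hq; have [[Hx _] _] := Hbox2 q Hq.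
    have Hbq : box r (fst q, psi q) by [].
    have Hnz : dy K (fst q, psi q) <> 0 by apply: Rgt_not_eq; apply: Rlt_le_trans (Hmr _ Hbq).
    have CI : Cinf (fun s => / dy K s) (fst q, psi q).
      by apply: Cinf_inv => //; apply: Cinf_dy; exact: HKr.
    have Cf : Ck n fst q by apply: Cinf_Ck; exact: Cinf_fst.
    split; last by apply: (Ck_comp n (fun s => / dy K s) fst psi) => //; exact: Cinf_Ck.
    apply: (Ck_comp n (fun s => - dx K s * / dy K s) fst psi) => //.
    by apply: Cinf_Ck; apply: Cinf_mult => //; apply: Cinf_opp; apply: Cinf_dx; exact: HKr.
  + by split=> //; apply: filter_imp (box_open r2 q Hq) => s; exact: cont.
- by have := psiK (0, 0); rewrite /= K0; apply.
- by apply: (box_locally r2) => // q /spec2 [].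
- by apply: (box_locally r).
Qed.

(** * Local existence for a smooth scalar differential equation *)

Lemma RInt_bound (f : R -> R) M c d :
  (forall s, continuous f s) -> (forall s, Rmin c d <= s <= Rmax c d -> Rabs (f s) <= M) ->
  Rabs (RInt f c d) <= M * Rabs (d - c).
Proof.
move=> Hf; wlog Hcd : c d / c <= d => [W|].
  move=> HM; case: (Rle_or_lt c d) => H; first exact: W.
  rewrite -(opp_RInt_swap f); last by apply: (@ex_RInt_continuous R_CompleteNormedModule) => s _; exact: Hf.
  rewrite /opp /= Rabs_Ropp Rabs_minus_sym; apply: W; first lra.
  by rewrite Rmin_comm Rmax_comm.
rewrite Rmin_left // Rmax_right // => HM.
rewrite (Rabs_pos_eq (d - c)); last lra.
rewrite Rmult_comm.
apply: abs_RInt_le_const => //.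
by apply: (@ex_RInt_continuous R_CompleteNormedModule) => s _; exact: Hf.
Qed.

Section Picard.

Variables (G : R2 -> R) (M L a : R).

(** Clamping the end point makes every iterate a function on the whole line, constant outside
    [-a, a]; the estimates then hold for all x. *)
Definition picard (u : R -> R) (x : R) : R := RInt (fun s => G (s, u s)) 0 (clamp a x).

Fixpoint picard_iter (n : nat) : R -> R :=
  match n with
  | O => fun _ => 0
  | S m => picard (picard_iter m)
  end.

Definition picard_limit (x : R) : R := real (Lim_seq (fun n => picard_iter n x)).

Hypotheses (Ha : 0 < a) (HL : L * a <= / 2) (HL0 : 0 <= L) (HM0 : 0 <= M).
Hypotheses (HG : forall q, continuous G q) (HM : forall q, Rabs (G q) <= M).
Hypothesis (HGL : forall x y y', Rabs (G (x, y) - G (x, y')) <= L * Rabs (y - y')).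

Lemma picard_integrand_continuous u s :
  continuous u s -> continuous (fun s => G (s, u s)) s.
Proof.
move=> Hu; apply: (continuous_comp (fun s => (s, u s)) G) => //.
move=> P HP; exact: (locally_along P (fun s => s) u s (continuous_id s) Hu HP).
Qed.

Lemma picard_integrand_ex u c d :
  (forall s, continuous u s) -> ex_RInt (fun s => G (s, u s)) c d.
Proof.
move=> Hu; apply: (@ex_RInt_continuous R_CompleteNormedModule) => s _.
exact: picard_integrand_continuous.
Qed.

Lemma picard_lipschitz u x x' :
  (forall s, continuous u s) -> Rabs (picard u x - picard u x') <= M * Rabs (x - x').
Proof.
move=> Hu; rewrite /picard.
have E := RInt_Chasles (fun s => G (s, u s)) 0 (clamp a x') (clamp a x)
  (picard_integrand_ex u _ _ Hu) (picard_integrand_ex u _ _ Hu).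
rewrite -E /plus /=.
set I := RInt _ 0 _; set J := RInt _ _ _; have -> : I + J - I = J by ring.
apply: (Rle_trans _ (M * Rabs (clamp a x - clamp a x'))).
  by apply: RInt_bound => s; [exact: picard_integrand_continuous|move=> _].
by apply: Rmult_le_compat_l => //; have := clamp_lipschitz a x x'; lra.
Qed.

(** The integration interval has length at most a, and L a is at most 1/2: hence the factor 1/2. *)
Lemma picard_contraction u v e x :
  (forall s, continuous u s) -> (forall s, continuous v s) ->
  (forall s, Rabs (u s - v s) <= e) -> Rabs (picard u x - picard v x) <= e / 2.
Proof.
move=> Hu Hv He; rewrite /picard.
have -> : RInt (fun s => G (s, u s)) 0 (clamp a x) - RInt (fun s => G (s, v s)) 0 (clamp a x) =
  RInt (fun s => minus (G (s, u s)) (G (s, v s))) 0 (clamp a x).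
  by rewrite (@RInt_minus R_CompleteNormedModule) //; exact: picard_integrand_ex.
have He0 : 0 <= e by apply: Rle_trans (He 0); exact: Rabs_pos.
apply: (Rle_trans _ (L * e * Rabs (clamp a x - 0))).
  apply: RInt_bound => s.
  - by apply: (continuous_minus (fun s => G (s, u s))); exact: picard_integrand_continuous.
  - by move=> _; apply: (Rle_trans _ _ _ (HGL _ _ _)); apply: Rmult_le_compat_l.
have : Rabs (clamp a x) <= a by apply: clamp_bound; lra.
rewrite Rminus_0_r => H1; have := Rabs_pos (clamp a x).
have : L * e * Rabs (clamp a x) <= L * e * a by apply: Rmult_le_compat_l => //; nra.
nra.
Qed.

Lemma picard_iter_continuous n s : continuous (picard_iter n) s.
Proof.
elim: n s => [|n IH] s /=; first exact: continuous_const.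
by apply: (lipschitz_continuous M) => y z; exact: picard_lipschitz.
Qed.

Lemma picard_iter_step n x : Rabs (picard_iter (S n) x - picard_iter n x) <= M * a * (/ 2) ^ n.
Proof.
elim: n x => [|n IH] x.
- rewrite /= Rminus_0_r Rmult_1_r.
  apply: (Rle_trans _ (M * Rabs (clamp a x - 0))).
    apply: RInt_bound => s; last by [].
    by apply: (picard_integrand_continuous (fun _ => 0)); exact: continuous_const.
  by apply: Rmult_le_compat_l => //; rewrite Rminus_0_r; apply: clamp_bound; lra.
- have := picard_contraction _ _ _ x (picard_iter_continuous (S n)) (picard_iter_continuous n) IH.
  by move=> /= ; lra.
Qed.

(** The geometric sum is kept in closed form, with its factor 1 - 2^(-k): the weaker bound without
    this factor would not pass through the induction on k. *)
Lemma picard_iter_cauchy n k x :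
  Rabs (picard_iter (n + k) x - picard_iter n x) <= 2 * M * a * (/ 2) ^ n * (1 - (/ 2) ^ k).
Proof.
elim: k => [|k IH].
  by rewrite PeanoNat.Nat.add_0_r Rminus_eq_0 Rabs_R0 /=; lra.
have := picard_iter_step (n + k) x; rewrite -plus_n_Sm pow_add => H.
have -> : picard_iter (S (n + k)) x - picard_iter n x =
  (picard_iter (S (n + k)) x - picard_iter (n + k) x) + (picard_iter (n + k) x - picard_iter n x) by ring.
apply: (Rle_trans _ _ _ (Rabs_triang _ _)).
by rewrite -tech_pow_Rmult; lra.
Qed.

Lemma picard_iter_dist n m x : (n <= m)%nat ->
  Rabs (picard_iter m x - picard_iter n x) <= 2 * M * a * (/ 2) ^ n.
Proof.
move=> Hnm; have := picard_iter_cauchy n (m - n) x.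
have -> : (n + (m - n) = m)%nat by lia.
have H1 : 0 <= (/ 2) ^ n by apply: pow_le; lra.
have H2 : 0 <= (/ 2) ^ (m - n) by apply: pow_le; lra.
have : 0 <= 2 * M * a * (/ 2) ^ n by apply: Rmult_le_pos => //; nra.
nra.
Qed.

Lemma picard_is_lim x : is_lim_seq (fun n => picard_iter n x) (picard_limit x).
Proof.
apply: Lim_seq_correct'; apply/ex_lim_seq_cauchy_corr => eps.
have [N HN] : exists N, forall n, (N <= n)%nat -> 2 * M * a * (/ 2) ^ n < eps / 2.
  have : is_lim_seq (fun n => 2 * M * a * (/ 2) ^ n) (2 * M * a * 0).
    apply: (is_lim_seq_scal_l _ _ 0); apply: is_lim_seq_geom; rewrite Rabs_pos_eq; lra.
  rewrite Rmult_0_r => /is_lim_seq_spec H.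
  have He : 0 < eps / 2 by have := cond_pos eps; lra.
  have [N HN] := H (mkposreal _ He); exists N => n /HN /=.
  by rewrite Rminus_0_r => /Rabs_def2; lra.
exists N => n m Hn Hm.
have A1 := picard_iter_dist N n x Hn; have A2 := picard_iter_dist N m x Hm.
have A3 := HN N (le_n N).
have -> : picard_iter n x - picard_iter m x =
  (picard_iter n x - picard_iter N x) + - (picard_iter m x - picard_iter N x) by ring.
apply: (Rle_lt_trans _ _ _ (Rabs_triang _ _)); rewrite Rabs_Ropp; lra.
Qed.

Lemma picard_limit_dist n x : Rabs (picard_limit x - picard_iter n x) <= 2 * M * a * (/ 2) ^ n.
Proof.
have H : is_lim_seq (fun m => Rabs (picard_iter (m + n) x - picard_iter n x))
    (Rabs (picard_limit x - picard_iter n x)).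
  apply: (is_lim_seq_abs _ (Finite _)); apply: is_lim_seq_minus'; last exact: is_lim_seq_const.
  by apply/(is_lim_seq_incr_n (fun n => picard_iter n x)); exact: picard_is_lim.
apply: (is_lim_seq_le _ _ (Finite _) (Finite _) _ H (is_lim_seq_const _)) => m.
by apply: picard_iter_dist; lia.
Qed.

(** All iterates from the first on share the Lipschitz constant M, which survives pointwise limits;
    continuity of the limit follows at once. *)
Lemma picard_limit_lipschitz x x' : Rabs (picard_limit x - picard_limit x') <= M * Rabs (x - x').
Proof.
have H : is_lim_seq (fun n => Rabs (picard_iter (S n) x - picard_iter (S n) x'))
    (Rabs (picard_limit x - picard_limit x')).
  apply: (is_lim_seq_abs _ (Finite _)); apply: is_lim_seq_minus';
    by apply/(is_lim_seq_incr_1 (fun n => picard_iter n _)); exact: picard_is_lim.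
apply: (is_lim_seq_le _ _ (Finite _) (Finite _) _ H (is_lim_seq_const _)) => n.
by apply: picard_lipschitz; exact: picard_iter_continuous.
Qed.

Lemma picard_limit_continuous x : continuous picard_limit x.
Proof. by apply: (lipschitz_continuous M); exact: picard_limit_lipschitz. Qed.

(** The shifted sequence tends both to the limit and, by the contraction estimate, to the image of
    the limit. *)
Lemma picard_fixpoint x : picard_limit x = picard picard_limit x.
Proof.
have H : is_lim_seq (fun n => picard_iter (S n) x) (picard picard_limit x).
  apply/is_lim_seq_spec => eps.
  have : is_lim_seq (fun n => 2 * M * a * (/ 2) ^ n) (2 * M * a * 0).
    apply: (is_lim_seq_scal_l _ _ 0); apply: is_lim_seq_geom; rewrite Rabs_pos_eq; lra.
  rewrite Rmult_0_r => /is_lim_seq_spec /(_ eps) [N HN]; exists N => n /HN.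
  rewrite Rminus_0_r => /Rabs_def2 HNn.
  have := picard_contraction (picard_iter n) picard_limit _ x (picard_iter_continuous n)
    picard_limit_continuous (fun s => eq_ind_r (fun z => z <= _) (picard_limit_dist n s) (Rabs_minus_sym _ _)).
  move=> /=; have := Rabs_pos (picard_iter (S n) x - picard picard_limit x) => /=; lra.
have := is_lim_seq_unique _ _ H.
move/(is_lim_seq_incr_1 (fun n => picard_iter n x))/is_lim_seq_unique: H => H _.
have := is_lim_seq_unique _ _ (picard_is_lim x); rewrite H => -[]. done.
Qed.

End Picard.

(** The clamped equation has a global solution, which solves the original equation as long as it
    stays in the box; smoothness comes from the equation. *)
Lemma ode_solution G : Cinf G (0, 0) ->
  exists y, [/\ smooth0 y, y 0 = 0 & locally 0 (fun x => is_derive y x (G (x, y x)))].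
Proof.
move=> HG.
have Bd : forall g, Cinf g (0, 0) -> locally ((0, 0) : R2) (fun q => Rabs (g q) <= Rabs (g (0, 0)) + 1).
  move=> g Hg; have L : locally ((0, 0) : R2) (fun q => ball (g (0, 0)) (mkposreal 1 Rlt_0_1) (g q)) :=
    Cinf_cont _ _ Hg _ (locally_ball _ _).
  apply: filter_imp L => q; rewrite /ball /= /AbsRing_ball /= /abs /minus /plus /opp /= => H.
  have := Rabs_triang (g q + - g (0, 0)) (g (0, 0)).
  by rewrite Rplus_assoc Rplus_opp_l Rplus_0_r; lra.
have [r [Hr Hbox]] := locally_box _ (filter_and _ _ (Cinf_locally _ _ HG)
  (filter_and _ _ (Bd _ HG) (Bd _ (Cinf_dy _ _ HG)))).
move: Hbox; set M := _ + 1; set L := _ + 1 => Hbox.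
have HM0 : 0 < M by rewrite /M; have := Rabs_pos (G (0, 0)); lra.
have HL0 : 0 < L by rewrite /L; have := Rabs_pos (dy G (0, 0)); lra.
pose b := r / 2; have Hb : 0 < b < r by rewrite /b; lra.
(* The three bounds keep the abscissa within the clamping range, make the iteration contract by 1/2,
   and keep the solution bounded by b. *)
pose a := Rmin b (Rmin (/ (2 * L)) (b / M)).
have Ha : 0 < a.
  apply: Rmin_pos; first lra.
  by apply: Rmin_pos; [apply: Rinv_0_lt_compat; lra|apply: Rdiv_lt_0_compat; lra].
have Hab : a <= b by exact: Rmin_l.
have HaL : L * a <= / 2.
  apply: (Rle_trans _ (L * / (2 * L))); last by right; field; lra.
  by apply: Rmult_le_compat_l; [lra|apply: Rle_trans (Rmin_r _ _) (Rmin_l _ _)].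
have HaM : M * a <= b.
  apply: (Rle_trans _ (M * (b / M))); last by right; field; lra.
  by apply: Rmult_le_compat_l; [lra|apply: Rle_trans (Rmin_r _ _) (Rmin_r _ _)].
(* F is continuous, bounded by M and L-Lipschitz in y on the whole plane, and equals G on the closed
   box of radius b, where the solution lives. *)
pose F (q : R2) := G (clamp b (fst q), clamp b (snd q)).
have Hcl : forall x y, box r (clamp b x, clamp b y).
  by move=> x y; split => /=; [have := clamp_bound b x|have := clamp_bound b y]; lra.
have HF : forall q, continuous F q.
  move=> q; apply: (continuous_comp (fun q => (clamp b (fst q), clamp b (snd q))) G).
    apply: continuous_pair; apply: (continuous_comp _ (clamp b)); try exact: clamp_continuous;
    [exact: continuous_fst|exact: continuous_snd].
  by apply: Cinf_cont; case: (Hbox _ (Hcl (fst q) (snd q))).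
have HFM : forall q, Rabs (F q) <= M by move=> q; case: (Hbox _ (Hcl (fst q) (snd q))) => _ [].
have HFL : forall x y y', Rabs (F (x, y) - F (x, y')) <= L * Rabs (y - y').
  move=> x y y'; rewrite /F /=.
  apply: (Rle_trans _ (L * Rabs (clamp b y - clamp b y'))); last first.
    by apply: Rmult_le_compat_l; [lra|have := clamp_lipschitz b y y'; lra].
  have Hd : forall z, Rmin (clamp b y') (clamp b y) <= z <= Rmax (clamp b y') (clamp b y) ->
     box r (clamp b x, z).
    move=> z [Hz1 Hz2]; split => /=; first by case: (Hcl x y).
    have /= [_ /Rabs_def2 H1] := Hcl x y; have /= [_ /Rabs_def2 H2] := Hcl x y'.
    apply: Rabs_def1.
    - by apply: Rle_lt_trans Hz2 _; apply: Rmax_lub_lt; tauto.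
    - by apply: Rlt_le_trans Hz1; apply: Rmin_glb_lt; tauto.
  have [| |c [Hc ->]] := MVT_gen (fun z => G (clamp b x, z)) (clamp b y') (clamp b y) (fun z => dy G (clamp b x, z)).
  - move=> z [Hz1 Hz2]; have /Hbox [Hz' _] : box r (clamp b x, z) by apply: Hd; split; exact: Rlt_le.
    by have [_] := Cinf_partials _ _ Hz'.
  - move=> z /Hd/Hbox [Hz' _]; apply/continuity_pt_filterlim; apply: ex_derive_continuous.
    by have [_ H] := Cinf_partials _ _ Hz'; eexists; exact: H.
  rewrite Rabs_mult; apply: Rmult_le_compat_r; first exact: Rabs_pos.
  by case: (Hbox _ (Hd _ Hc)) => _ [].
pose y := picard_limit F a.
have Cy : forall x, continuous y x.
  by move=> x; apply: (picard_limit_continuous F M L) => //; lra.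
have Ey : forall x, y x = picard F a y x.
  by move=> x; apply: (picard_fixpoint F M L) => //; lra.
have y_bd : forall x, Rabs (y x) <= b.
  move=> x; apply: Rle_trans HaM; rewrite Ey.
  apply: (Rle_trans _ (M * Rabs (clamp a x - 0))).
    by apply: RInt_bound => s; [exact: picard_integrand_continuous|].
  by apply: Rmult_le_compat_l; [lra|rewrite Rminus_0_r; apply: clamp_bound; lra].
have Hd : forall x, Rabs x < a -> is_derive y x (G (x, y x)).
  move=> x Hx.
  have -> : G (x, y x) = F (x, y x) by rewrite /F /= !clamp_id //; lra.
  apply: (is_derive_ext_loc (fun z => RInt (fun s => F (s, y s)) 0 z)).
    have Hx' : 0 < a - Rabs x by lra.
    exists (mkposreal _ Hx') => z; rewrite /ball /= /AbsRing_ball /= /abs /minus /plus /opp /= => Hz.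
    rewrite Ey /picard clamp_id //; have := Rabs_triang (z + - x) x.
    by rewrite Rplus_assoc Rplus_opp_l Rplus_0_r; lra.
  apply: (is_derive_RInt (fun s => F (s, y s)) _ 0); last exact: (picard_integrand_continuous F).
  apply: filter_forall => z; apply: (@RInt_correct R_CompleteNormedModule).
  exact: (picard_integrand_ex F).
exists y; split.
(* Since y' = G(x, y), a solution of class C^n has a derivative of class C^n. *)
- apply: (Cinf_lift (fun x => Rabs x < a) y (fun x => G (x, y x))).
  + by apply: (interval_locally a) => // t Ht; split=> //; exact: Hd.
  + move=> n s Hs Hn; apply: (Ck_comp n G fst (fun s => y (fst s))) => //.
    * apply: Cinf_Ck; case: (Hbox (fst s, y (fst s))) => //; split => /=; first lra.
      by have := y_bd (fst s); lra.
    * by apply: Cinf_Ck; exact: Cinf_fst.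
- by rewrite Ey /picard clamp_id ?Rabs_R0 ?RInt_point //; lra.
- exact: (interval_locally a).
Qed.

(** * The singularity A4 along a curve *)

Lemma near_comp (P : R2 -> Prop) u v q a b : Cinf u q -> Cinf v q -> u q = a -> v q = b ->
  locally ((a, b) : R2) P -> locally q (fun r => P (u r, v r)).
Proof.
move=> /Cinf_cont Hu /Cinf_cont Hv <- <-; exact: filterlim_pair_locally.
Qed.

Lemma smooth2_near phi p :
  (exists D, open D /\ D p /\ smooth2_on D phi) <->
  Cinf (fun q => fst (phi q)) p /\ Cinf (fun q => snd (phi q)) p.
Proof.
split.
- by move=> [W [HW [Hp [H1 H2]]]]; split; apply: (smooth_on_Cinf W).
- move=> [/Cinf_smooth_at H1 /Cinf_smooth_at H2].
  (* The points with a neighbourhood of smoothness form an open set by construction. *)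
  exists (fun q => locally q (fun r => smooth_at (fun q => fst (phi q)) r /\
                                     smooth_at (fun q => snd (phi q)) r)); split; [|split].
  + by move=> q; exact: locally_locally.
  + exact: filter_and.
  + by split=> q /locally_singleton [].
Qed.

Lemma sign_choice a : a <> 0 -> exists s, (s = 1 \/ s = -1) /\ s * s = 1 /\ 0 < s * a.
Proof.
by move=> Ha; case: (Rlt_or_le 0 a) => H; [exists 1|exists (-1)]; split; try lra; tauto.
Qed.

Lemma Cinf_root n f q : Cinf f q -> 0 < f q ->
  exists g, [/\ Cinf g q, 0 < g q & locally q (fun r => g r ^ S n = f r)].
Proof.
move=> Hf H0; exists (fun r => exp (ln (f r) * / INR (S n))); split; last first.
- apply: filter_imp (Cinf_gt0 _ _ Hf H0) => r Hr.
  rewrite -Rpower_pow; last exact: exp_pos.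
  rewrite /Rpower ln_exp -[RHS](exp_ln _ Hr); congr exp; field; exact: not_0_INR.
- exact: exp_pos.
- by apply: Cinf_exp; apply: Cinf_mult; [exact: Cinf_ln|exact: Cinf_const].
Qed.

(** Implicit function theorem: the section is psi(., 0) for the inverse of the shear by s K, the
    sign s making the vertical derivative positive. The last clause, that all nearby zeros lie on
    the graph, later identifies the whole ridge set near p. *)
Lemma critical_section K : Cinf K (0, 0) -> K (0, 0) = 0 -> dy K (0, 0) <> 0 ->
  exists c, [/\ smooth0 c, c 0 = 0 , locally 0 (fun x => K (x, c x) = 0) &
    locally ((0, 0) : R2) (fun q => K q = 0 -> snd q = c (fst q))].
Proof.
move=> HK K0 /sign_choice [s [_ [Hs Hpos]]].
have Hd : dy (fun q => s * K q) (0, 0) = s * dy K (0, 0) by rewrite /dy Derive_scal.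
have [|||psi [Hpsi p0 H1 H2]] := shear_inverse (fun q => s * K q).
- by apply: Cinf_mult => //; exact: Cinf_const.
- by rewrite K0; ring.
- by rewrite Hd.
have s0 : s <> 0 by move=> E; move: Hs; rewrite E; lra.
exists (fun x => psi (x, 0)); split=> //.
- by apply: (smooth0_comp psi (fun t => t) (fun _ => 0)) => //; solve_smooth0.
- apply: filter_imp (locally_axis _ _ _ H1) => x /= /Rmult_integral; tauto.
- by apply: filter_imp H2 => q Hq E; move: Hq; rewrite E Rmult_0_r => ->.
Qed.

(** After subtracting the value on the curve c of vertical critical points, G vanishes with its
    vertical derivative on that curve, and two applications of Hadamard's lemma extract a square.
    The formula for [dy G] measures how far another curve is from c. *)
Lemma splitting G : Cinf G (0, 0) -> dy G (0, 0) = 0 -> dy (dy G) (0, 0) <> 0 ->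
  exists c B, [/\ smooth0 c, c 0 = 0, Cinf B (0, 0), B (0, 0) <> 0 &
    locally ((0, 0) : R2) (fun q => G (fst q, c (fst q) + snd q) =
       G (fst q, c (fst q)) + snd q * (snd q * B q))] /\
    locally ((0, 0) : R2) (fun q => dy G (fst q, c (fst q) + snd q) =
       snd q * (2 * B q + snd q * dy B q)).
Proof.
move=> HG G0 Hnz.
have [c [Hc c0 Ec _]] := critical_section _ (Cinf_dy _ _ HG) G0 Hnz.
exists c.
have CG : Cinf (fun q => G (fst q, c (fst q) + snd q)) (0, 0).
  apply: (Cinf_comp G fst (fun q => c (fst q) + snd q)).
  - by rewrite /= c0 Rplus_0_r.
  - exact: Cinf_fst.
  - by apply: Cinf_plus => //; exact: Cinf_snd.
have CG0 : Cinf (fun q => G (fst q, c (fst q))) (0, 0).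
  apply: (Cinf_comp G fst (fun q => c (fst q))) => //; last exact: Cinf_fst.
  by rewrite /= c0.
have [||B1 [HB1 B1x E1]] := hadamard (fun q => G (fst q, c (fst q) + snd q) - G (fst q, c (fst q))).
- exact: Cinf_minus.
- by apply: filter_forall => x /=; rewrite Rplus_0_r; ring.
have B1x0 : locally 0 (fun x => B1 (x, 0) = 0).
  have HGx : locally 0 (fun x => Cinf G (x, c x)).
    apply: (locally_along _ (fun x => x) c); [exact: continuous_id|exact: smooth0_cont|].
    by rewrite c0; exact: Cinf_locally.
  apply: filter_imp (filter_and _ _ B1x (filter_and _ _ Ec HGx)) => x [-> [Ex /Cinf_partials [_ /= Hx]]].
  rewrite /dy /=; apply: is_derive_unique; evar_last.
    apply: (is_derive_minus (fun y => G (x, c x + y)) (fun _ => G (x, c x))); last exact: is_derive_const.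
    apply: (is_derive_comp (fun y => G (x, y)) (fun y => c x + y)).
      by rewrite Rplus_0_r; exact: Hx.
    by auto_derive.
  by rewrite Ex /minus /plus /opp /scal /zero /= /mult /=; ring.
have [B [HB _ E2]] := hadamard B1 HB1 B1x0.
have EB : locally ((0, 0) : R2) (fun q => G (fst q, c (fst q) + snd q) =
       G (fst q, c (fst q)) + snd q * (snd q * B q)).
  by apply: filter_imp (filter_and _ _ E1 E2) => q [/= H1 H2]; rewrite -H2; lra.
have EyB : locally ((0, 0) : R2) (fun q => dy G (fst q, c (fst q) + snd q) =
       snd q * (2 * B q + snd q * dy B q)).
  have HGq : locally ((0, 0) : R2) (fun q => Cinf G (fst q, c (fst q) + snd q)).
    apply: (filterlim_pair_locally fst (fun q => c (fst q) + snd q)).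
    - exact: continuous_fst.
    - by apply: Cinf_cont; apply: Cinf_plus => //; exact: Cinf_snd.
    - by rewrite /= c0 Rplus_0_r; exact: Cinf_locally.
  apply: filter_imp (filter_and _ _ (locally_locally _ _ EB) (filter_and _ _ HGq (Cinf_locally _ _ HB))).
  move=> -[x z] [Ez [/Cinf_partials [_ /= HGz] /Cinf_partials [_ /= Hz]]] /=.
  have D1 : is_derive (fun z => G (x, c x + z)) z (dy G (x, c x + z)).
    evar_last.
      apply: (is_derive_comp (fun y => G (x, y)) (fun z => c x + z)); first exact: HGz.
      by auto_derive.
    by rewrite /scal /= /mult /=; ring.
  rewrite -(is_derive_unique _ _ _ D1); apply: is_derive_unique.
  apply: (is_derive_ext_loc (fun z => G (x, c x) + z * (z * B (x, z)))).
    by apply: filter_imp (slice_y _ _ Ez) => y /= ->.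
  evar_last.
    apply: is_derive_plus; first exact: is_derive_const.
    apply: (@is_derive_mult R_AbsRing); [exact: is_derive_id| |exact: Rmult_comm].
    apply: (@is_derive_mult R_AbsRing); [exact: is_derive_id|exact: Hz|exact: Rmult_comm].
  by rewrite /plus /mult /zero /one /=; ring.
(* The second vertical derivative at the origin equals 2 B(0, 0), by differentiating the formula for
   [dy G] on the axis. *)
exists B; split => //; split => // B0; apply: Hnz.
have E0 : locally 0 (fun z => dy G (0, z) = z * (2 * B (0, z) + z * dy B (0, z))).
  have := locally_along _ (fun _ => 0) (fun z => z) 0 (continuous_const _ _) (continuous_id _) EyB.
  by apply: filter_imp => z /=; rewrite c0 Rplus_0_l.
change (Derive (fun z => dy G (0, z)) 0 = 0); apply: is_derive_unique.
apply: (is_derive_ext_loc (fun z => z * (2 * B (0, z) + z * dy B (0, z)))).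
  by apply: filter_imp E0 => z ->.
evar_last.
  apply: is_derive_mult_zero; [exact: is_derive_id|by []|].
  apply: (smooth0_cont (fun z => 2 * B (0, z) + z * dy B (0, z))); solve_smooth0.
  + by apply: (smooth0_comp B (fun _ => 0) (fun z => z)) => //; solve_smooth0.
  + by apply: (smooth0_comp (dy B) (fun _ => 0) (fun z => z)); [exact: Cinf_dy| |]; solve_smooth0.
by rewrite /one /= B0; ring.
Qed.

(** Absorb |A| and |B| into the coordinates: X is x times a fifth root, Y is z times a square root.
    The map (X, Y) is triangular, so its inverse comes from two shears, first in X alone, then in Y
    over a fixed abscissa. *)
Lemma A4_normal_form G c k0 A B s1 s2 :
  smooth0 c -> c 0 = 0 -> smooth0 A -> Cinf B (0, 0) ->
  (s1 = 1 \/ s1 = -1) -> (s2 = 1 \/ s2 = -1) -> 0 < s1 * A 0 -> 0 < s2 * B (0, 0) ->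
  locally ((0, 0) : R2) (fun q => G (fst q, c (fst q) + snd q) =
     k0 + fst q ^ 5 * A (fst q) + snd q ^ 2 * B q) ->
  exists phi psi, local_diffeo phi psi (0, 0) (0, 0) /\
    locally ((0, 0) : R2) (fun z => G (phi z) = k0 + s1 * fst z ^ 5 + s2 * snd z ^ 2).
Proof.
move=> Hc c0 HA HB Hs1 Hs2 HA0 HB0 E.
(* The degree of the root is one more than the argument of [Cinf_root]: a fifth root here, a square
   root next. *)
have [al [Hal al0 Eal]] := Cinf_root 4 (fun q => s1 * A (fst q)) (0, 0)
  (Cinf_mult _ _ _ (Cinf_const s1 _) HA) HA0.
have [be [Hbe be0 Ebe]] := Cinf_root 1 (fun q => s2 * B q) (0, 0)
  (Cinf_mult _ _ _ (Cinf_const s2 _) HB) HB0.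
have s1s : s1 * s1 = 1 by case: Hs1 => ->; ring.
have s2s : s2 * s2 = 1 by case: Hs2 => ->; ring.
pose a x := al (x, 0).
have Ha : smooth0 a by apply: (smooth0_comp al (fun t => t) (fun _ => 0)) => //; solve_smooth0.
pose X x := x * a x.
have HX : smooth0 X by rewrite /X; solve_smooth0.
pose Y (q : R2) := (snd q - c (fst q)) * be (fst q, snd q - c (fst q)).
have Hz : Cinf (fun q => snd q - c (fst q)) (0, 0) by apply: Cinf_minus => //; exact: Cinf_snd.
have HY : Cinf Y (0, 0).
  apply: Cinf_mult => //; apply: (Cinf_comp be fst (fun q => snd q - c (fst q))) => //; last exact: Cinf_fst.
  by rewrite /= c0 Rminus_0_r.
have dX : 0 < dy (fun q => X (snd q)) (0, 0).
  have -> : dy (fun q => X (snd q)) (0, 0) = 1 * a 0; last by rewrite Rmult_1_l.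
  apply: is_derive_unique; apply: is_derive_mult_zero => //; [exact: is_derive_id|exact: smooth0_cont].
have dY : 0 < dy Y (0, 0).
  have -> : dy Y (0, 0) = 1 * be (0, 0); last by rewrite Rmult_1_l.
  rewrite /dy /Y /= c0; apply: is_derive_unique.
  apply: (is_derive_ext (fun z => z * be (0, z))); first by move=> z; rewrite Rminus_0_r.
  apply: is_derive_mult_zero => //; first exact: is_derive_id.
  by apply: (smooth0_cont (fun z => be (0, z))); apply: (smooth0_comp be (fun _ => 0) (fun z => z)) => //; solve_smooth0.
have CX : Cinf (fun q => X (snd q)) (0, 0).
  by apply: (Cinf_comp (fun s => X (fst s)) snd (fun _ => 0)) => //; [exact: Cinf_snd|exact: Cinf_const].
have [|p2 [Hp2 p20 H21 H22]] := shear_inverse _ CX _ dX; first by rewrite /X /=; ring.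
have [|p1 [Hp1 p10 H11 H12]] := shear_inverse _ HY _ dY; first by rewrite /Y /= c0; ring.
pose chi x := p2 (0, x).
have Hchi : smooth0 chi by apply: (smooth0_comp p2 (fun _ => 0) (fun t => t)) => //; solve_smooth0.
have chi0 : chi 0 = 0 by [].
have X0 : X 0 = 0 by rewrite /X; ring.
have E1 : locally 0 (fun x => X (chi x) = x).
  exact: (locally_along _ (fun _ => 0) (fun x => x) 0 (continuous_const _ _) (continuous_id _) H21).
have E2 : locally 0 (fun x => chi (X x) = x).
  exact: (locally_along _ (fun _ => 0) (fun x => x) 0 (continuous_const _ _) (continuous_id _) H22).
pose phi (q : R2) : R2 := (chi (fst q), p1 (chi (fst q), snd q)).
pose psi (q : R2) : R2 := (X (fst q), Y q).
have Hphi2 : Cinf (fun q => p1 (chi (fst q), snd q)) (0, 0).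
  by apply: (Cinf_comp p1 (fun q => chi (fst q)) snd) => //; [rewrite /= chi0|exact: Cinf_snd].
have Y0 : Y (0, 0) = 0 by rewrite /Y /= c0; ring.
have L1 : locally ((0, 0) : R2) (fun q => Y (phi q) = snd q).
  exact: (near_comp _ (fun q => chi (fst q)) snd (0, 0) 0 0 Hchi (Cinf_snd _) chi0 eq_refl H11).
have L1x := locally_fst _ (0, 0) E1.
exists phi, psi; split; last first.
- pose w q := snd (phi q) - c (fst (phi q)).
  have Hw : Cinf w (0, 0).
    apply: Cinf_minus => //.
    apply: (Cinf_comp (fun s => c (fst s)) (fun q => chi (fst q)) (fun _ => 0)) => //; last exact: Cinf_const.
    by rewrite /= chi0.
  have w0 : w (0, 0) = 0 by rewrite /w /= chi0 p10 c0; ring.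
  have L2 : locally ((0, 0) : R2) (fun q => G (phi q) =
     k0 + fst (phi q) ^ 5 * A (fst (phi q)) + w q ^ 2 * B (fst (phi q), w q)).
    have H := near_comp _ (fun q => fst (phi q)) w (0, 0) 0 0 Hchi Hw chi0 w0 E.
    by apply: filter_imp H => q /= <-; rewrite /phi /w /=; congr (G (_, _)); ring.
  have L3 : locally ((0, 0) : R2) (fun q => a (fst (phi q)) ^ 5 = s1 * A (fst (phi q))).
    have := near_comp _ (fun q => chi (fst q)) (fun _ => 0) (0, 0) 0 0 Hchi (Cinf_const 0 _) chi0 eq_refl Eal.
    exact.
  have L4 := near_comp _ (fun q => chi (fst q)) w (0, 0) 0 0 Hchi Hw chi0 w0 Ebe.
  apply: filter_imp (filter_and _ _ (filter_and _ _ L1 L1x) (filter_and _ _ L2 (filter_and _ _ L3 L4))).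
  move=> q [[M1 M2] [-> [M3 M4]]].
  have -> : fst q ^ 5 = fst (phi q) ^ 5 * (s1 * A (fst (phi q))).
    by rewrite -M3 -Rpow_mult_distr -{1}M2.
  have -> : snd q ^ 2 = w q ^ 2 * (s2 * B (fst (phi q), w q)).
    by rewrite -M4 -Rpow_mult_distr -{1}M1.
  have -> : forall z b, s2 * (z * (s2 * b)) = s2 * s2 * z * b by move=> *; ring.
  have -> : forall z b, s1 * (z * (s1 * b)) = s1 * s1 * z * b by move=> *; ring.
  by rewrite s1s s2s; ring.
split; [|split; [|split; [|split; [|split]]]].
- by rewrite /phi /= chi0 p10.
- by rewrite /psi /= X0 Y0.
- by apply/smooth2_near.
- by apply/smooth2_near.
- apply: filter_imp (filter_and _ _ L1 L1x) => q [M1 M2].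
  by rewrite /psi M1 /= M2; case: (q).
- have L2x := locally_fst _ (0, 0) E2.
  apply: filter_imp (filter_and _ _ H12 L2x) => q [M1 M2].
  by rewrite /phi /psi /= M2 M1; case: (q).
Qed.

(** * Orders of vanishing of powers *)

Lemma flat_pow_mult n k v : smooth0 v -> flat (n + k) (fun t => t ^ n * v t) -> flat k v.
Proof.
elim: n v => [|n IH] v Hv H.
  by apply: flat_ext H; apply: filter_forall => t /=; ring.
apply: IH => //; apply: flat_id_mult; first by solve_smooth0.
by apply: flat_ext H; apply: filter_forall => t /=; ring.
Qed.

Lemma flat_mult_pow n k v : smooth0 v -> flat k v -> flat (n + k) (fun t => t ^ n * v t).
Proof.
elim: n v => [|n IH] v Hv H.
  by apply: flat_ext H; apply: filter_forall => t /=; ring.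
apply: (flat_ext _ (fun t => t * (t ^ n * v t))).
  by apply: filter_forall => t /=; ring.
by apply: (flat_mult 1 (n + k)); [lia|solve_smooth0|solve_smooth0| |exact: IH].
Qed.

Lemma flat1 u : flat 1 u <-> u 0 = 0.
Proof. by split=> [[]|]. Qed.

(* A square vanishes to an even order. *)
Lemma flat_sqr k u : smooth0 u -> flat (S (2 * k)) (fun t => u t * u t) -> flat (S k) u.
Proof.
elim: k u => [|k IH] u Hu HV.
  by apply/flat1; move/flat1/Rmult_integral: HV; tauto.
have u0 : u 0 = 0.
  by move: (flat_le 1 _ _ (le_n_S _ _ (PeanoNat.Nat.le_0_l _)) HV) => /flat1/Rmult_integral; tauto.
have [v [Hv E]] := flat_factor 1 u Hu (proj2 (flat1 u) u0).
apply: (flat_ext _ (fun t => t ^ 1 * v t)); first by apply: filter_imp E => t ->.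
apply: (flat_mult_pow 1) => //; apply: IH => //.
apply: (flat_pow_mult 2); first by solve_smooth0.
apply: (flat_le _ (S (2 * S k))); first by lia.
by apply: flat_ext HV; apply: filter_imp E => t ->; ring.
Qed.

Lemma flat_pow_l j k u : smooth0 u -> flat k u -> flat (j * k) (fun t => u t ^ j).
Proof.
move=> Hu HV; elim: j => [|j IH] //.
by apply: (flat_mult k (j * k)) => //; solve_smooth0.
Qed.

(** Writing u = t v, the power is t^n v^n; one order more than n forces v(0)^n = 0, hence v(0) =
    0. *)
Lemma flat_pow_root n u : smooth0 u -> flat 1 u -> flat (S n) (fun t => u t ^ n) -> flat 2 u.
Proof.
move=> Hu HV HVn; have [v [Hv E]] := flat_factor 1 u Hu HV.
apply: (flat_ext _ (fun t => t ^ 1 * v t)); first by apply: filter_imp E => t ->.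
apply: (flat_mult_pow 1) => //; apply/flat1.
have H : flat 1 (fun t => v t ^ n).
  apply: (flat_pow_mult n); first by solve_smooth0.
  rewrite PeanoNat.Nat.add_1_r; apply: flat_ext HVn.
  by apply: filter_imp E => t ->; rewrite Rpow_mult_distr pow_1.
move/flat1: H => H; case: (Req_dec (v 0) 0) => // Hnz.
by case: (pow_nonzero _ n Hnz).
Qed.

(** The curve y is only an approximation of the critical curve c. Flatness of [dy G] along y makes d
    = y - c flat to order 3, so d^2 B is flat to order 6, and G restricted to c vanishes to order
    exactly 5 like its restriction to y. The splitting then gives the normal form. *)
Lemma A4_sufficient G y :
  Cinf G (0, 0) -> smooth0 y -> y 0 = 0 -> dx G (0, 0) = 0 -> dy G (0, 0) = 0 ->
  dy (dy G) (0, 0) <> 0 -> flat 3 (fun t => dy G (t, y t)) ->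
  flat 5 (fun t => G (t, y t) - G (0, 0)) -> ~ flat 6 (fun t => G (t, y t) - G (0, 0)) ->
  A_point 4 G (0, 0).
Proof.
move=> HG Hy y0 Gx Gy Gyy HP HQ HQ6; split.
  move=> X; rewrite /deriv -/(dx G (0, 0)) -/(dy G (0, 0)) Gx Gy; ring.
have [c [B [[Hc c0 HB B0 EB] EyB]]] := splitting _ HG Gy Gyy.
have HmB : Cinf (fun q => 2 * B q + snd q * dy B q) (0, 0).
  apply: Cinf_plus; first by apply: Cinf_mult => //; exact: Cinf_const.
  by apply: Cinf_mult; [exact: Cinf_snd|exact: Cinf_dy].
pose d t := y t - c t.
have Hd : smooth0 d by rewrite /d; solve_smooth0.
have d0 : d 0 = 0 by rewrite /d y0 c0; ring.
have near : forall P : R2 -> Prop, locally ((0, 0) : R2) P -> locally 0 (fun t => P (t, d t)).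
  move=> P HP1; apply: (locally_along P (fun t => t) d); [exact: continuous_id|exact: smooth0_cont|].
  by rewrite d0.
have cd : forall t, c t + d t = y t by move=> t; rewrite /d; ring.
have V3d : flat 3 d.
  apply: (flat_unit 3 d (fun t => 2 * B (t, d t) + d t * dy B (t, d t))) => //.
  - by apply: (smooth0_comp (fun q => 2 * B q + snd q * dy B q) (fun t => t) d) => //; [rewrite d0|solve_smooth0].
  - by rewrite d0; lra.
  - by apply: flat_ext HP; apply: filter_imp (near _ EyB) => t /=; rewrite cd.
pose k t := G (t, c t) - G (0, 0).
have Hk : smooth0 k.
  by apply: smooth0_minus; last solve_smooth0; apply: (smooth0_comp G (fun t => t) c) => //; [rewrite c0|solve_smooth0].
have HBd : smooth0 (fun t => B (t, d t)) by apply: smooth0_comp => //; [rewrite d0|solve_smooth0].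
have V6 : flat 6 (fun t => d t * (d t * B (t, d t))).
  by apply: (flat_mult 3 3) => //; [solve_smooth0|exact: flat_mult_l].
have Ek : locally 0 (fun t => (G (t, y t) - G (0, 0)) - d t * (d t * B (t, d t)) = k t).
  apply: filter_imp (near _ EB) => t /=; rewrite cd /k => ->; ring.
have Hq : smooth0 (fun t => G (t, y t) - G (0, 0)).
  by apply: smooth0_minus; last solve_smooth0; apply: (smooth0_comp G (fun t => t) y) => //; [rewrite y0|solve_smooth0].
have V5k : flat 5 k.
  apply: (flat_ext _ _ _ Ek); apply: flat_minus => //; first by solve_smooth0.
  by apply: flat_le V6; lia.
have nV6k : ~ flat 6 k.
  move=> H; apply: HQ6; apply: (flat_ext _ (fun t => k t + d t * (d t * B (t, d t)))).
    by apply: filter_imp Ek => t; move: (k t) (d t * _) (G (t, _)) (G (0, 0)) => *; lra.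
  by apply: flat_plus => //; solve_smooth0.
have [A [HA EA]] := flat_factor 5 k Hk V5k.
have A0 : A 0 <> 0.
  move=> A0; apply: nV6k; apply: (flat_ext _ (fun t => t ^ 5 * A t)).
    by apply: filter_imp EA => t ->.
  by apply: (flat_mult_pow 5 1) => //; apply/flat1.
have [s1 [Hs1 [_ Hs1A]]] := sign_choice _ A0.
have [s2 [Hs2 [_ Hs2B]]] := sign_choice _ B0.
have [|phi [psi [Hd1 Hd2]]] := A4_normal_form G c (G (0, 0)) A B s1 s2 Hc c0 HA HB Hs1 Hs2 Hs1A Hs2B.
- apply: filter_imp (filter_and _ _ EB (locally_fst _ (0, 0) EA)) => q [-> Hq1].
  by move: Hq1; rewrite /k; move: (G (fst q, _)) (G (0, 0)) (A _) (B _) => *; lra.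
by exists phi, psi, (G (0, 0)), s1, s2.
Qed.

(** In the normal coordinates (u, v) along the curve, g - g(p) = s1 u^5 + s2 v^2. The aim is to show
    that v is flat to order 3 and u has order exactly 1. The transverse information is available
    only after g - g(p) is known to be flat to order 4, whence the conditional hypothesis. *)
Lemma A4_necessary g p a b e :
  Cinf g p -> smooth0 a -> smooth0 b -> (a 0, b 0) = p ->
  fst e * Derive b 0 - snd e * Derive a 0 <> 0 ->
  flat 3 (fun t => g (a t, b t) - g p) ->
  (flat 4 (fun t => g (a t, b t) - g p) -> flat 3 (fun t => deriv e g (a t, b t))) ->
  A_point 4 g p ->
  flat 5 (fun t => g (a t, b t) - g p) /\ ~ flat 6 (fun t => g (a t, b t) - g p).
Proof.
move=> Hg Ha Hb Hp Hdet V3Q HVP [_ [phi [psi [c [s1 [s2 [[ph0 [ps0 [Hphi [Hpsi [E1 E2]]]]] [Hs1 [Hs2 E]]]]]]]]].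
move/smooth2_near: Hphi => [F1 F2]; move/smooth2_near: Hpsi => [P1 P2].
pose p1 q := fst (psi q); pose p2 q := snd (psi q).
have Hp1 : Cinf p1 (a 0, b 0) by rewrite Hp.
have Hp2 : Cinf p2 (a 0, b 0) by rewrite Hp.
pose u t := p1 (a t, b t); pose v t := p2 (a t, b t).
have Hu : smooth0 u by exact: smooth0_comp.
have Hv : smooth0 v by exact: smooth0_comp.
have u0 : u 0 = 0 by rewrite /u /p1 Hp ps0.
have v0 : v 0 = 0 by rewrite /v /p2 Hp ps0.
have s10 : s1 <> 0 by case: Hs1 => ->; lra.
have s20 : s2 <> 0 by case: Hs2 => ->; lra.
have Eg : locally p (fun r => g r = c + s1 * p1 r ^ 5 + s2 * p2 r ^ 2).
  have HE : locally (psi p) (fun z => g (phi z) = c + s1 * fst z ^ 5 + s2 * snd z ^ 2) by rewrite ps0.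
  have HE' : locally p (fun r => g (phi (p1 r, p2 r)) = c + s1 * p1 r ^ 5 + s2 * p2 r ^ 2).
    by apply: (near_comp (fun z => g (phi z) = c + s1 * fst z ^ 5 + s2 * snd z ^ 2) p1 p2 p 0 0) => //;
       rewrite /p1 /p2 ps0.
  apply: filter_imp (filter_and _ _ HE' E2) => r [<- M2].
  by rewrite /p1 /p2 -surjective_pairing M2.
have near : forall P : R2 -> Prop, locally p P -> locally 0 (fun t => P (a t, b t)).
  by move=> P HP1; apply: locally_along; [exact: smooth0_cont|exact: smooth0_cont|rewrite Hp].
have gp : g p = c.
  by rewrite (locally_singleton _ _ Eg) /p1 /p2 ps0 /=; ring.
have EQ : locally 0 (fun t => s1 * u t ^ 5 + s2 * (v t * v t) = g (a t, b t) - g p).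
  by apply: filter_imp (near _ Eg) => t ->; rewrite gp /u /v; ring.
have V5u : flat 5 (fun t => s1 * u t ^ 5).
  by apply: flat_mult_r; [solve_smooth0|solve_smooth0|apply: (flat_pow_l 5 1)].
have HQ : smooth0 (fun t => g (a t, b t) - g p).
  by apply: smooth0_minus; last solve_smooth0; apply: smooth0_comp => //; rewrite Hp.
have Vv : forall k, flat k (fun t => g (a t, b t) - g p) -> (k <= 5)%nat -> flat k (fun t => v t * v t).
  move=> k HVk Hk; apply: (flat_unit k _ (fun _ => s2)) => //; [solve_smooth0|solve_smooth0|].
  apply: (flat_ext _ (fun t => (g (a t, b t) - g p) - s1 * u t ^ 5)).
    by apply: filter_imp EQ => t <-; ring.
  by apply: flat_minus => //; [solve_smooth0|apply: flat_le V5u].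
(* Order 3 for v^2 already means order 4, since squares vanish to even order. *)
have V2v : flat 2 v by apply: (flat_sqr 1) => //; apply: Vv => //; lia.
have VQ : forall k, flat k v -> flat (min 5 (k + k)) (fun t => g (a t, b t) - g p).
  move=> k HVk; apply: (flat_ext _ _ _ EQ); apply: flat_plus; [solve_smooth0|solve_smooth0| |].
  - by apply: flat_le V5u; lia.
  - by apply: flat_mult_r; [solve_smooth0|solve_smooth0|apply: (flat_mult k k) => //; lia].
(* With v flat to order 2, g - g(p) is flat to order min(5, 4) = 4, which releases the hypothesis on
   the transverse derivative. *)
have V3P := HVP (VQ 2%nat V2v).
have exa : ex_derive a 0 by eexists; exact: smooth0_is_derive.
have exb : ex_derive b 0 by eexists; exact: smooth0_is_derive.
have dv0 : deriv (Derive a 0, Derive b 0) p2 p = 0.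
  rewrite -Hp -(is_derive_unique _ _ _ (chain_rule p2 a b 0 Hp2 exa exb)).
  by case: V2v => _ [].
have du0 : Derive u 0 = deriv (Derive a 0, Derive b 0) p1 p.
  by rewrite -Hp -(is_derive_unique _ _ _ (chain_rule p1 a b 0 Hp1 exa exb)).
have dv1 : Derive v 0 = 0 by case: V2v => _ [].
(* The differential of [p2] kills the velocity. If it also killed the transverse vector e, it would
   be zero, contradicting p2(phi(0, y)) = y. *)
have Hnd2 : deriv e p2 p <> 0.
  move=> De; have [Dx Dy] : dx p2 p = 0 /\ dy p2 p = 0.
    move: dv0 De; rewrite /deriv -/(dx p2 p) -/(dy p2 p) /= => M1 M2.
    split; apply: (Rmult_eq_reg_l _ _ _ _ Hdet).
    - have -> : (fst e * Derive b 0 - snd e * Derive a 0) * dx p2 p =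
        Derive b 0 * (fst e * dx p2 p + snd e * dy p2 p) -
        snd e * (Derive a 0 * dx p2 p + Derive b 0 * dy p2 p) by ring.
      by rewrite M1 M2; ring.
    - have -> : (fst e * Derive b 0 - snd e * Derive a 0) * dy p2 p =
        fst e * (Derive a 0 * dx p2 p + Derive b 0 * dy p2 p) -
        Derive a 0 * (fst e * dx p2 p + snd e * dy p2 p) by ring.
      by rewrite M1 M2; ring.
  have W1 : smooth0 (fun y => fst (phi (0, y))) by apply: (smooth0_comp _ (fun _ => 0) (fun y => y) F1); solve_smooth0.
  have W2 : smooth0 (fun y => snd (phi (0, y))) by apply: (smooth0_comp _ (fun _ => 0) (fun y => y) F2); solve_smooth0.
  have Hphi0 : (fst (phi (0, 0)), snd (phi (0, 0))) = p by rewrite -surjective_pairing.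
  have Hp2' : Cinf p2 (fst (phi (0, 0)), snd (phi (0, 0))) by rewrite Hphi0 -Hp.
  have H1 := chain_rule p2 _ _ 0 Hp2' (ex_intro _ _ (smooth0_is_derive _ W1)) (ex_intro _ _ (smooth0_is_derive _ W2)).
  have H2 : is_derive (fun y => p2 (fst (phi (0, y)), snd (phi (0, y)))) 0 1.
    apply: (is_derive_ext_loc (fun y => y)); last exact: is_derive_id.
    have := locally_along _ (fun _ => 0) (fun y => y) 0 (continuous_const _ _) (continuous_id _) E1.
    by apply: filter_imp => y; rewrite /p2 -surjective_pairing => ->.
  have := is_derive_unique _ _ _ H2; rewrite (is_derive_unique _ _ _ H1).
  rewrite /deriv Hphi0 -/(dx p2 p) -/(dy p2 p) Dx Dy; lra.
(* As v'(0) = 0, having u'(0) = 0 too would give the curve phi(u, v) zero velocity. *)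
have Hdu : Derive u 0 <> 0.
  move=> Du; apply: Hdet.
  have E0 : (u 0, v 0) = (0, 0) by rewrite u0 v0.
  have zero_of : forall F w, Cinf F (0, 0) -> locally 0 (fun t => F (u t, v t) = w t) -> Derive w 0 = 0.
    move=> F w HF Ew; rewrite -(Derive_ext_loc _ _ _ Ew); apply: is_derive_unique.
    evar_last.
      apply: chain_rule; [by rewrite E0|by eexists; exact: smooth0_is_derive|by eexists; exact: smooth0_is_derive].
    by rewrite /deriv /= Du dv1; ring.
  have Eab := near _ E2.
  rewrite (zero_of _ a F1); last by apply: filter_imp Eab => t; rewrite /u /v /p1 /p2 -surjective_pairing => ->.
  rewrite (zero_of _ b F2); last by apply: filter_imp Eab => t; rewrite /u /v /p1 /p2 -surjective_pairing => ->.
  ring.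
have Hde : forall w, Cinf w (a 0, b 0) -> smooth0 (fun t => deriv e w (a t, b t)).
  move=> w Hw; apply: (smooth0_comp (fun q => fst e * dx w q + snd e * dy w q)) => //.
  by apply: Cinf_plus; apply: Cinf_mult; (exact: Cinf_const || exact: Cinf_dx || exact: Cinf_dy).
have S1 := Hde _ Hp1; have S2 := Hde _ Hp2.
have EP : locally 0 (fun t => deriv e g (a t, b t) - s1 * (5 * u t ^ 4 * deriv e p1 (a t, b t)) =
    v t * (2 * s2 * deriv e p2 (a t, b t))).
  have Hpart : locally p (fun r => forall X, deriv X g r =
       s1 * (5 * p1 r ^ 4 * deriv X p1 r) + s2 * (2 * p2 r * deriv X p2 r)).
    rewrite Hp in Hp1 Hp2.
    apply: filter_imp (filter_and _ _ (locally_locally _ _ Eg)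
      (filter_and _ _ (Cinf_locally _ _ Hp1) (Cinf_locally _ _ Hp2))) => r.
    move=> [Er [/Cinf_partials H1 /Cinf_partials H2]] X.
    have D : forall (w1 w2 : R -> R) t l1 l2, is_derive w1 t l1 -> is_derive w2 t l2 ->
        is_derive (fun s => c + s1 * w1 s ^ 5 + s2 * w2 s ^ 2) t (s1 * (5 * w1 t ^ 4 * l1) + s2 * (2 * w2 t * l2)).
      move=> w1 w2 t l1 l2 K1 K2; auto_derive; first by split; [eexists; exact: K1|split; [eexists; exact: K2|]].
      by rewrite (is_derive_unique _ _ _ K1) (is_derive_unique _ _ _ K2); ring.
    have HD : partials g (fun r => s1 * (5 * p1 r ^ 4 * dx p1 r) + s2 * (2 * p2 r * dx p2 r))
                         (fun r => s1 * (5 * p1 r ^ 4 * dy p1 r) + s2 * (2 * p2 r * dy p2 r)) r.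
      apply: (partials_ext (fun r => c + s1 * p1 r ^ 5 + s2 * p2 r ^ 2)).
        by apply: filter_imp Er => s ->.
      case: H1 => H1x H1y; case: H2 => H2x H2y; case: r Er H1x H1y H2x H2y => x y Er /= *.
      by split; apply: D.
    have [Gx Gy] := partialsE _ _ _ _ HD.
    by rewrite /deriv -/(dx g r) -/(dy g r) -/(dx p1 r) -/(dy p1 r) -/(dx p2 r) -/(dy p2 r) Gx Gy; ring.
  by apply: filter_imp (near _ Hpart) => t ->; rewrite -/(u t) -/(v t); ring.
(* The transverse derivative of g is a term in u^4 plus v times a function nonzero at 0, so its
   order 3 passes to v. *)
have V3v : flat 3 v.
  apply: (flat_unit 3 v (fun t => 2 * s2 * deriv e p2 (a t, b t))) => //; [by solve_smooth0|by rewrite Hp; nra|].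
  apply: (flat_ext _ _ _ EP); apply: flat_minus => //; [|by solve_smooth0|].
    by apply: Hde; rewrite Hp.
  apply: flat_mult_r; [by solve_smooth0|by solve_smooth0|]; apply: flat_mult_l; [by solve_smooth0|by solve_smooth0|].
  by apply: flat_mult_r; [solve_smooth0|solve_smooth0|apply: (flat_le 3 4 _ _ (flat_pow_l 4 1 u Hu (proj2 (flat1 u) u0))); lia].
split; first exact: (VQ 3%nat V3v).
(* Now v^2 is flat to order 6, so a sixth order for g - g(p) would belong to u^5 and force u'(0) =
   0. *)
move=> V6; have V6u : flat 6 (fun t => u t ^ 5).
  apply: (flat_unit 6 _ (fun _ => s1)) => //; [solve_smooth0|solve_smooth0|].
  apply: (flat_ext _ (fun t => (g (a t, b t) - g p) - s2 * (v t * v t))).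
    by apply: filter_imp EQ => t <-; ring.
  apply: flat_minus => //; first by solve_smooth0.
  by apply: flat_mult_r; [solve_smooth0|solve_smooth0|apply: (flat_mult 3 3)].
by have [_ []] := flat_pow_root 5 u Hu (proj2 (flat1 u) u0) V6u.
Qed.

(** * The support function along a principal line *)

Definition smooth0_3 (c : R -> R3) : Prop :=
  [/\ smooth0 (fun t => fst (fst (c t))), smooth0 (fun t => snd (fst (c t))) & smooth0 (fun t => snd (c t))].

Definition velocity3 (c : R -> R3) (t : R) : R3 :=
  (Derive (fun s => fst (fst (c s))) t, Derive (fun s => snd (fst (c s))) t,
   Derive (fun s => snd (c s)) t).

Lemma smooth0_3_velocity3 c : smooth0_3 c -> smooth0_3 (velocity3 c).
Proof. by move=> [H1 H2 H3]; split; apply: smooth0_Derive. Qed.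

Lemma smooth0_dot a b : smooth0_3 a -> smooth0_3 b -> smooth0 (fun t => dot (a t) (b t)).
Proof. by move=> [H1 H2 H3] [H4 H5 H6]; rewrite /dot; solve_smooth0. Qed.

Lemma dot_derive a b : smooth0_3 a -> smooth0_3 b ->
  locally 0 (fun t => is_derive (fun s => dot (a s) (b s)) t (dot (velocity3 a t) (b t) + dot (a t) (velocity3 b t))).
Proof.
move=> [/smooth0_locally H1 /smooth0_locally H2 /smooth0_locally H3] [/smooth0_locally H4 /smooth0_locally H5 /smooth0_locally H6].
apply: filter_imp (filter_and _ _ (filter_and _ _ H1 (filter_and _ _ H2 H3)) (filter_and _ _ H4 (filter_and _ _ H5 H6))).
move=> t [[K1 [K2 K3]] [K4 [K5 K6]]]; rewrite /dot.
evar_last.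
  apply: is_derive_plus; first apply: is_derive_plus;
    (apply: (@is_derive_mult R_AbsRing); [| |exact: Rmult_comm]); eassumption.
by rewrite /plus /mult /velocity3 /=; ring.
Qed.

Section PrincipalLine.

Variables (n xi w E : R -> R3) (r lam : R -> R).
Hypotheses (Hn : smooth0_3 n) (Hxi : smooth0_3 xi) (HE : smooth0_3 E) (Hr : smooth0 r).
Hypothesis Hn_xi : locally 0 (fun t => dot (n t) (xi t) = 1).
Hypothesis Hn_w : locally 0 (fun t => dot (n t) (w t) = 0).
Hypothesis Hdxi : locally 0 (fun t => forall v, dot v (velocity3 xi t) = - lam t * dot v (w t)).
Hypothesis HdE : locally 0 (fun t => forall v, dot v (velocity3 E t) = - Derive r t * dot v (xi t)).
Hypothesis HE0 : forall v, dot v (E 0) = 0.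
Hypothesis Hkappa : lam 0 * dot (velocity3 n 0) (w 0) <> 0.

Let dr := Derive r.

Lemma Derive_dot_focal A : smooth0_3 A -> locally 0 (fun t => dot (velocity3 A t) (E t) + - (dr t * dot (A t) (xi t)) =
  Derive (fun s => dot (A s) (E s)) t).
Proof.
move=> HA; apply: filter_imp (filter_and _ _ (dot_derive _ _ HA HE) HdE) => t [H1 H2].
by rewrite (is_derive_unique _ _ _ H1) H2 /dr; ring.
Qed.

(** E(0) = 0 and (A.E)' = A'.E - r' A.xi. Both terms are flat to order k, the first by induction
    applied to A'. *)
Lemma flat_dot_focal k A : smooth0_3 A -> flat k dr -> flat (S k) (fun t => dot (A t) (E t)).
Proof.
elim: k A => [|k IH] A HA HV; split; try by [].
apply: (flat_ext _ _ _ (Derive_dot_focal _ HA)).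
have HA' := smooth0_3_velocity3 _ HA; have S1 := smooth0_dot _ _ HA' HE; have S2 := smooth0_dot _ _ HA Hxi.
have S3 : smooth0 dr by apply: smooth0_Derive.
apply: flat_plus; [by []|by solve_smooth0| |].
- by apply: IH => //; apply: flat_le HV; lia.
- by apply: flat_opp; [solve_smooth0|apply: flat_mult_l].
Qed.

(* Orthogonality of A to xi gains one order. *)
Lemma Derive_dot_focal_orth A : smooth0_3 A -> locally 0 (fun t => dot (A t) (xi t) = 0) ->
  locally 0 (fun t => dot (velocity3 A t) (E t) = Derive (fun s => dot (A s) (E s)) t).
Proof.
move=> HA HAx; apply: filter_imp (filter_and _ _ (Derive_dot_focal _ HA) HAx) => t [<- ->]; ring.
Qed.

(** Three orders from r'(0) = 0 alone: one because E(0) = 0, and two for the derivative A'.E by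
    [flat_dot_focal], the term in r' being absent by orthogonality. *)
Lemma flat3_dot_focal A : smooth0_3 A -> locally 0 (fun t => dot (A t) (xi t) = 0) ->
  flat 1 dr -> flat 3 (fun t => dot (A t) (E t)).
Proof.
move=> HA HAx HV; have HA' := smooth0_3_velocity3 _ HA.
split; first exact: HE0.
by apply: (flat_ext _ _ _ (Derive_dot_focal_orth _ HA HAx)); apply: flat_dot_focal.
Qed.

Let Q t := dot (n t) (E t) + r t.

Lemma dn_xi : locally 0 (fun t => dot (velocity3 n t) (xi t) = 0).
Proof.
apply: filter_imp (filter_and _ _ (filter_and _ _ (dot_derive _ _ Hn Hxi) (locally_locally _ _ Hn_xi))
  (filter_and _ _ Hn_w Hdxi)) => t [[H1 H2] [H3 H4]].
have H5 : is_derive (fun s => dot (n s) (xi s)) t 0.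
  apply: (is_derive_ext_loc (fun _ => 1)); last exact: is_derive_const.
  by apply: filter_imp H2 => s ->.
move: (is_derive_unique _ _ _ H1); rewrite (is_derive_unique _ _ _ H5) H4 H3; lra.
Qed.

Lemma Derive_support1 : locally 0 (fun t => dot (velocity3 n t) (E t) = Derive Q t).
Proof.
apply: filter_imp (filter_and _ _ (filter_and _ _ (dot_derive _ _ Hn HE) Hn_xi)
  (filter_and _ _ HdE (smooth0_locally _ Hr))) => t [[H1 H2] [H3 H4]].
symmetry; apply: is_derive_unique; evar_last.
  by apply: is_derive_plus; [exact: H1|exact: H4].
by rewrite H3 H2 /plus /=; ring.
Qed.

Lemma Derive_support2 : locally 0 (fun t => dot (velocity3 (velocity3 n) t) (E t) = Derive (Derive Q) t).
Proof.
have H := Derive_dot_focal_orth _ (smooth0_3_velocity3 _ Hn) dn_xi.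
apply: filter_imp (filter_and _ _ H (Derive_ext_germ _ _ Derive_support1)) => t [-> ->] //.
Qed.

Let kappa t := dot (velocity3 (velocity3 n) t) (xi t).

(** Differentiating nu'.xi = 0 gives nu''.xi = - nu'.xi' = lam nu'.f', the quantity assumed
    nonzero. *)
Lemma kappa_neq0 : kappa 0 <> 0.
Proof.
have Hn' := smooth0_3_velocity3 _ Hn.
have [H1 [H2 H3]] := locally_singleton _ _ (filter_and _ _ (dot_derive _ _ Hn' Hxi)
  (filter_and _ _ (locally_locally _ _ dn_xi) Hdxi)).
have H5 : is_derive (fun s => dot (velocity3 n s) (xi s)) 0 0.
  apply: (is_derive_ext_loc (fun _ => 0)); last exact: is_derive_const.
  by apply: filter_imp H2 => s ->.
move: (is_derive_unique _ _ _ H1); rewrite (is_derive_unique _ _ _ H5) H3 -/(kappa 0) => H6 H7.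
by apply: Hkappa; rewrite H7 in H6; lra.
Qed.

Lemma Derive_support3 :
  locally 0 (fun t => dot (velocity3 (velocity3 (velocity3 n)) t) (E t) + - (dr t * kappa t) = Derive (Derive (Derive Q)) t).
Proof.
have H := Derive_dot_focal _ (smooth0_3_velocity3 _ (smooth0_3_velocity3 _ Hn)).
by apply: filter_imp (filter_and _ _ H (Derive_ext_germ _ _ Derive_support2)) => t [-> ->].
Qed.

(** The values of g - g(p), g' and g'' at 0 vanish unconditionally because E(0) = 0, so only g'''
    has to be compared with r'. *)
Lemma support_order k : flat (3 + k) (fun t => Q t - Q 0) <-> flat k (Derive r).
Proof.
have Hn1 := smooth0_3_velocity3 _ Hn; have Hn2 := smooth0_3_velocity3 _ Hn1; have Hn3 := smooth0_3_velocity3 _ Hn2.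
have S1 : smooth0 (fun t => dot (velocity3 (velocity3 (velocity3 n)) t) (E t)) by apply: smooth0_dot.
have S2 : smooth0 kappa by apply: smooth0_dot.
have S3 : smooth0 dr by apply: smooth0_Derive.
have SQ : smooth0 Q by apply: smooth0_plus => //; apply: smooth0_dot.
have Hsub : locally 0 (fun t => Derive Q t = Derive (fun t => Q t - Q 0) t).
  apply: filter_imp (smooth0_locally _ SQ) => t Ht; symmetry; apply: is_derive_unique.
  evar_last.
    by apply: is_derive_minus; [exact: Ht|exact: is_derive_const].
  by rewrite /minus /plus /opp /zero /=; ring.
have E3 : flat (3 + k) (fun t => Q t - Q 0) <-> flat k (Derive (Derive (Derive Q))).
  split.
  - move=> HV; have H : flat (2 + k) (Derive (fun t => Q t - Q 0)) by case: HV.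
    have [_ [_ H']] : flat (2 + k) (Derive Q).
      by apply: flat_ext H; apply: filter_imp Hsub => t ->.
    exact: H'.
  - move=> H; split; first by ring.
    have : flat (2 + k) (Derive Q); last by apply: flat_ext Hsub.
    split; last split => //.
    + by rewrite -(locally_singleton _ _ Derive_support1).
    + by rewrite -(locally_singleton _ _ Derive_support2).
rewrite E3 -/dr; split; last first.
  move=> H; apply: (flat_ext _ _ _ Derive_support3); apply: flat_plus; [by []|by solve_smooth0| |].
  - by apply: (flat_le k (S k)); [lia|exact: flat_dot_focal].
  - by apply: flat_opp; [solve_smooth0|exact: flat_mult_l].
elim: k {E3} => [|k IH] // H.
(* Flatness of r' to order k makes nu'''.E flat to order k + 1. The term r' kappa thus inherits
   order k + 1 from g''', and kappa is divided out. *)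
have Hk : flat k dr by apply: IH; apply: flat_le H; lia.
apply: (flat_unit _ _ kappa) => //; first exact: kappa_neq0.
apply: (flat_ext _ (fun t => dot (velocity3 (velocity3 (velocity3 n)) t) (E t) - Derive (Derive (Derive Q)) t)).
  by apply: filter_imp Derive_support3 => t <-; ring.
by apply: flat_minus => //; [solve_smooth0|exact: flat_dot_focal].
Qed.

End PrincipalLine.

(** * Geometry of equiaffine line congruences *)

Lemma deriv_ext X f g q : locally q (fun r => f r = g r) -> deriv X f q = deriv X g q.
Proof.
move=> H; rewrite /deriv; congr (_ * _ + _ * _); apply: Derive_ext_loc.
- exact: (slice_x (fun r => f r = g r)).
- exact: (slice_y (fun r => f r = g r)).
Qed.

Lemma deriv_of_partials X g gx gy q : partials g gx gy q -> deriv X g q = fst X * gx q + snd X * gy q.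
Proof. by move=> /partialsE [<- <-]. Qed.

Lemma deriv_const X c q : deriv X (fun _ => c) q = 0.
Proof. by rewrite /deriv !Derive_const; ring. Qed.

Lemma deriv_plus X f g q : Cinf f q -> Cinf g q ->
  deriv X (fun r => f r + g r) q = deriv X f q + deriv X g q.
Proof.
move=> /Cinf_partials [H1 H2] /Cinf_partials [H3 H4].
rewrite (deriv_of_partials _ _ (fun r => dx f r + dx g r) (fun r => dy f r + dy g r)).
- by rewrite /deriv -/(dx f q) -/(dy f q) -/(dx g q) -/(dy g q); ring.
- by split; apply: is_derive_plus.
Qed.

Lemma deriv_mult X f g q : Cinf f q -> Cinf g q ->
  deriv X (fun r => f r * g r) q = deriv X f q * g q + f q * deriv X g q.
Proof.
move=> /Cinf_partials [H1 H2] /Cinf_partials [H3 H4].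
rewrite (deriv_of_partials _ _ (fun r => dx f r * g r + f r * dx g r) (fun r => dy f r * g r + f r * dy g r)).
- by rewrite /deriv -/(dx f q) -/(dy f q) -/(dx g q) -/(dy g q); ring.
- case: q H1 H2 H3 H4 => x y /= *; split => /=;
    by apply: (@is_derive_mult R_AbsRing) => // *; exact: Rmult_comm.
Qed.

Lemma deriv_inv X f q : Cinf f q -> f q <> 0 -> deriv X (fun r => / f r) q = - deriv X f q / f q ^ 2.
Proof.
move=> Hf H0.
have E : deriv X (fun r => f r * / f r) q = 0.
  rewrite -(deriv_const X 1 q); apply: deriv_ext.
  by apply: filter_imp (Cinf_neq0 _ _ Hf H0) => r Hr; field.
rewrite deriv_mult // in E; last exact: Cinf_inv.
apply: (Rmult_eq_reg_l (f q)) => //.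
have -> : f q * (- deriv X f q / f q ^ 2) = - (deriv X f q * / f q) by field.
lra.
Qed.

Lemma deriv_comb a b X Y g q :
  deriv (a * fst X + b * fst Y, a * snd X + b * snd Y) g q = a * deriv X g q + b * deriv Y g q.
Proof. by rewrite /deriv /=; ring. Qed.

Lemma Cinf_deriv X g q : Cinf g q -> Cinf (deriv X g) q.
Proof.
move=> Hg; apply: Cinf_plus; apply: Cinf_mult; try exact: Cinf_const; [exact: Cinf_dx|exact: Cinf_dy].
Qed.

Lemma dx_dy_comm g q : Cinf g q -> dx (dy g) q = dy (dx g) q.
Proof.
case: q => x y Hg.
apply: (Schwarz (fun x y => g (x, y))).
- apply/locally_2d_locally; apply: filter_imp (Cinf_locally _ _ Hg) => -[u v] Huv /=.
  have [H1 H2] := Cinf_partials _ _ Huv.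
  have [H3 _] := Cinf_partials _ _ (Cinf_dy _ _ Huv).
  have [_ H4] := Cinf_partials _ _ (Cinf_dx _ _ Huv).
  by split; [|split; [|split]]; eexists; eassumption.
- exact: (Cinf_continuity_2d (dx (dy g)) x y (Cinf_dx _ _ (Cinf_dy _ _ Hg))).
- exact: (Cinf_continuity_2d (dy (dx g)) x y (Cinf_dy _ _ (Cinf_dx _ _ Hg))).
Qed.

Lemma deriv_comm X Y g q : Cinf g q -> deriv X (deriv Y g) q = deriv Y (deriv X g) q.
Proof.
move=> Hg; have Hx := Cinf_dx _ _ Hg; have Hy := Cinf_dy _ _ Hg.
have D : forall X Y, deriv X (deriv Y g) q = fst Y * deriv X (dx g) q + snd Y * deriv X (dy g) q.
  move=> X' Y'; rewrite [LHS](deriv_plus X' (fun r => fst Y' * dx g r) (fun r => snd Y' * dy g r));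
    try by apply: Cinf_mult => //; exact: Cinf_const.
  by rewrite !deriv_mult ?deriv_const //; try exact: Cinf_const; ring.
rewrite !D /deriv -!/(dx _ q) -!/(dy _ q) dx_dy_comm //; ring.
Qed.

Definition Cinf3 (F : R2 -> R3) (q : R2) : Prop :=
  [/\ Cinf (fun r => fst (fst (F r))) q, Cinf (fun r => snd (fst (F r))) q & Cinf (fun r => snd (F r)) q].

Lemma Cinf3_locally F q : Cinf3 F q -> locally q (Cinf3 F).
Proof.
move=> [/Cinf_locally H1 /Cinf_locally H2 /Cinf_locally H3].
by apply: filter_imp (filter_and _ _ H1 (filter_and _ _ H2 H3)) => r [? []].
Qed.

Lemma Cinf3_deriv3 X F q : Cinf3 F q -> Cinf3 (deriv3 X F) q.
Proof. by move=> [H1 H2 H3]; split; apply: Cinf_deriv. Qed.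

Lemma Cinf_dot F G q : Cinf3 F q -> Cinf3 G q -> Cinf (fun r => dot (F r) (G r)) q.
Proof.
move=> [H1 H2 H3] [H4 H5 H6].
by apply: Cinf_plus; first apply: Cinf_plus; apply: Cinf_mult.
Qed.

Lemma deriv_dot X F G q : Cinf3 F q -> Cinf3 G q ->
  deriv X (fun r => dot (F r) (G r)) q = dot (deriv3 X F q) (G q) + dot (F q) (deriv3 X G q).
Proof.
move=> [H1 H2 H3] [H4 H5 H6]; rewrite /dot.
by rewrite !deriv_plus ?deriv_mult //=; try (try apply: Cinf_plus; apply: Cinf_mult => //); ring.
Qed.

Lemma deriv3_comm X Y F q : Cinf3 F q -> deriv3 X (deriv3 Y F) q = deriv3 Y (deriv3 X F) q.
Proof.
by move=> [H1 H2 H3]; rewrite /deriv3 /=; congr (_, _, _); apply: deriv_comm.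
Qed.

Lemma dot_deriv3_comb v a b X Y F q :
  dot v (deriv3 (a * fst X + b * fst Y, a * snd X + b * snd Y) F q) =
  a * dot v (deriv3 X F q) + b * dot v (deriv3 Y F q).
Proof. by rewrite /dot /deriv3 !deriv_comb /=; ring. Qed.

Lemma smooth3_Cinf3 U F q : open U -> U q -> smooth3_on U F -> Cinf3 F q.
Proof. by move=> HU Hq [H1 [H2 H3]]; split; apply: (smooth_on_Cinf U). Qed.

Definition cross (v w : R3) : R3 :=
  (snd (fst v) * snd w - snd v * snd (fst w),
   snd v * fst (fst w) - fst (fst v) * snd w,
   fst (fst v) * snd (fst w) - snd (fst v) * fst (fst w)).

(** If the i-th coordinate of v is nonzero, the relation is - w_i v + v_i w = 0; if v = 0, take the
    coefficients (1, 0). *)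
Lemma cross_eq0 (v w : R3) : cross v w = (0, 0, 0) ->
  exists X : R2, X <> (0, 0) /\ (fst X * fst (fst v) + snd X * fst (fst w) = 0 /\
    fst X * snd (fst v) + snd X * snd (fst w) = 0 /\ fst X * snd v + snd X * snd w = 0).
Proof.
case: v => -[v1 v2] v3; case: w => -[w1 w2] w3; rewrite /cross /= => -[E1 E2 E3].
case: (Req_dec v1 0) => [H1|H1]; last first.
  by exists (- w1, v1) => /=; split; [case|repeat split; lra].
case: (Req_dec v2 0) => [H2|H2]; last first.
  by exists (- w2, v2) => /=; split; [case|repeat split; lra].
case: (Req_dec v3 0) => [H3|H3]; last first.
  by exists (- w3, v3) => /=; split; [case|repeat split; lra].
by exists (1, 0) => /=; split; [case; lra|rewrite H1 H2 H3; repeat split; ring].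
Qed.

(** * The co-normal and the affine metric *)

Section Congruence.

Variables (U : R2 -> Prop) (f xi : R2 -> R3) (S : R2 -> mat2) (tau : R2 -> R2 -> R)
  (h : R2 -> R2 -> R2 -> R) (nu : R2 -> R3).
Hypotheses (hcongr : line_congruence U f xi) (hstruct : structure_equations U f xi S tau h)
  (hequi : equiaffine U tau h) (hnu : conormal U f xi nu).

Lemma congr_Cinf3 q : U q -> Cinf3 f q /\ Cinf3 xi q.
Proof. by case: hcongr => HU Hf Hx _ _ Hq; split; apply: (smooth3_Cinf3 U). Qed.

Lemma congr_locally q : U q -> locally q U.
Proof. by case: hcongr => HU _ _ _ _; exact: HU. Qed.

Lemma conormal_tangent q X : U q -> dot (nu q) (deriv3 X f q) = 0.
Proof. by move=> Hq; case: (hnu q Hq). Qed.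

Lemma conormal_xi q : U q -> dot (nu q) (xi q) = 1.
Proof. by move=> Hq; case: (hnu q Hq). Qed.

Lemma dot_dxi v q X : U q -> dot v (deriv3 X xi q) = - dot v (deriv3 (mat2_app (S q) X) f q).
Proof.
move=> Hq; rewrite (proj1 hstruct q Hq X) (proj1 hequi q Hq X).
by rewrite /dot /plus /opp /scal /= /prod_plus /prod_opp /prod_scal /= /plus /opp /scal /= /mult /=; ring.
Qed.

(* nu = (f_u x f_v) / det(f_u, f_v, xi). *)
Lemma conormal_Cinf3 q : U q -> Cinf3 nu q.
Proof.
move=> Hq; have [Hf Hxi] := congr_Cinf3 q Hq.
pose c r := cross (deriv3 (1, 0) f r) (deriv3 (0, 1) f r).
have Hc : Cinf3 c q.
  have [F1 F2 F3] := Cinf3_deriv3 (1, 0) _ _ Hf; have [G1 G2 G3] := Cinf3_deriv3 (0, 1) _ _ Hf.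
  by split; apply: Cinf_minus; apply: Cinf_mult.
pose D r := dot (c r) (xi r).
have HD : Cinf D q by exact: Cinf_dot.
have E : forall r, U r -> [/\ D r * fst (fst (nu r)) = fst (fst (c r)),
     D r * snd (fst (nu r)) = snd (fst (c r)) & D r * snd (nu r) = snd (c r)].
  move=> r Hr; have := conormal_xi r Hr.
  have := conormal_tangent r (1, 0) Hr; have := conormal_tangent r (0, 1) Hr.
  rewrite /D /c; move: (deriv3 (1, 0) f r) (deriv3 (0, 1) f r) (xi r) (nu r).
  move=> [[a1 a2] a3] [[b1 b2] b3] [[x1 x2] x3] [[n1 n2] n3]; rewrite /dot /cross /= => H1 H2 H3.
  split.
  (* Cramer's rule: det(a, b, x) n = (n.x) a x b + (n.a) b x x + (n.b) x x a, where the middle sign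
     in each product is the cross product. The last two scalar coefficients are zero and the first
     is 1. *)
  - transitivity ((n1 * x1 + n2 * x2 + n3 * x3) * (a2 * b3 - a3 * b2) +
      (n1 * a1 + n2 * a2 + n3 * a3) * (b2 * x3 - b3 * x2) +
      (n1 * b1 + n2 * b2 + n3 * b3) * (x2 * a3 - x3 * a2)); [ring|rewrite H1 H2 H3; ring].
  - transitivity ((n1 * x1 + n2 * x2 + n3 * x3) * (a3 * b1 - a1 * b3) +
      (n1 * a1 + n2 * a2 + n3 * a3) * (b3 * x1 - b1 * x3) +
      (n1 * b1 + n2 * b2 + n3 * b3) * (x3 * a1 - x1 * a3)); [ring|rewrite H1 H2 H3; ring].
  - transitivity ((n1 * x1 + n2 * x2 + n3 * x3) * (a1 * b2 - a2 * b1) +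
      (n1 * a1 + n2 * a2 + n3 * a3) * (b1 * x2 - b2 * x1) +
      (n1 * b1 + n2 * b2 + n3 * b3) * (x1 * a2 - x2 * a1)); [ring|rewrite H1 H2 H3; ring].
(* From D nu = c, a zero of D would make c vanish, so f_u and f_v would be linearly dependent. *)
have D0 : D q <> 0.
  move=> D0; have [E1 E2 E3] := E q Hq; rewrite D0 !Rmult_0_l in E1 E2 E3.
  have c0 : c q = (0, 0, 0).
    by rewrite [c q]surjective_pairing [fst (c q)]surjective_pairing -E1 -E2 -E3.
  have [X [HX [X1 [X2 X3]]]] := cross_eq0 _ _ c0.
  apply: HX; change (X = zero); apply: (lc_immersion _ _ _ hcongr q Hq).
  rewrite /deriv3 /zero /= /prod_zero /= /zero /=.
  move: X1 X2 X3; rewrite /deriv3 /deriv /= => X1 X2 X3.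
  by congr (_, _, _); [apply: eq_trans X1|apply: eq_trans X2|apply: eq_trans X3]; rewrite /deriv /=; ring.
have L : locally q (fun r => U r /\ D r <> 0).
  by apply: filter_and; [exact: congr_locally|exact: Cinf_neq0].
case: Hc => C1 C2 C3; split.
- apply: (Cinf_ext (fun r => fst (fst (c r)) / D r)); last exact: Cinf_div.
  by apply: filter_imp L => r [/E [<- _ _] Hr]; move: (D r) Hr => d Hd; field.
- apply: (Cinf_ext (fun r => snd (fst (c r)) / D r)); last exact: Cinf_div.
  by apply: filter_imp L => r [/E [_ <- _] Hr]; move: (D r) Hr => d Hd; field.
- apply: (Cinf_ext (fun r => snd (c r) / D r)); last exact: Cinf_div.
  by apply: filter_imp L => r [/E [_ _ <-] Hr]; move: (D r) Hr => d Hd; field.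
Qed.

Lemma dconormal_xi q X : U q -> dot (deriv3 X nu q) (xi q) = 0.
Proof.
move=> Hq; have [Hf Hxi] := congr_Cinf3 q Hq.
have := deriv_dot X _ _ q (conormal_Cinf3 q Hq) Hxi.
rewrite dot_dxi // conormal_tangent // (deriv_ext _ _ (fun _ => 1)).
  by rewrite deriv_const; lra.
by apply: filter_imp (congr_locally q Hq) => r; exact: conormal_xi.
Qed.

(** This is - h: differentiating nu . df(Y) = 0 turns it into - nu . D_X D_Y f. In this form
    symmetry is the commutation of partial derivatives, and linearity is visible. *)
Definition affine_metric (q X Y : R2) : R := dot (deriv3 X nu q) (deriv3 Y f q).

Lemma affine_metricE q X Y : U q -> affine_metric q X Y = - dot (nu q) (deriv3 X (deriv3 Y f) q).
Proof.
move=> Hq; have [Hf Hxi] := congr_Cinf3 q Hq.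
have := deriv_dot X _ _ q (conormal_Cinf3 q Hq) (Cinf3_deriv3 Y _ _ Hf).
rewrite (deriv_ext _ _ (fun _ => 0)); last first.
  by apply: filter_imp (congr_locally q Hq) => r; exact: conormal_tangent.
by rewrite deriv_const /affine_metric; lra.
Qed.

Lemma affine_metric_sym q X Y : U q -> affine_metric q X Y = affine_metric q Y X.
Proof.
move=> Hq; have [Hf Hxi] := congr_Cinf3 q Hq.
by rewrite !affine_metricE // deriv3_comm.
Qed.

Lemma affine_metric_comb q a b X Y Z :
  affine_metric q Z (a * fst X + b * fst Y, a * snd X + b * snd Y) =
  a * affine_metric q Z X + b * affine_metric q Z Y.
Proof. exact: dot_deriv3_comb. Qed.

(** Pairing the structure equation for the constant field Y with nu leaves h(X, Y), so
    non-degeneracy of h transfers. *)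
Lemma affine_metric_nondegenerate q X : U q -> (forall Y, affine_metric q X Y = 0) -> X = zero.
Proof.
move=> Hq H; apply: (proj2 hequi q Hq) => Y; have [Hf Hxi] := congr_Cinf3 q Hq.
have := H Y; rewrite affine_metricE //.
have [|Z HZ] := proj2 hstruct q Hq X (fun _ => Y).
  by split=> r Hr; apply: (locally_singleton r); apply/Cinf_smooth_at; exact: Cinf_const.
rewrite [deriv3 X (deriv3 Y f) q]HZ.
have -> : dot (nu q) (plus (deriv3 Z f q) (scal (h q X Y) (xi q))) =
  dot (nu q) (deriv3 Z f q) + h q X Y * dot (nu q) (xi q).
  by rewrite /dot /plus /scal /= /prod_plus /prod_scal /= /plus /scal /= /mult /=; ring.
by rewrite conormal_tangent // conormal_xi //; lra.
Qed.

Lemma basis_decomposition (a b Y : R2) : fst a * snd b - snd a * fst b <> 0 ->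
  exists s t, Y = (s * fst a + t * fst b, s * snd a + t * snd b).
Proof.
move=> Hd; exists ((fst Y * snd b - snd Y * fst b) / (fst a * snd b - snd a * fst b)).
exists ((fst a * snd Y - snd a * fst Y) / (fst a * snd b - snd a * fst b)).
by case: Y => y1 y2 /=; congr (_, _); field.
Qed.

Lemma affine_metric_basis q X a b : U q -> fst a * snd b - snd a * fst b <> 0 ->
  affine_metric q X a = 0 -> affine_metric q X b = 0 -> X = zero.
Proof.
move=> Hq Hd Ha Hb; apply: (affine_metric_nondegenerate q) => // Y.
have [s [t ->]] := basis_decomposition a b Y Hd.
by rewrite affine_metric_comb Ha Hb; ring.
Qed.

Lemma Cinf3_translate Z q : U q -> Cinf3 (fun r => minus Z (f r)) q.
Proof.
move=> Hq; have [[H1 H2 H3] _] := congr_Cinf3 q Hq.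
by split; apply: Cinf_minus => //; exact: Cinf_const.
Qed.

Lemma dot_deriv3_translate v X Z q : U q ->
  dot v (deriv3 X (fun r => minus Z (f r)) q) = - dot v (deriv3 X f q).
Proof.
move=> Hq; have [[H1 H2 H3] _] := congr_Cinf3 q Hq.
have E : forall (z : R) g, Cinf g q -> deriv X (fun r => z + - g r) q = - deriv X g q.
  move=> z g Hg; rewrite deriv_plus ?deriv_const; [|exact: Cinf_const|exact: Cinf_opp].
  rewrite (deriv_ext _ _ (fun r => -1 * g r)); last by apply: filter_forall => r; ring.
  by rewrite deriv_mult ?deriv_const //; [ring|exact: Cinf_const].
by rewrite /deriv3 /minus /plus /opp /= /prod_plus /prod_opp /= /plus /opp /= !E // /dot /=; ring.
Qed.

Lemma support_Cinf Z q : U q -> Cinf (fun r => support f nu r Z) q.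
Proof. by move=> Hq; apply: Cinf_dot; [exact: conormal_Cinf3|exact: Cinf3_translate]. Qed.

Lemma deriv_support Z q X : U q ->
  deriv X (fun r => support f nu r Z) q = dot (deriv3 X nu q) (minus Z (f q)).
Proof.
move=> Hq; rewrite /support deriv_dot; [|exact: conormal_Cinf3|exact: Cinf3_translate].
by rewrite dot_deriv3_translate // conormal_tangent //; ring.
Qed.

(** * The Hessian of the support function at a focal point *)

Definition focal_point (p : R2) (l : R) : R3 := plus (f p) (scal (/ l) (xi p)).

Lemma dot_focal_point v p l : dot v (minus (focal_point p l) (f p)) = / l * dot v (xi p).
Proof.
by rewrite /focal_point /dot /minus /plus /opp /scal /= /prod_plus /prod_opp /prod_scal /= /plus /opp /scal /= /mult /=; ring.
Qed.

Definition shape_defect (p : R2) (l : R) (X : R2) : R2 :=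
  (fst (mat2_app (S p) X) - l * fst X, snd (mat2_app (S p) X) - l * snd X).

(** At p the vector Z - f is xi / l. Differentiating dnu(X) . xi = 0 gives D_Y(dnu(X)) . xi = dnu(X)
    . df(S Y), and differentiating Z - f contributes - dnu(X) . df(Y); together they form (S - l)
    Y. *)
Lemma hessian_support p l X Y : U p -> l <> 0 ->
  deriv Y (deriv X (fun r => support f nu r (focal_point p l))) p =
  / l * affine_metric p X (shape_defect p l Y).
Proof.
move=> Hp Hl; have [Hf Hxi] := congr_Cinf3 p Hp; have Hnu := conormal_Cinf3 p Hp.
rewrite (deriv_ext _ _ (fun r => dot (deriv3 X nu r) (minus (focal_point p l) (f r)))); last first.
  by apply: filter_imp (congr_locally p Hp) => r; exact: deriv_support.
rewrite deriv_dot; [|exact: Cinf3_deriv3|exact: Cinf3_translate].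
rewrite dot_focal_point dot_deriv3_translate //.
have := deriv_dot Y _ _ p (Cinf3_deriv3 X _ _ Hnu) Hxi.
rewrite (deriv_ext _ _ (fun _ => 0)); last first.
  by apply: filter_imp (congr_locally p Hp) => r; exact: dconormal_xi.
rewrite deriv_const dot_dxi // -!/(affine_metric p X _) => H.
have -> : shape_defect p l Y = (1 * fst (mat2_app (S p) Y) + - l * fst Y, 1 * snd (mat2_app (S p) Y) + - l * snd Y).
  by rewrite /shape_defect; congr (_, _); ring.
rewrite affine_metric_comb.
have -> : dot (deriv3 Y (deriv3 X nu) p) (xi p) = affine_metric p X (mat2_app (S p) Y) by lra.
by field.
Qed.

(** On the quotient by the eigenline, S acts as the other eigenvalue. If (S - l) e were on that
    line, the trace would be 2 l and l a double eigenvalue, against delta > 0. *)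
Lemma shape_defect_det p l w e : w <> zero -> mat2_app (S p) w = scal l w -> 0 < delta S p ->
  fst w * snd e - snd w * fst e <> 0 ->
  fst w * snd (shape_defect p l e) - snd w * fst (shape_defect p l e) <> 0.
Proof.
rewrite /shape_defect /delta /mat2_app; case: w => w1 w2; case: e => x1 x2.
case: (S p) => a b c d; rewrite /scal /= /prod_scal /= /scal /= /mult /= => Hw [H1 H2] Hd Hdet H.
have Ht : (a + d - 2 * l) * (w1 * x2 - w2 * x1) = 0.
  have -> : (a + d - 2 * l) * (w1 * x2 - w2 * x1) =
    w1 * (c * x1 + d * x2 - l * x2) - w2 * (a * x1 + b * x2 - l * x1)
    + x2 * (a * w1 + b * w2 - l * w1) - x1 * (c * w1 + d * w2 - l * w2) by ring.
  by rewrite H H1 H2; ring.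
have {}Ht : a = 2 * l - d by case/Rmult_integral: Ht => //; lra.
subst a.
have K1 : w1 * (b * c + (d - l) ^ 2) = 0.
  have -> : w1 * (b * c + (d - l) ^ 2) = b * (c * w1 + d * w2 - l * w2) - (d - l) * ((2 * l - d) * w1 + b * w2 - l * w1) by ring.
  by rewrite H1 H2; ring.
have K2 : w2 * (b * c + (d - l) ^ 2) = 0.
  have -> : w2 * (b * c + (d - l) ^ 2) = c * ((2 * l - d) * w1 + b * w2 - l * w1) + (d - l) * (c * w1 + d * w2 - l * w2) by ring.
  by rewrite H1 H2; ring.
have Hbc : b * c + (d - l) ^ 2 <> 0 by nra.
case/Rmult_integral: K1 => // W1; case/Rmult_integral: K2 => // W2.
by apply: Hdet; rewrite W1 W2; ring.
Qed.

Lemma shape_defect_eigenvector p l w : mat2_app (S p) w = scal l w -> shape_defect p l w = (0, 0).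
Proof. by rewrite /shape_defect => ->; rewrite /scal /= /prod_scal /= /scal /= /mult /=; congr (_, _); ring. Qed.

(** Self-adjointness of S for the metric, obtained from the symmetry of the Hessian: the opposite
    entry contains (S - l) w = 0. *)
Lemma affine_metric_defect_eigenvector p l w e : U p -> l <> 0 -> mat2_app (S p) w = scal l w ->
  affine_metric p w (shape_defect p l e) = 0.
Proof.
move=> Hp Hl Hw; have Hg := support_Cinf (focal_point p l) p Hp.
have H := deriv_comm w e _ p Hg.
rewrite !hessian_support // shape_defect_eigenvector // in H.
have E0 : affine_metric p e (0, 0) = 0 by rewrite /affine_metric /dot /deriv3 /deriv /=; ring.
move: H; rewrite E0 Rmult_0_r => /esym /Rmult_integral [] //.
by move=> H; case: (Rinv_neq_0_compat l Hl).
Qed.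

(** Take e to be w turned by a right angle. Then w and (S - l) e form a basis, and w is
    metric-orthogonal to the second vector; were it also orthogonal to itself, the metric would
    degenerate. *)
Lemma principal_metric_neq0 p l w : U p -> l <> 0 -> w <> zero -> mat2_app (S p) w = scal l w ->
  0 < delta S p -> affine_metric p w w <> 0.
Proof.
move=> Hp Hl Hw HS Hd H0.
have Hdet : fst w * fst w - snd w * - snd w <> 0.
  move=> E; apply: Hw; case: w E {HS H0} => w1 w2 /= E.
  have -> : w1 = 0 by nra. have -> : w2 = 0 by nra. by [].
have Hu := shape_defect_det p l w (- snd w, fst w) Hw HS Hd Hdet.
apply: Hw; apply: (affine_metric_basis p w w _ Hp Hu) => //.
exact: affine_metric_defect_eigenvector.
Qed.

(** The vector (S - l) e is metric-orthogonal to w. If it were orthogonal to e as well it would be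
    zero, contradicting [shape_defect_det]. *)
Lemma hessian_support_neq0 p l w e : U p -> l <> 0 -> w <> zero -> mat2_app (S p) w = scal l w ->
  0 < delta S p -> fst w * snd e - snd w * fst e <> 0 ->
  deriv e (deriv e (fun r => support f nu r (focal_point p l))) p <> 0.
Proof.
move=> Hp Hl Hw HS Hd Hdet; rewrite hessian_support //.
have Hu := shape_defect_det p l w e Hw HS Hd Hdet.
move/Rmult_integral => [H|H]; first by case: (Rinv_neq_0_compat l Hl).
apply: Hu; suff E : shape_defect p l e = zero by rewrite E /zero /= /zero /=; ring.
apply: (affine_metric_basis p _ w e) => //; rewrite affine_metric_sym //.
exact: affine_metric_defect_eigenvector.
Qed.

(** * The focal map and its singular points *)

Lemma deriv3_focal_map lam q X : U q -> Cinf lam q -> lam q <> 0 ->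
  deriv3 X (focal_map f xi lam) q =
  plus (deriv3 (fst X - / lam q * fst (mat2_app (S q) X), snd X - / lam q * snd (mat2_app (S q) X)) f q)
       (scal (- deriv X lam q / lam q ^ 2) (xi q)).
Proof.
move=> Hq Hlam H0; have [[F1 F2 F3] [X1 X2 X3]] := congr_Cinf3 q Hq.
have D : forall g x, Cinf g q -> Cinf x q ->
  deriv X (fun r => g r + / lam r * x r) q =
  deriv X g q + (- deriv X lam q / lam q ^ 2 * x q + / lam q * deriv X x q).
  move=> g x Hg Hx; rewrite deriv_plus //; last by apply: Cinf_mult => //; exact: Cinf_inv.
  by rewrite deriv_mult //; [rewrite deriv_inv|exact: Cinf_inv].
have := proj1 hstruct q Hq X; rewrite (proj1 hequi q Hq X); move: (mat2_app (S q) X) => SX.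
have Dl : forall g, deriv (fst X - / lam q * fst SX, snd X - / lam q * snd SX) g q =
    deriv X g q - / lam q * deriv SX g q by move=> g; rewrite /deriv /=; ring.
rewrite /deriv3 /focal_map /plus /opp /scal /= /prod_plus /prod_opp /prod_scal /= /plus /opp /scal /= /mult /=.
move=> [E1 E2 E3]; rewrite !D // !Dl E1 E2 E3.
rewrite /plus /opp /scal /= /prod_plus /prod_scal /= /plus /scal /= /mult /=.
by congr (_, _, _); field.
Qed.

(** The differential of the focal map splits into a tangential part df(X - S X / lam) and a multiple
    of xi by - dlam(X) / lam^2. Pairing with nu isolates the second, and immersivity of f handles
    the first. *)
Lemma ridge_pointE lam q : hyperbolic U S q -> Cinf lam q -> lam q <> 0 ->
  (ridge_point U f xi S lam q <-> exists X, principal_direction S lam q X /\ deriv X lam q = 0).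
Proof.
move=> Hh Hlam H0; have [Hq _] := Hh.
split.
- move=> [_ [_ Himm]]; apply: NNPP => Hno; apply: Himm => X HX; apply: NNPP => HX0.
  apply: Hno; exists X.
  have E := deriv3_focal_map lam q X Hq Hlam H0; rewrite HX in E.
  set Y : R2 := (_ - _, _ - _) in E; set c := _ / _ in E.
  have Ec : c = 0.
    have : dot (nu q) zero = 0 by rewrite /dot /zero /= /zero /=; ring.
    rewrite E; have -> : dot (nu q) (plus (deriv3 Y f q) (scal c (xi q))) =
      dot (nu q) (deriv3 Y f q) + c * dot (nu q) (xi q).
      by rewrite /dot /plus /scal /= /prod_plus /prod_scal /= /plus /scal /= /mult /=; ring.
    by rewrite conormal_tangent // conormal_xi //; lra.
  have EY : Y = zero.
    apply: (lc_immersion _ _ _ hcongr q Hq).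
    by rewrite E Ec [scal 0 _](scal_zero_l (xi q)) plus_zero_r.
  split; last first.
    move: Ec; rewrite /c => /Rmult_integral [|H]; first lra.
    by case: (Rinv_neq_0_compat _ (pow_nonzero _ 2 H0)).
  have aux : forall x a, x - / lam q * a = 0 -> a = lam q * x.
    move=> x a Hx; have -> : x = / lam q * a by lra.
    by field.
  split=> //; case: EY => /aux E1 /aux E2.
  by rewrite /mat2_app E1 E2.
- move=> [X [[HX0 HX] Hd]]; split=> //; split=> // Himm; apply: HX0; apply: Himm.
  have EY : (fst X - / lam q * fst (scal (lam q) X), snd X - / lam q * snd (scal (lam q) X)) = (0, 0).
    by rewrite /scal /= /prod_scal /= /scal /= /mult /=; congr (_, _); field.
  rewrite deriv3_focal_map // HX Hd EY; have -> : - 0 / lam q ^ 2 = 0 by field.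
  rewrite [scal 0 _](scal_zero_l (xi q)) plus_zero_r.
  by rewrite /deriv3 /deriv /= !Rmult_0_l !Rplus_0_r.
Qed.

(** * Restriction to a principal line *)

Lemma smooth0_3_along F a b : Cinf3 F (a 0, b 0) -> smooth0 a -> smooth0 b -> smooth0_3 (fun t => F (a t, b t)).
Proof.
move=> [H1 H2 H3] Ha Hb; split; [exact: (smooth0_comp (fun r => fst (fst (F r))))|
  exact: (smooth0_comp (fun r => snd (fst (F r))))|exact: (smooth0_comp (fun r => snd (F r)))].
Qed.

Lemma near_along (P : R2 -> Prop) a b : smooth0 a -> smooth0 b -> locally ((a 0, b 0) : R2) P ->
  locally 0 (fun t => P (a t, b t)).
Proof. by move=> Ha Hb; apply: locally_along; exact: smooth0_cont. Qed.

Lemma velocity3_along F a b : Cinf3 F (a 0, b 0) -> smooth0 a -> smooth0 b ->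
  locally 0 (fun t => velocity3 (fun s => F (a s, b s)) t = deriv3 (Derive a t, Derive b t) F (a t, b t)).
Proof.
move=> HF Ha Hb.
have L := near_along _ _ _ Ha Hb (Cinf3_locally _ _ HF).
apply: filter_imp (filter_and _ _ L (filter_and _ _ (smooth0_locally _ Ha) (smooth0_locally _ Hb))).
move=> t [[H1 H2 H3] [H4 H5]].
have C : forall g, Cinf g (a t, b t) -> Derive (fun s => g (a s, b s)) t = deriv (Derive a t, Derive b t) g (a t, b t).
  by move=> g Hg; apply: is_derive_unique; apply: chain_rule => //; eexists; eassumption.
by rewrite /velocity3 /deriv3 (C _ H1) (C _ H2) (C _ H3).
Qed.

Section AlongPrincipalLine.

Variables (lam : R2 -> R) (p : R2) (a b : R -> R).
Hypotheses (Hp : U p) (Hlam : Cinf lam p) (Hlamp : lam p <> 0) (Hdelta : 0 < delta S p).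
Hypotheses (Ha : smooth0 a) (Hb : smooth0 b) (Hab : (a 0, b 0) = p).
Hypothesis Hprin : locally 0 (fun t => mat2_app (S (a t, b t)) (Derive a t, Derive b t) =
  scal (lam (a t, b t)) (Derive a t, Derive b t)).
Hypothesis Hvel : (Derive a 0, Derive b 0) <> zero.

Let Z := focal_point p (lam p).
Let r t := / lam (a t, b t).
Let E t := minus (minus Z (f (a t, b t))) (scal (r t) (xi (a t, b t))).

Let HUab : locally 0 (fun t => U (a t, b t)).
Proof. by apply: near_along => //; rewrite Hab; exact: congr_locally. Qed.

Let Hcl : Cinf lam (a 0, b 0). Proof. by rewrite Hab. Qed.
Let Hcf : Cinf3 f (a 0, b 0). Proof. by rewrite Hab; case: (congr_Cinf3 p Hp). Qed.
Let Hcx : Cinf3 xi (a 0, b 0). Proof. by rewrite Hab; case: (congr_Cinf3 p Hp). Qed.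
Let Hcn : Cinf3 nu (a 0, b 0). Proof. by rewrite Hab; exact: conormal_Cinf3. Qed.

Let Sr : smooth0 r.
Proof. by apply: smooth0_inv; [exact: smooth0_comp|rewrite Hab]. Qed.

Let dot_E v t : dot v (E t) = dot v (minus Z (f (a t, b t))) - r t * dot v (xi (a t, b t)).
Proof.
by rewrite /E /dot /minus /plus /opp /scal /= /prod_plus /prod_opp /prod_scal /= /plus /opp /scal /= /mult /=; ring.
Qed.

Let SE : smooth0_3 E.
Proof.
have [F1 F2 F3] := smooth0_3_along _ _ _ Hcf Ha Hb; have [X1 X2 X3] := smooth0_3_along _ _ _ Hcx Ha Hb.
rewrite /E /minus /plus /opp /scal /= /prod_plus /prod_opp /prod_scal /= /plus /opp /scal /= /mult /=.
by split=> /=; solve_smooth0.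
Qed.

Let E_derive : locally 0 (fun t => forall v, dot v (velocity3 E t) = - Derive r t * dot v (xi (a t, b t))).
Proof.
have [/smooth0_locally F1 /smooth0_locally F2 /smooth0_locally F3] := smooth0_3_along _ _ _ Hcf Ha Hb.
have [/smooth0_locally X1 /smooth0_locally X2 /smooth0_locally X3] := smooth0_3_along _ _ _ Hcx Ha Hb.
have Ln : locally 0 (fun t => lam (a t, b t) <> 0).
  by apply: (near_along (fun q => lam q <> 0)) => //; apply: Cinf_neq0 => //; rewrite Hab.
apply: filter_imp (filter_and _ _ (filter_and _ _ (filter_and _ _ F1 (filter_and _ _ F2 F3))
  (filter_and _ _ X1 (filter_and _ _ X2 X3))) (filter_and _ _ (filter_and _ _ (smooth0_locally _ Sr)
  (filter_and _ _ (velocity3_along _ _ _ Hcf Ha Hb) (velocity3_along _ _ _ Hcx Ha Hb))) (filter_and _ _ (filter_and _ _ HUab Hprin) Ln))).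
move=> t [[[K1 [K2 K3]] [K4 [K5 K6]]] [[Kr [Kf Kx]] [[KU Kp] Kl]]] v.
have D : forall (z : R) g x dg dx', is_derive g t dg -> is_derive x t dx' ->
    Derive (fun s => z + - g s + - (r s * x s)) t = - dg - (Derive r t * x t + r t * dx').
  move=> z g x dg dx' Hg Hx; apply: is_derive_unique; evar_last.
    apply: is_derive_plus.
      apply: is_derive_plus; [exact: is_derive_const|apply: is_derive_opp; exact: Hg].
    apply: is_derive_opp; apply: (@is_derive_mult R_AbsRing); [exact: Kr|exact: Hx|exact: Rmult_comm].
  by rewrite /plus /opp /zero /mult /=; ring.
have -> : dot v (velocity3 E t) = - dot v (velocity3 (fun s => f (a s, b s)) t) -
    (Derive r t * dot v (xi (a t, b t)) + r t * dot v (velocity3 (fun s => xi (a s, b s)) t)).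
  rewrite {1}/velocity3 /E /minus /plus /opp /scal /= /prod_plus /prod_opp /prod_scal /= /plus /opp /scal /= /mult /=.
  rewrite (D _ _ _ _ _ K1 K4) (D _ _ _ _ _ K2 K5) (D _ _ _ _ _ K3 K6) /dot /velocity3 /=; ring.
rewrite Kf Kx dot_dxi // Kp.
have -> : dot v (deriv3 (scal (lam (a t, b t)) (Derive a t, Derive b t)) f (a t, b t)) =
   lam (a t, b t) * dot v (deriv3 (Derive a t, Derive b t) f (a t, b t)).
  by rewrite /dot /deriv3 /deriv /scal /= /prod_scal /= /scal /= /mult /=; ring.
by rewrite /r; field.
Qed.

Let E_zero v : dot v (E 0) = 0.
Proof. by rewrite dot_E Hab dot_focal_point /r Hab; ring. Qed.

Let xi_derive : locally 0 (fun t => forall v, dot v (velocity3 (fun s => xi (a s, b s)) t) =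
   - lam (a t, b t) * dot v (velocity3 (fun s => f (a s, b s)) t)).
Proof.
apply: filter_imp (filter_and _ _ (filter_and _ _ (velocity3_along _ _ _ Hcf Ha Hb) (velocity3_along _ _ _ Hcx Ha Hb))
  (filter_and _ _ HUab Hprin)) => t [[-> ->] [KU Kp]] v.
rewrite dot_dxi // Kp /dot /deriv3 /deriv /scal /= /prod_scal /= /scal /= /mult /=; ring.
Qed.

Let g q := support f nu q Z.

Let gE t : U (a t, b t) -> g (a t, b t) = dot (nu (a t, b t)) (E t) + r t.
Proof. by move=> Ht; rewrite dot_E conormal_xi // /g /support; ring. Qed.

(** The constant required to be nonzero in [support_order] is lam times the metric on the velocity
    of the line, covered by [principal_metric_neq0]. *)
Lemma support_contact k : flat (3 + k) (fun t => g (a t, b t) - g p) <-> flat k (Derive r).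
Proof.
have := support_order (fun t => nu (a t, b t)) (fun t => xi (a t, b t)) (velocity3 (fun s => f (a s, b s))) E r
  (fun t => lam (a t, b t)) (smooth0_3_along _ _ _ Hcn Ha Hb) (smooth0_3_along _ _ _ Hcx Ha Hb) SE Sr.
move=> H; rewrite -H {H} //.
- have Q0 : g p = dot (nu (a 0, b 0)) (E 0) + r 0 by rewrite -Hab; apply: gE; rewrite Hab.
  have L : locally 0 (fun t => g (a t, b t) - g p =
      dot (nu (a t, b t)) (E t) + r t - (dot (nu (a 0, b 0)) (E 0) + r 0)).
    by apply: filter_imp HUab => t Ht; rewrite -Q0 gE.
  by split; apply: flat_ext; apply: filter_imp L => t ->.
- by apply: filter_imp HUab => t; exact: conormal_xi.
- apply: filter_imp (filter_and _ _ HUab (velocity3_along _ _ _ Hcf Ha Hb)) => t [Ht ->].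
  exact: conormal_tangent.
- rewrite (locally_singleton _ _ (velocity3_along _ _ _ Hcf Ha Hb)) (locally_singleton _ _ (velocity3_along _ _ _ Hcn Ha Hb)).
  have Hp0 := locally_singleton _ _ Hprin; rewrite Hab in Hp0 *.
  apply: Rmult_integral_contrapositive_currified => //.
  exact: (principal_metric_neq0 p (lam p)).
Qed.

(** For constant e the derivative is dnu(e) . (Z - f), which equals dnu(e) . E because dnu(e) is
    orthogonal to xi; the same orthogonality yields the third order. *)
Lemma deriv_support_contact e : flat 1 (Derive r) -> flat 3 (fun t => deriv e g (a t, b t)).
Proof.
move=> Hr; have Hcne := Cinf3_deriv3 e _ _ Hcn.
apply: (flat_ext _ (fun t => dot (deriv3 e nu (a t, b t)) (E t))).
  apply: filter_imp HUab => t Ht.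
  by rewrite deriv_support // dot_E dconormal_xi //; ring.
apply: (flat3_dot_focal (fun t => xi (a t, b t)) E r) => //.
- exact: smooth0_3_along.
- exact: smooth0_3_along.
- by apply: filter_imp HUab => t; exact: dconormal_xi.
Qed.

End AlongPrincipalLine.

End Congruence.

(** * Contact of curves in an affine chart *)

(** Hadamard's lemma in the coordinate y - y2(x) gives K(x, y1) = (y1 - y2) B, and B is nonzero at
    the origin, where it equals K_y. *)
Lemma flat_graph_contact K y1 y2 k : Cinf K (0, 0) -> dy K (0, 0) <> 0 ->
  smooth0 y1 -> smooth0 y2 -> y1 0 = 0 -> y2 0 = 0 -> locally 0 (fun x => K (x, y2 x) = 0) ->
  flat k (fun x => K (x, y1 x)) <-> flat k (fun x => y1 x - y2 x).
Proof.
move=> HK Hnz H1 H2 y10 y20 E2.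
have [||B [HB B0 EB]] := hadamard (fun q => K (fst q, y2 (fst q) + snd q)).
- apply: (Cinf_comp K fst (fun q => y2 (fst q) + snd q)).
  + by rewrite /= y20 Rplus_0_r.
  + exact: Cinf_fst.
  + by apply: Cinf_plus => //; exact: Cinf_snd.
- by apply: filter_imp E2 => x /=; rewrite Rplus_0_r.
have {}B0 : B (0, 0) = dy K (0, 0).
  rewrite (locally_singleton _ _ B0) /dy /= y20.
  by apply: Derive_ext => z; rewrite Rplus_0_l.
have Sd : smooth0 (fun x => y1 x - y2 x) by solve_smooth0.
have SB : smooth0 (fun x => B (x, y1 x - y2 x)).
  by apply: (smooth0_comp B (fun x => x)) => //; [rewrite y10 y20 Rminus_0_r|solve_smooth0].
have E : locally 0 (fun x => K (x, y1 x) = (y1 x - y2 x) * B (x, y1 x - y2 x)).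
  have := locally_along _ (fun x => x) (fun x => y1 x - y2 x) 0 (continuous_id _) (smooth0_cont _ Sd).
  rewrite y10 y20 Rminus_0_r => H; apply: filter_imp (H _ EB) => x /= <-.
  by congr (K (_, _)); ring.
split=> HV.
- apply: (flat_unit k _ (fun x => B (x, y1 x - y2 x))) => //.
    by rewrite y10 y20 Rminus_0_r B0.
  by apply: flat_ext HV.
- apply: (flat_ext _ (fun x => (y1 x - y2 x) * B (x, y1 x - y2 x))).
    by apply: filter_imp E => x ->.
  exact: flat_mult_l.
Qed.

Definition chart (p e1 e2 q : R2) : R2 :=
  (fst p + (fst q * fst e1 + snd q * fst e2), snd p + (fst q * snd e1 + snd q * snd e2)).

Definition chart_inv (p e1 e2 r : R2) : R2 :=
  (((fst r - fst p) * snd e2 - (snd r - snd p) * fst e2) / (fst e1 * snd e2 - snd e1 * fst e2),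
   (fst e1 * (snd r - snd p) - snd e1 * (fst r - fst p)) / (fst e1 * snd e2 - snd e1 * fst e2)).

Section Chart.

Variables (p e1 e2 : R2).
Hypothesis Hdet : fst e1 * snd e2 - snd e1 * fst e2 <> 0.

Lemma chartE x z : plus p (plus (scal x e1) (scal z e2)) = chart p e1 e2 (x, z).
Proof. by []. Qed.

Lemma chart0 : chart p e1 e2 (0, 0) = p.
Proof. by rewrite /chart /= [RHS]surjective_pairing; congr (_, _); ring. Qed.

Lemma chartK q : chart_inv p e1 e2 (chart p e1 e2 q) = q.
Proof. by rewrite /chart /chart_inv /= [RHS]surjective_pairing; congr (_, _); field. Qed.

Lemma chart_invK r : chart p e1 e2 (chart_inv p e1 e2 r) = r.
Proof. by rewrite /chart /chart_inv /= [RHS]surjective_pairing; congr (_, _); field. Qed.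

Lemma chart_inv0 : chart_inv p e1 e2 p = (0, 0).
Proof. by rewrite -{2}chart0 chartK. Qed.

Lemma Cinf_chart q : Cinf (fun s => fst (chart p e1 e2 s)) q /\ Cinf (fun s => snd (chart p e1 e2 s)) q.
Proof.
by split; apply: Cinf_plus; try exact: Cinf_const; apply: Cinf_plus; apply: Cinf_mult;
  (exact: Cinf_const || exact: Cinf_fst || exact: Cinf_snd).
Qed.

Lemma Cinf_chart_inv r :
  Cinf (fun s => fst (chart_inv p e1 e2 s)) r /\ Cinf (fun s => snd (chart_inv p e1 e2 s)) r.
Proof.
by split; apply: Cinf_mult; try exact: Cinf_const; apply: Cinf_minus; apply: Cinf_mult;
  try exact: Cinf_const; apply: Cinf_minus; (exact: Cinf_const || exact: Cinf_fst || exact: Cinf_snd).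
Qed.

Lemma Cinf_comp_chart g q : Cinf g (chart p e1 e2 q) -> Cinf (fun s => g (chart p e1 e2 s)) q.
Proof.
move=> Hg; have [H1 H2] := Cinf_chart q.
apply: (Cinf_ext (fun s => g (fst (chart p e1 e2 s), snd (chart p e1 e2 s)))).
  by apply: filter_forall.
by apply: Cinf_comp.
Qed.

Lemma locally_chart (P : R2 -> Prop) : locally p P -> locally ((0, 0) : R2) (fun q => P (chart p e1 e2 q)).
Proof.
move=> HP; have [H1 H2] := Cinf_chart (0, 0).
by apply: (filterlim_pair_locally (fun s => fst (chart p e1 e2 s)) (fun s => snd (chart p e1 e2 s)));
  [exact: Cinf_cont|exact: Cinf_cont|rewrite -surjective_pairing chart0].
Qed.

Lemma dx_comp_chart g q : Cinf g (chart p e1 e2 q) -> dx (fun s => g (chart p e1 e2 s)) q = deriv e1 g (chart p e1 e2 q).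
Proof.
move=> Hg; rewrite /dx /=; apply: is_derive_unique.
evar_last.
  apply: (chain_rule g (fun x => fst p + (x * fst e1 + snd q * fst e2))
    (fun x => snd p + (x * snd e1 + snd q * snd e2))) => //; by auto_derive.
by rewrite /deriv /=; congr (_ * _ + _ * _); apply: is_derive_unique; auto_derive => //; ring.
Qed.

Lemma dy_comp_chart g q : Cinf g (chart p e1 e2 q) -> dy (fun s => g (chart p e1 e2 s)) q = deriv e2 g (chart p e1 e2 q).
Proof.
move=> Hg; rewrite /dy /=; apply: is_derive_unique.
evar_last.
  apply: (chain_rule g (fun z => fst p + (fst q * fst e1 + z * fst e2))
    (fun z => snd p + (fst q * snd e1 + z * snd e2))) => //; by auto_derive.
by rewrite /deriv /=; congr (_ * _ + _ * _); apply: is_derive_unique; auto_derive => //; ring.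
Qed.

Lemma A_point_chart k g : (forall X, deriv X g p = 0) ->
  A_point k (fun q => g (chart p e1 e2 q)) (0, 0) -> A_point k g p.
Proof.
move=> Hg [_ [phi [psi [c [s1 [s2 [[ph0 [ps0 [Hphi [Hpsi [E1 E2]]]]] [Hs1 [Hs2 E]]]]]]]]].
split=> //; exists (fun q => chart p e1 e2 (phi q)), (fun r => psi (chart_inv p e1 e2 r)), c, s1, s2.
split=> //; move/smooth2_near: Hphi => [F1 F2]; move/smooth2_near: Hpsi => [P1 P2].
have [C1 C2] := Cinf_chart (phi (0, 0)); have [I1 I2] := Cinf_chart_inv p.
have L : forall P : R2 -> Prop, locally ((0, 0) : R2) P -> locally p (fun r => P (chart_inv p e1 e2 r)).
  move=> P HP; apply: (filterlim_pair_locally (fun s => fst (chart_inv p e1 e2 s)) (fun s => snd (chart_inv p e1 e2 s)));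
  [exact: Cinf_cont|exact: Cinf_cont|by rewrite -surjective_pairing chart_inv0].
split; [|split; [|split; [|split; [|split]]]].
- by rewrite ph0 chart0.
- by rewrite chart_inv0.
- apply/smooth2_near; split.
  + by apply: Cinf_plus; [exact: Cinf_const|apply: Cinf_plus; apply: Cinf_mult => //; exact: Cinf_const].
  + by apply: Cinf_plus; [exact: Cinf_const|apply: Cinf_plus; apply: Cinf_mult => //; exact: Cinf_const].
- apply/smooth2_near; split.
  + apply: (Cinf_ext (fun r => fst (psi (fst (chart_inv p e1 e2 r), snd (chart_inv p e1 e2 r))))).
      by apply: filter_forall.
    by apply: (Cinf_comp (fun r => fst (psi r))) => //; rewrite -surjective_pairing chart_inv0.
  + apply: (Cinf_ext (fun r => snd (psi (fst (chart_inv p e1 e2 r), snd (chart_inv p e1 e2 r))))).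
      by apply: filter_forall.
    by apply: (Cinf_comp (fun r => snd (psi r))) => //; rewrite -surjective_pairing chart_inv0.
- by apply: filter_imp E1 => r; rewrite chartK.
- by apply: filter_imp (L _ E2) => r ->; rewrite chart_invK.
Qed.

Definition graph_x (y : R -> R) (t : R) : R := fst p + (t * fst e1 + y t * fst e2).
Definition graph_y (y : R -> R) (t : R) : R := snd p + (t * snd e1 + y t * snd e2).

Lemma graphE y t : (graph_x y t, graph_y y t) = chart p e1 e2 (t, y t).
Proof. by []. Qed.

Lemma smooth0_graph y : smooth0 y -> smooth0 (graph_x y) /\ smooth0 (graph_y y).
Proof. by move=> Hy; split; rewrite /graph_x /graph_y; solve_smooth0. Qed.

Lemma graph_velocity y t dyt : is_derive y t dyt ->
  is_derive (graph_x y) t (fst e1 + dyt * fst e2) /\ is_derive (graph_y y) t (snd e1 + dyt * snd e2).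
Proof.
move=> H; rewrite /graph_x /graph_y; split; auto_derive; try (by eexists; exact: H);
  rewrite (is_derive_unique _ _ _ H); ring.
Qed.

End Chart.

(** * The A4 criterion on a principal graph *)

Section Ridges.

Variables (U : R2 -> Prop) (f xi : R2 -> R3) (S : R2 -> mat2) (tau : R2 -> R2 -> R)
  (h : R2 -> R2 -> R2 -> R) (nu : R2 -> R3) (lam : R2 -> R) (p : R2).
Hypotheses (hcongr : line_congruence U f xi) (hstruct : structure_equations U f xi S tau h)
  (hequi : equiaffine U tau h) (hnu : conormal U f xi nu).
Hypotheses (hUp : U p) (hdelta : 0 < delta S p) (hlamp : lam p <> 0) (hlam : Cinf lam p).

Let g q := support f nu q (focal_point f xi p (lam p)).

Lemma deriv_support_focal X : deriv X g p = 0.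
Proof.
rewrite (deriv_support U f xi nu) // dot_focal_point.
by rewrite (dconormal_xi U f xi S tau h nu) //; ring.
Qed.

(** The derivative of the focal radius has order exactly 2 when the support function has order
    exactly 5 along the graph. The second basis vector serves as transverse direction, since the
    velocity is e1 + y' e2. *)
Lemma A4_graph e1 e2 y : fst e1 * snd e2 - snd e1 * fst e2 <> 0 -> smooth0 y -> y 0 = 0 ->
  locally 0 (fun t => mat2_app (S (graph_x p e1 e2 y t, graph_y p e1 e2 y t))
      (Derive (graph_x p e1 e2 y) t, Derive (graph_y p e1 e2 y) t) =
    scal (lam (graph_x p e1 e2 y t, graph_y p e1 e2 y t))
      (Derive (graph_x p e1 e2 y) t, Derive (graph_y p e1 e2 y) t)) ->
  (A_point 4 g p <->
   flat 2 (Derive (fun t => / lam (graph_x p e1 e2 y t, graph_y p e1 e2 y t))) /\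
   ~ flat 3 (Derive (fun t => / lam (graph_x p e1 e2 y t, graph_y p e1 e2 y t)))).
Proof.
move=> Hdet Hy y0 Hprin; set a := graph_x p e1 e2 y; set b := graph_y p e1 e2 y.
have [Ha Hb] : smooth0 a /\ smooth0 b by exact: smooth0_graph.
have Hab : (a 0, b 0) = p by rewrite graphE y0 chart0.
have [/is_derive_unique Da /is_derive_unique Db] := graph_velocity p e1 e2 y 0 _ (smooth0_is_derive _ Hy).
rewrite -/a -/b in Da Db.
have Hdet2 : fst e2 * Derive b 0 - snd e2 * Derive a 0 <> 0.
  by rewrite Da Db => E; apply: Hdet; lra.
have Hvel : (Derive a 0, Derive b 0) <> zero by move=> [E1 E2]; apply: Hdet2; rewrite E1 E2 /zero /=; ring.
have Hg : Cinf g p by apply: (support_Cinf U f xi nu).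
have HC := support_contact U f xi S tau h nu hcongr hstruct hequi hnu lam p a b hUp hlam hlamp hdelta Ha Hb Hab Hprin Hvel.
have HD := deriv_support_contact U f xi S tau h nu hcongr hstruct hequi hnu lam p a b hUp hlam hlamp Ha Hb Hab Hprin.
rewrite -/g in HC HD.
split.
- move=> HA; have [| |Q5 Q6] := A4_necessary g p a b e2 Hg Ha Hb Hab Hdet2 _ _ HA.
  (* Order 3 is automatic at a focal point: [flat 0] is trivially true. *)
  + exact: (proj2 (HC 0%nat)).
  + by move=> /(proj1 (HC 1%nat)); exact: HD.
  + by split; [exact: (proj1 (HC 2%nat))|move=> /(proj2 (HC 3%nat))].
(* In the chart, p becomes the origin and the derivative along e2 becomes the vertical derivative,
   the form required by [A4_sufficient]. *)
- move=> [V2r V3r]; apply: (A_point_chart p e1 e2) => //; first exact: deriv_support_focal.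
  have Gc : Cinf (fun q => g (chart p e1 e2 q)) (0, 0) by apply: Cinf_comp_chart; rewrite chart0.
  have gc0 : g (chart p e1 e2 (0, 0)) = g p by rewrite chart0.
  have Ldy : locally ((0, 0) : R2) (fun q => dy (fun s => g (chart p e1 e2 s)) q = deriv e2 g (chart p e1 e2 q)).
    apply: filter_imp (locally_chart p e1 e2 _ (Cinf_locally _ _ Hg)) => q; exact: dy_comp_chart.
  apply: (A4_sufficient _ y) => //.
  + by rewrite dx_comp_chart chart0 // deriv_support_focal.
  + by rewrite dy_comp_chart chart0 // deriv_support_focal.
  + have -> : dy (dy (fun q => g (chart p e1 e2 q))) (0, 0) = deriv e2 (deriv e2 g) p.
      rewrite -{2}(chart0 p e1 e2) -dy_comp_chart; last by rewrite chart0; exact: Cinf_deriv.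
      by apply: Derive_ext_loc; exact: (slice_y (fun q => dy _ q = deriv e2 g (chart p e1 e2 q)) (0, 0)).
    apply: (hessian_support_neq0 U f xi S tau h nu hcongr hstruct hequi hnu p (lam p) (Derive a 0, Derive b 0)) => //.
      by have := locally_singleton _ _ Hprin; rewrite -/a -/b Hab.
    by move=> /= E; apply: Hdet2; lra.
  + apply: (flat_ext _ (fun t => deriv e2 g (a t, b t))); last by apply: HD; apply: flat_le V2r; lia.
    have H := locally_along _ (fun t => t) y 0 (continuous_id _) (smooth0_cont _ Hy); rewrite y0 in H.
    by apply: filter_imp (H _ Ldy) => t /= ->.
  + by rewrite gc0; exact: (proj2 (HC 2%nat)).
  + by rewrite gc0 => /(proj1 (HC 3%nat)).
Qed.

(** * The ridge function and the focal radius *)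

Variables (W : R2 -> Prop) (w : R2 -> R2).
Hypotheses (HW : open W) (HWp : W p) (HWh : forall r, W r -> hyperbolic U S r).
Hypotheses (Hw : smooth2_on W w) (HWw : forall r, W r -> principal_direction S lam r (w r)).
Hypothesis HWlam : smooth_on (hyperbolic U S) lam.

Let HWnear : locally p W. Proof. exact: HW. Qed.

Let Cinf_lam r : W r -> Cinf lam r.
Proof.
move=> Hr; apply/Cinf_smooth_at; apply: filter_imp (HW r Hr) => s Hs; exact: (HWlam s (HWh s Hs)).
Qed.

Let Cinf_w r : W r -> Cinf (fun q => fst (w q)) r /\ Cinf (fun q => snd (w q)) r.
Proof. by case: Hw => H1 H2 Hr; split; apply: (smooth_on_Cinf W). Qed.

Definition ridge_function (r : R2) : R := deriv (w r) lam r.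

Let Rf := ridge_function.

Lemma Cinf_ridge_function r : W r -> Cinf Rf r.
Proof.
move=> Hr; have [H1 H2] := Cinf_w r Hr; have Hl := Cinf_lam r Hr.
by apply: Cinf_plus; apply: Cinf_mult => //; [exact: Cinf_dx|exact: Cinf_dy].
Qed.

(** Positive delta makes the eigenspace a line. The coefficient is written as a Euclidean projection
    so that it depends smoothly on the point and on X. *)
Lemma eigenvector_colinear r X : W r -> mat2_app (S r) X = scal (lam r) X ->
  X = scal ((fst X * fst (w r) + snd X * snd (w r)) / (fst (w r) * fst (w r) + snd (w r) * snd (w r))) (w r).
Proof.
move=> Hr HX; have [Hw0 Hwe] := HWw r Hr; have [_ Hd] := HWh r Hr.
have Hn : fst (w r) * fst (w r) + snd (w r) * snd (w r) <> 0.
  move=> E; apply: Hw0; move: E; case: (w r) => w1 w2 /= E.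
  have -> : w1 = 0 by nra. have -> : w2 = 0 by nra. by [].
have E : fst (w r) * snd X - snd (w r) * fst X = 0.
  apply: NNPP => Hdet; have := shape_defect_det S r (lam r) (w r) X Hw0 Hwe Hd Hdet.
  by rewrite shape_defect_eigenvector //=; apply; ring.
move: E Hn; case: (w r) => w1 w2; case: X {HX} => x1 x2 /= E Hn.
rewrite /scal /= /prod_scal /= /scal /= /mult /=; congr (_, _).
- apply: (Rmult_eq_reg_r (w1 * w1 + w2 * w2)) => //.
  have -> : (x1 * w1 + x2 * w2) / (w1 * w1 + w2 * w2) * w1 * (w1 * w1 + w2 * w2) = (x1 * w1 + x2 * w2) * w1 by field.
  have -> : x1 * (w1 * w1 + w2 * w2) = (x1 * w1 + x2 * w2) * w1 - w2 * (w1 * x2 - w2 * x1) by ring.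
  by rewrite E; ring.
- apply: (Rmult_eq_reg_r (w1 * w1 + w2 * w2)) => //.
  have -> : (x1 * w1 + x2 * w2) / (w1 * w1 + w2 * w2) * w2 * (w1 * w1 + w2 * w2) = (x1 * w1 + x2 * w2) * w2 by field.
  have -> : x2 * (w1 * w1 + w2 * w2) = (x1 * w1 + x2 * w2) * w2 + w1 * (w1 * x2 - w2 * x1) by ring.
  by rewrite E; ring.
Qed.

Lemma deriv_scal c X q : deriv (scal c X) lam q = c * deriv X lam q.
Proof. by rewrite /deriv /scal /= /prod_scal /= /scal /= /mult /=; ring. Qed.

Lemma ridge_point_near : locally p (fun r => ridge_point U f xi S lam r <-> Rf r = 0).
Proof.
apply: filter_imp (filter_and _ _ HWnear (Cinf_neq0 _ _ hlam hlamp)) => r [Hr Hl].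
rewrite (ridge_pointE U f xi S tau h nu) //; [|exact: HWh|exact: Cinf_lam].
split.
- move=> [X [[HX0 HX] HXl]]; have E := eigenvector_colinear r X Hr HX.
  move: HXl; rewrite {1}E deriv_scal => /Rmult_integral [] // Hc.
  by case: HX0; rewrite E Hc; exact: (scal_zero_l (w r)).
- by move=> HR; exists (w r); split => //; exact: HWw.
Qed.

(** With velocity c w along the line, (1 / lam)' = - c dlam(w) / lam^2, a multiple of the ridge
    function by a smooth factor that is nonzero at 0. *)
Lemma focal_radius_order a b k : smooth0 a -> smooth0 b -> (a 0, b 0) = p ->
  (Derive a 0, Derive b 0) <> zero ->
  locally 0 (fun t => mat2_app (S (a t, b t)) (Derive a t, Derive b t) =
    scal (lam (a t, b t)) (Derive a t, Derive b t)) ->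
  flat k (Derive (fun t => / lam (a t, b t))) <-> flat k (fun t => Rf (a t, b t)).
Proof.
move=> Ha Hb Hab Hvel Hprin.
have LW : locally 0 (fun t => W (a t, b t)) by apply: near_along => //; rewrite Hab.
have Hl : Cinf lam (a 0, b 0) by rewrite Hab.
have [Cw1 Cw2] : Cinf (fun q => fst (w q)) (a 0, b 0) /\ Cinf (fun q => snd (w q)) (a 0, b 0).
  by rewrite Hab; exact: Cinf_w.
pose w1 t := fst (w (a t, b t)); pose w2 t := snd (w (a t, b t)).
have Sw1 : smooth0 w1 by exact: (smooth0_comp _ _ _ Cw1).
have Sw2 : smooth0 w2 by exact: (smooth0_comp _ _ _ Cw2).
pose c t := (Derive a t * w1 t + Derive b t * w2 t) / (w1 t * w1 t + w2 t * w2 t).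
have [Hw0 _] := HWw p HWp.
have n0 : w1 0 * w1 0 + w2 0 * w2 0 <> 0.
  move=> E; apply: Hw0; move: E; rewrite /w1 /w2 Hab; case: (w p) => u1 u2 /= E.
  have -> : u1 = 0 by nra. have -> : u2 = 0 by nra. by [].
have Sc : smooth0 c by apply: smooth0_div => //; solve_smooth0.
have Ec : locally 0 (fun t => (Derive a t, Derive b t) = scal (c t) (w (a t, b t))).
  by apply: filter_imp (filter_and _ _ LW Hprin) => t [Ht Hp]; exact: (eigenvector_colinear _ _ Ht Hp).
have c0 : c 0 <> 0.
  move=> E; apply: Hvel; rewrite (locally_singleton _ _ Ec) E; exact: (scal_zero_l (w (a 0, b 0))).
have Sl : smooth0 (fun t => lam (a t, b t)) by exact: smooth0_comp.
have l0 : lam (a 0, b 0) <> 0 by rewrite Hab.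
have SR : smooth0 (fun t => Rf (a t, b t)).
  by apply: smooth0_comp => //; rewrite Hab; exact: Cinf_ridge_function.
pose m t := - c t * (/ lam (a t, b t) * / lam (a t, b t)).
have Sm : smooth0 m by apply: smooth0_mult; [by solve_smooth0|apply: smooth0_mult; exact: smooth0_inv].
have m0 : m 0 <> 0.
  by rewrite /m; apply: Rmult_integral_contrapositive_currified; [lra|
    apply: Rmult_integral_contrapositive_currified; exact: Rinv_neq_0_compat].
have E : locally 0 (fun t => Rf (a t, b t) * m t = Derive (fun t => / lam (a t, b t)) t).
  have Ll : locally 0 (fun t => lam (a t, b t) <> 0) by exact: (smooth0_neq0 (fun t => lam (a t, b t))).
  apply: filter_imp (filter_and _ _ (filter_and _ _ LW Ec) (filter_and _ _ Ll
    (filter_and _ _ (smooth0_locally _ Ha) (smooth0_locally _ Hb)))) => t [[Ht Et] [Hlt [Da Db]]].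
  have HC := chain_rule lam a b t (Cinf_lam _ Ht) (ex_intro _ _ Da) (ex_intro _ _ Db).
  rewrite Et deriv_scal -/(Rf (a t, b t)) in HC.
  symmetry; apply: is_derive_unique; evar_last.
    by apply: is_derive_inv; [exact: HC|].
  by rewrite /m -[deriv _ _ _]/(Rf (a t, b t)); move: (c t) (Rf _) => *; field.
split=> HV.
- by apply: (flat_unit _ _ m) => //; apply: flat_ext HV; apply: filter_imp E => t ->.
- by apply: (flat_ext _ _ _ E); exact: flat_mult_l.
Qed.

End Ridges.

(** * Passage between arcs, graphs and principal lines *)

Lemma locally_and (P Q : R -> Prop) (x : R) :
  locally x P -> locally x Q -> locally x (fun t => P t /\ Q t).
Proof. exact: filter_and. Qed.

Lemma locally_pull (P : R -> Prop) c : smooth0 c -> c 0 = 0 -> locally 0 P -> locally 0 (fun x => P (c x)).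
Proof. by move=> /smooth0_cont Hc c0 HP; apply: Hc; rewrite c0. Qed.

Lemma smooth_arc_smooth0 gamma eps : 0 < eps -> smooth_arc gamma eps ->
  smooth0 (fun t => fst (gamma t)) /\ smooth0 (fun t => snd (gamma t)).
Proof.
by move=> He H; split; apply/smooth0_smooth_curve; apply: (interval_locally eps) => // t /H [].
Qed.

Lemma smooth0_smooth_arc a b : smooth0 a -> smooth0 b ->
  locally 0 (fun t => smooth_curve_at a t /\ smooth_curve_at b t).
Proof. by move=> /smooth0_smooth_curve Ha /smooth0_smooth_curve Hb; exact: locally_and. Qed.

Lemma graph_near_smooth0 C p e1 e2 y : graph_near C p e1 e2 y -> smooth0 y /\ y 0 = 0.
Proof.
by move=> [y0 [eps [He [Hs _]]]]; split=> //; apply/smooth0_smooth_curve; exact: (interval_locally eps).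
Qed.

Lemma graph_near_mem C p e1 e2 y : graph_near C p e1 e2 y ->
  locally ((0, 0) : R2) (fun q => C (chart p e1 e2 q) <-> snd q = y (fst q)).
Proof.
move=> [y0 [eps [He [_ H]]]]; apply: (box_locally eps) => // -[x z] [/= Hx Hz].
exact: H.
Qed.

(* An arc that is locally a graph can be reparametrised by the abscissa. *)
Lemma principal_arc_graph U S lam p gamma eps e1 e2 y :
  fst e1 * snd e2 - snd e1 * fst e2 <> 0 ->
  principal_arc U S lam p gamma eps -> graph_near (arc_image gamma eps) p e1 e2 y ->
  locally 0 (fun t => mat2_app (S (graph_x p e1 e2 y t, graph_y p e1 e2 y t))
      (Derive (graph_x p e1 e2 y) t, Derive (graph_y p e1 e2 y) t) =
    scal (lam (graph_x p e1 e2 y t, graph_y p e1 e2 y t))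
      (Derive (graph_x p e1 e2 y) t, Derive (graph_y p e1 e2 y) t)).
Proof.
move=> Hdet [He [g0 [Hsm Hprin]]] Hgr.
have [Sy y0] := graph_near_smooth0 _ _ _ _ _ Hgr; have Hmem := graph_near_mem _ _ _ _ _ Hgr.
have [Sa Sb] := smooth_arc_smooth0 _ _ He Hsm.
pose X t := fst (chart_inv p e1 e2 (gamma t)); pose Z t := snd (chart_inv p e1 e2 (gamma t)).
have SX : smooth0 X by rewrite /X /chart_inv /Rdiv /=; solve_smooth0.
have SZ : smooth0 Z by rewrite /Z /chart_inv /Rdiv /=; solve_smooth0.
have X0 : X 0 = 0 by rewrite /X g0 chart_inv0.
have Z0 : Z 0 = 0 by rewrite /Z g0 chart_inv0.
have [Sgx Sgy] := smooth0_graph p e1 e2 y Sy.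
have Leps : locally 0 (fun t => Rabs t < eps) by exact: (interval_locally eps).
have LZ : locally 0 (fun t => gamma t = (graph_x p e1 e2 y (X t), graph_y p e1 e2 y (X t))).
  have HM : locally 0 (fun t => arc_image gamma eps (chart p e1 e2 (X t, Z t)) <-> Z t = y (X t)).
    apply: (near_along (fun q => arc_image gamma eps (chart p e1 e2 q) <-> snd q = y (fst q))) => //.
    by rewrite X0 Z0.
  have HH : locally 0 (fun t => Rabs t < eps /\
      (arc_image gamma eps (chart p e1 e2 (X t, Z t)) <-> Z t = y (X t))) by exact: locally_and.
  apply: filter_imp HH => t [Ht [H1 _]].
  have E : (X t, Z t) = chart_inv p e1 e2 (gamma t) by rewrite /X /Z -surjective_pairing.
  rewrite graphE -H1 ?E ?chart_invK //.
  by exists t.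
have LV : locally 0 (fun t => velocity gamma t =
    (Derive X t * Derive (graph_x p e1 e2 y) (X t), Derive X t * Derive (graph_y p e1 e2 y) (X t))).
  have L1 : locally 0 (fun t => is_derive (graph_x p e1 e2 y) (X t) (Derive (graph_x p e1 e2 y) (X t)) /\
      is_derive (graph_y p e1 e2 y) (X t) (Derive (graph_y p e1 e2 y) (X t))).
    exact: (locally_pull _ X SX X0 (locally_and _ _ _ (smooth0_locally _ Sgx) (smooth0_locally _ Sgy))).
  have L2 := locally_and _ _ _ (smooth0_locally _ SX) L1; have L3 := locally_locally _ _ LZ.
  apply: filter_imp (locally_and _ _ _ L3 L2).
  move=> t [Et [Hx [H1 H2]]]; rewrite /velocity; congr (_, _); apply: is_derive_unique.
  - apply: (is_derive_ext_loc (fun s => graph_x p e1 e2 y (X s))).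
      by apply: filter_imp Et => s ->.
    exact: (is_derive_comp (graph_x p e1 e2 y) X).
  - apply: (is_derive_ext_loc (fun s => graph_y p e1 e2 y (X s))).
      by apply: filter_imp Et => s ->.
    exact: (is_derive_comp (graph_y p e1 e2 y) X).
(* The velocity of the arc is X' times that of the graph, and principal arcs have nonzero
   velocity. *)
have DX0 : Derive X 0 <> 0.
  move=> E; have R0 : Rabs 0 < eps by rewrite Rabs_R0.
  have [_ [Hv _]] := Hprin 0 R0; apply: Hv.
  by rewrite (locally_singleton _ _ LV) E !Rmult_0_l.
(* Solving X(t) = x for t: c(x) is the parameter at which the arc has abscissa x. The eigenvector
   equation at that parameter is then divided by X'. *)
have [|||c [Sc c0 Ec _]] := critical_section (fun q => X (snd q) - fst q).
- apply: Cinf_minus; last exact: Cinf_fst.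
  by apply: (Cinf_comp (fun s => X (fst s)) snd (fun _ => 0)) => //; [exact: Cinf_snd|exact: Cinf_const].
- by rewrite /= X0; ring.
- by rewrite /dy /= (Derive_ext _ X) // => t; rewrite Rminus_0_r.
have LDX : locally 0 (fun t => Derive X t <> 0) by apply: smooth0_neq0 => //; solve_smooth0.
have L := locally_pull _ c Sc c0 (locally_and _ _ _ (locally_and _ _ _ Leps LZ) (locally_and _ _ _ LV LDX)).
apply: filter_imp (locally_and _ _ _ Ec L) => x [Ex [[Hx1 Hx2] [Hx3 Hx4]]].
have Xc : X (c x) = x by move: Ex => /=; lra.
have [_ [_ HP]] := Hprin _ Hx1; move: HP; rewrite Hx3 Hx2 Xc.
move: (Derive X (c x)) Hx4 (Derive _ x) (Derive _ x) (lam _) => m Hm u v l.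
rewrite /mat2_app /scal /= /prod_scal /= /scal /= /mult /= => -[E1 E2].
by congr (_, _); apply: (Rmult_eq_reg_l m) => //; lra.
Qed.

Lemma mat2_app_scal A c X : mat2_app A (scal c X) = scal c (mat2_app A X).
Proof. by rewrite /mat2_app /scal /= /prod_scal /= /scal /= /mult /=; congr (_, _); ring. Qed.

(** In a basis starting with w(p), the field w is not vertical near p, so its integral curve is the
    solution of a scalar equation y' = slope. *)
Lemma exists_principal_graph S lam (W : R2 -> Prop) w p :
  open W -> W p -> smooth2_on W w -> (forall r, W r -> principal_direction S lam r (w r)) ->
  exists e1 e2 y, [/\ fst e1 * snd e2 - snd e1 * fst e2 <> 0, smooth0 y, y 0 = 0 &
    locally 0 (fun t => (Derive (graph_x p e1 e2 y) t, Derive (graph_y p e1 e2 y) t) <> zero /\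
      mat2_app (S (graph_x p e1 e2 y t, graph_y p e1 e2 y t))
        (Derive (graph_x p e1 e2 y) t, Derive (graph_y p e1 e2 y) t) =
      scal (lam (graph_x p e1 e2 y t, graph_y p e1 e2 y t))
        (Derive (graph_x p e1 e2 y) t, Derive (graph_y p e1 e2 y) t))].
Proof.
move=> HW HWp [Hw1 Hw2] HWw.
have [Hw0 _] := HWw p HWp.
exists (w p), (- snd (w p), fst (w p)); set e1 := w p; set e2 : R2 := (_, _).
have Hdet : fst e1 * snd e2 - snd e1 * fst e2 <> 0.
  move=> E; apply: Hw0; have {}E : fst e1 * fst e1 + snd e1 * snd e1 = 0 by move: E; rewrite /e2 /=; lra.
  rewrite [w p]surjective_pairing -/e1.
  have -> : fst e1 = 0 by nra. have -> : snd e1 = 0 by nra. by [].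
pose D := fst e1 * snd e2 - snd e1 * fst e2.
(* By Cramer's rule w = (A e1 + B e2) / D, so the slope is B / A and the velocity e1 + (B / A) e2 of
   the graph is (D / A) w. *)
pose A q := fst (w q) * snd e2 - snd (w q) * fst e2.
pose B q := fst e1 * snd (w q) - snd e1 * fst (w q).
have CA : Cinf A p.
  by apply: Cinf_minus; apply: Cinf_mult; try exact: Cinf_const; apply: (smooth_on_Cinf W).
have CB : Cinf B p.
  by apply: Cinf_minus; apply: Cinf_mult; try exact: Cinf_const; apply: (smooth_on_Cinf W).
have A0 : A p <> 0 by exact: Hdet.
have CG : Cinf (fun q => B (chart p e1 e2 q) / A (chart p e1 e2 q)) (0, 0).
  apply: Cinf_div; last by rewrite chart0.
  - by apply: Cinf_comp_chart; rewrite chart0.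
  - by apply: Cinf_comp_chart; rewrite chart0.
have [y [Sy y0 Hy]] := ode_solution _ CG.
exists y; split=> //.
have LWA : locally 0 (fun t => W (graph_x p e1 e2 y t, graph_y p e1 e2 y t) /\
    A (graph_x p e1 e2 y t, graph_y p e1 e2 y t) <> 0).
  have [Sgx Sgy] := smooth0_graph p e1 e2 y Sy.
  apply: (near_along (fun q => W q /\ A q <> 0)) => //; rewrite graphE y0 chart0.
  by apply: filter_and; [exact: HW|exact: Cinf_neq0].
have HyL : locally 0 (fun t => is_derive y t (B (chart p e1 e2 (t, y t)) / A (chart p e1 e2 (t, y t)))) by exact: Hy.
apply: filter_imp (locally_and _ _ _ LWA HyL) => t [[Ht At] Hyt].
have [/is_derive_unique -> /is_derive_unique ->] := graph_velocity p e1 e2 y t _ Hyt.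
rewrite graphE in Ht At *; move: (chart p e1 e2 (t, y t)) Ht At {Hyt} => q Hq Aq.
have -> : (fst e1 + B q / A q * fst e2, snd e1 + B q / A q * snd e2) = scal (D / A q) (w q).
  rewrite /scal /= /prod_scal /= /scal /= /mult /=; congr (_, _);
    apply: (Rmult_eq_reg_r (A q)) => //.
  - have -> : (fst e1 + B q / A q * fst e2) * A q = fst e1 * A q + B q * fst e2 by field.
    have -> : D / A q * fst (w q) * A q = D * fst (w q) by field.
    by rewrite /A /B /D; ring.
  - have -> : (snd e1 + B q / A q * snd e2) * A q = snd e1 * A q + B q * snd e2 by field.
    have -> : D / A q * snd (w q) * A q = D * snd (w q) by field.
    by rewrite /A /B /D; ring.
have [Hq0 Hqe] := HWw q Hq; split; last first.
  rewrite mat2_app_scal Hqe /scal /= /prod_scal /= /scal /= /mult /=; congr (_, _); ring.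
have HDA : D / A q <> 0.
  by apply: Rmult_integral_contrapositive_currified => //; exact: Rinv_neq_0_compat.
move: (D / A q) HDA => m Hm; case: (w q) Hq0 => w1 w2 Hq0.
rewrite /scal /= /prod_scal /= /scal /= /mult /= => -[E1 E2]; apply: Hq0.
case/Rmult_integral: E1 => // ->; case/Rmult_integral: E2 => // -> //.
Qed.

Theorem corollary7p7
  (U : R2 -> Prop) (f xi : R2 -> R3)
  (S : R2 -> mat2) (tau : R2 -> R2 -> R) (h : R2 -> R2 -> R2 -> R)
  (nu : R2 -> R3) (lam : R2 -> R) (p : R2)
  (hcongr : line_congruence U f xi)
  (hstruct : structure_equations U f xi S tau h)
  (hequi : equiaffine U tau h)
  (hnu : conormal U f xi nu)
  (hlam : principal_curvature U S lam)
  (hUp : U p) (hdelta : 0 < delta S p) (hlamp : lam p <> 0)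
  (hridge : regular_ridge U S lam) :
  A_point 4
    (fun q => support f nu q (plus (f p) (scal (/ lam p) (xi p)))) p
  <->
  (ridge_point U f xi S lam p /\
   (exists X, principal_direction S lam p X /\
              tangent_to (ridge_point U f xi S lam) p X) /\
   (exists (gamma : R -> R2) (eps : R),
      principal_arc U S lam p gamma eps /\
      contact_order (arc_image gamma eps) (ridge_point U f xi S lam) p 2)).
Proof.
have [hsm _] := hlam.
have [W [w [HW [HWp [HWh [Hw [HWw Hreg]]]]]]] := hridge p (conj hUp hdelta).
have Clam : Cinf lam p.
  by apply/Cinf_smooth_at; apply: filter_imp (HW p HWp) => r Hr; exact: (hsm r (HWh r Hr)).
pose Rf := ridge_function lam w.
have CR : Cinf Rf p by exact: (Cinf_ridge_function U S lam W).
have LR := ridge_point_near U f xi S tau h nu lam p hcongr hstruct hequi hnu hlamp Clam W w HW HWp HWh HWw hsm.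
rewrite -/Rf in LR.
(* At a zero of the ridge function its differential is nonzero, so it cannot kill both vectors of a
   basis. *)
have Hreg0 : forall a b, fst a * snd b - snd a * fst b <> 0 -> Rf p = 0 -> deriv a Rf p = 0 -> deriv b Rf p <> 0.
  move=> a b Hdet R0 Ha Hb; have [X] := Hreg p HWp R0; apply.
  have [s [t ->]] := basis_decomposition a b X Hdet.
  by rewrite -/Rf deriv_comb Ha Hb; ring.
(* Both directions reduce to this equivalence, in any affine basis where the principal line is the
   graph of y1, the ridge function vanishes on the graph of y2, and its derivative along e2 is
   nonzero. *)
have key : forall e1 e2 y1 y2, fst e1 * snd e2 - snd e1 * fst e2 <> 0 ->
    smooth0 y1 -> y1 0 = 0 -> smooth0 y2 -> y2 0 = 0 ->
    locally 0 (fun t => mat2_app (S (graph_x p e1 e2 y1 t, graph_y p e1 e2 y1 t))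
      (Derive (graph_x p e1 e2 y1) t, Derive (graph_y p e1 e2 y1) t) =
    scal (lam (graph_x p e1 e2 y1 t, graph_y p e1 e2 y1 t))
      (Derive (graph_x p e1 e2 y1) t, Derive (graph_y p e1 e2 y1) t)) ->
    deriv e2 Rf p <> 0 -> locally 0 (fun x => Rf (chart p e1 e2 (x, y2 x)) = 0) ->
    (A_point 4 (fun q => support f nu q (plus (f p) (scal (/ lam p) (xi p)))) p <->
     vanishes_exactly (fun x => y1 x - y2 x) 2).
  move=> e1 e2 y1 y2 Hdet S1 y10 S2 y20 Hprin He2 E2.
  have [Sgx Sgy] := smooth0_graph p e1 e2 y1 S1.
  have [D1 D2] := graph_velocity p e1 e2 y1 0 _ (smooth0_is_derive _ S1).
  have Hvel : (Derive (graph_x p e1 e2 y1) 0, Derive (graph_y p e1 e2 y1) 0) <> zero.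
    rewrite (is_derive_unique _ _ _ D1) (is_derive_unique _ _ _ D2) => -[F1 F2]; apply: Hdet.
    have -> : fst e1 = - Derive y1 0 * fst e2 by move: F1; rewrite /zero /=; lra.
    have -> : snd e1 = - Derive y1 0 * snd e2 by move: F2; rewrite /zero /=; lra.
    ring.
  have g0 : (graph_x p e1 e2 y1 0, graph_y p e1 e2 y1 0) = p by rewrite graphE y10 chart0.
  have CK : Cinf (fun q => Rf (chart p e1 e2 q)) (0, 0) by apply: Cinf_comp_chart; rewrite chart0.
  have K0 : dy (fun q => Rf (chart p e1 e2 q)) (0, 0) <> 0 by rewrite dy_comp_chart chart0.
  have order : forall k, flat k (Derive (fun t => / lam (graph_x p e1 e2 y1 t, graph_y p e1 e2 y1 t))) <->
      flat k (fun x => y1 x - y2 x).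
    move=> k; rewrite (focal_radius_order U S lam p hlamp Clam W w HW HWp HWh Hw HWw hsm) //.
    exact: (flat_graph_contact (fun q => Rf (chart p e1 e2 q)) y1 y2 k).
  rewrite vanishes_exactlyE -!order.
  exact: (A4_graph U f xi S tau h nu lam p).
split.
- move=> HA.
  have [e1 [e2 [y1 [Hdet S1 y10 Hprin]]]] := exists_principal_graph S lam W w p HW HWp Hw HWw.
  have Hprin2 : locally 0 (fun t => mat2_app (S (graph_x p e1 e2 y1 t, graph_y p e1 e2 y1 t))
      (Derive (graph_x p e1 e2 y1) t, Derive (graph_y p e1 e2 y1) t) =
    scal (lam (graph_x p e1 e2 y1 t, graph_y p e1 e2 y1 t))
      (Derive (graph_x p e1 e2 y1) t, Derive (graph_y p e1 e2 y1) t)) by apply: filter_imp Hprin => t [].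
  have [Sgx Sgy] := smooth0_graph p e1 e2 y1 S1.
  have [D1 D2] := graph_velocity p e1 e2 y1 0 _ (smooth0_is_derive _ S1).
  have g0 : (graph_x p e1 e2 y1 0, graph_y p e1 e2 y1 0) = p by rewrite graphE y10 chart0.
  have [Hvel Heig] := locally_singleton _ _ Hprin.
  (* The A4 hypothesis makes the ridge function flat to order 2 along the principal graph: it
     vanishes at p and its differential kills the principal direction. By regularity it does not
     kill e2, so the ridge is a graph over the same axis. *)
  have [R0 Hd] : Rf p = 0 /\ deriv (fst e1 + Derive y1 0 * fst e2, snd e1 + Derive y1 0 * snd e2) Rf p = 0.
    have [V2r _] := proj1 (A4_graph U f xi S tau h nu lam p hcongr hstruct hequi hnu hUp hdelta hlamp Clam
      e1 e2 y1 Hdet S1 y10 Hprin2) HA.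
    have [V0 [flat1' _]] := proj1 (focal_radius_order U S lam p hlamp Clam W w HW HWp HWh Hw HWw hsm
      _ _ 2%nat Sgx Sgy g0 Hvel Hprin2) V2r.
    have CR' : Cinf Rf (graph_x p e1 e2 y1 0, graph_y p e1 e2 y1 0) by rewrite g0.
    have H := chain_rule Rf _ _ 0 CR' (ex_intro _ _ D1) (ex_intro _ _ D2).
    split; first by rewrite -g0.
    by move: flat1'; rewrite (is_derive_unique _ _ _ H) (is_derive_unique _ _ _ D1) (is_derive_unique _ _ _ D2) g0.
  have He2 : deriv e2 Rf p <> 0.
    apply: (Hreg0 (fst e1 + Derive y1 0 * fst e2, snd e1 + Derive y1 0 * snd e2) e2) => //=.
    by move=> E; apply: Hdet; lra.
  have CK : Cinf (fun q => Rf (chart p e1 e2 q)) (0, 0) by apply: Cinf_comp_chart; rewrite chart0.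
  have [| |y2 [S2 y20 E2 U2]] := critical_section _ CK.
  + by rewrite chart0.
  + by rewrite dy_comp_chart chart0.
  have Hv := proj1 (key e1 e2 y1 y2 Hdet S1 y10 S2 y20 Hprin2 He2 E2) HA.
  have [Sgx2 Sgy2] := smooth0_graph p e1 e2 y2 S2.
  have [D3 D4] := graph_velocity p e1 e2 y2 0 _ (smooth0_is_derive _ S2).
  (* Contact of order 2 includes equality of slopes, which gives the tangency. *)
  have Dy : Derive y2 0 = Derive y1 0.
    case: Hv => Hv _; have := Hv 1%nat (le_n 2) => /=; rewrite Derive_minus.
    * by move=> ?; lra.
    * by eexists; exact: smooth0_is_derive.
    * by eexists; exact: smooth0_is_derive.
  have Rp : ridge_point U f xi S lam p by apply/(locally_singleton _ _ LR).
  have L2 : locally 0 (fun t => ridge_point U f xi S lam (graph_x p e1 e2 y2 t, graph_y p e1 e2 y2 t)).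
    have L3 : locally 0 (fun t => ridge_point U f xi S lam (graph_x p e1 e2 y2 t, graph_y p e1 e2 y2 t) <->
        Rf (graph_x p e1 e2 y2 t, graph_y p e1 e2 y2 t) = 0).
      by apply: (near_along (fun q => ridge_point U f xi S lam q <-> Rf q = 0)) => //; rewrite graphE y20 chart0.
    by apply: filter_imp (locally_and _ _ _ L3 E2) => t [H1 H2]; apply/H1.
  have LW : locally 0 (fun t => W (graph_x p e1 e2 y1 t, graph_y p e1 e2 y1 t)).
    by apply: near_along => //; rewrite g0; exact: HW.
  split=> //; split.
  + exists (Derive (graph_x p e1 e2 y1) 0, Derive (graph_y p e1 e2 y1) 0); split.
      by split=> //; move: Heig; rewrite g0.
    have [d [Hd0 Hd1]] := locally_interval _ (locally_and _ _ _ L2 (smooth0_smooth_arc _ _ Sgx2 Sgy2)).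
    exists (fun t => (graph_x p e1 e2 y2 t, graph_y p e1 e2 y2 t)), d; split=> //; split.
      by move=> t /Hd1 [].
    split; first by move=> t /Hd1 [].
    split; first by rewrite graphE y20 chart0.
    rewrite /velocity /= (is_derive_unique _ _ _ D1) (is_derive_unique _ _ _ D2).
    by rewrite (is_derive_unique _ _ _ D3) (is_derive_unique _ _ _ D4) Dy.
  + have Sy1 := proj1 (smooth0_smooth_curve y1) S1; have Sy2 := proj1 (smooth0_smooth_curve y2) S2.
    have [d [Hd0 Hd1]] := locally_interval _ (locally_and _ _ _ (locally_and _ _ _ LW Hprin)
       (locally_and _ _ _ (smooth0_smooth_arc _ _ Sgx Sgy) Sy1)).
    pose gamma t := (graph_x p e1 e2 y1 t, graph_y p e1 e2 y1 t).
    exists gamma, d; split.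
      split=> //; split; first exact: g0.
      split; first by move=> t /Hd1 [_ []].
      by move=> t /Hd1 [[HWt [Hv1 Hv2]] _]; split; [exact: HWh|].
    exists e1, e2, y1, y2; split=> //; split; [|split] => //.
    * split=> //; exists d; split=> //; split; first by move=> x /Hd1 [_ []].
      move=> x z Hx Hz; rewrite chartE; split.
      - move=> [t [Ht E]]; have := f_equal (chart_inv p e1 e2) E.
        by rewrite /gamma graphE !chartK // => -[-> ->].
      - by move=> ->; exists x.
    * have LR2 := locally_chart p e1 e2 _ LR.
      have [d1 [Hd10 Hd11]] := locally_box _ (filter_and _ _ LR2 U2).
      have [d2 [Hd20 Hd22]] := locally_interval _ (locally_and _ _ _ E2 Sy2).
      (* [d1] bounds a box where ridge points are the zeros of [Rf] and these zeros lie on the graph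
         of [y2]; [d2] an interval over which that graph consists of zeros and [y2] is smooth. *)
      split=> //; exists (Rmin d1 d2); split; first exact: Rmin_pos.
      split; first by move=> x Hx; case: (Hd22 x) => //; apply: Rlt_le_trans Hx (Rmin_r _ _).
      move=> x z Hx Hz; rewrite chartE.
      have [H1 H2] : _ /\ _ := Hd11 (x, z) (conj (Rlt_le_trans _ _ _ Hx (Rmin_l _ _)) (Rlt_le_trans _ _ _ Hz (Rmin_l _ _))).
      have [H3 _] : _ /\ _ := Hd22 x (Rlt_le_trans _ _ _ Hx (Rmin_r _ _)).
      split; first by move=> /H1; exact: H2.
      by move=> E; apply/H1; rewrite E.
- move=> [Hrp [_ [gamma [eps [Harc [e1 [e2 [y1 [y2 [Hdet [G1 [G2 Hv]]]]]]]]]]]].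
  have [S1 y10] := graph_near_smooth0 _ _ _ _ _ G1; have [S2 y20] := graph_near_smooth0 _ _ _ _ _ G2.
  have Hprin := principal_arc_graph _ _ _ _ _ _ _ _ _ Hdet Harc G1.
  have R0 : Rf p = 0 by apply/(locally_singleton _ _ LR).
  have E2 : locally 0 (fun x => Rf (chart p e1 e2 (x, y2 x)) = 0).
    have L1 : locally 0 (fun x => ridge_point U f xi S lam (chart p e1 e2 (x, y2 x)) <-> y2 x = y2 x).
      apply: (near_along (fun q => ridge_point U f xi S lam (chart p e1 e2 q) <-> snd q = y2 (fst q)) (fun x => x) y2) => //; first by solve_smooth0.
      by rewrite y20; exact: graph_near_mem G2.
    have L2 : locally 0 (fun x => ridge_point U f xi S lam (chart p e1 e2 (x, y2 x)) <-> Rf (chart p e1 e2 (x, y2 x)) = 0).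
      apply: (near_along (fun q => ridge_point U f xi S lam (chart p e1 e2 q) <-> Rf (chart p e1 e2 q) = 0) (fun x => x) y2) => //; first by solve_smooth0.
      by rewrite y20; exact: locally_chart LR.
    by apply: filter_imp (locally_and _ _ _ L1 L2) => x [H1 H2]; apply/H2/H1.
  (* Transversality of e2 is forced by the graph form: the differential of [Rf] kills the tangent e1
     + y2' e2 of the ridge graph, so killing e2 as well would contradict regularity. *)
  apply/(key e1 e2 y1 y2) => // He2.
  have [Sgx Sgy] := smooth0_graph p e1 e2 y2 S2.
  have [D1 D2] := graph_velocity p e1 e2 y2 0 _ (smooth0_is_derive _ S2).
  have Hd : deriv (fst e1 + Derive y2 0 * fst e2, snd e1 + Derive y2 0 * snd e2) Rf p = 0.
    have CR' : Cinf Rf (graph_x p e1 e2 y2 0, graph_y p e1 e2 y2 0) by rewrite graphE y20 chart0.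
    have := chain_rule Rf _ _ 0 CR' (ex_intro _ _ D1) (ex_intro _ _ D2).
    rewrite (is_derive_unique _ _ _ D1) (is_derive_unique _ _ _ D2) graphE y20 chart0 => H.
    rewrite -(is_derive_unique _ _ _ H); apply: is_derive_unique.
    apply: (is_derive_ext_loc (fun _ => 0)); last exact: is_derive_const.
    by apply: filter_imp E2 => x <-.
  apply: (Hreg0 (fst e1 + Derive y2 0 * fst e2, snd e1 + Derive y2 0 * snd e2) e2) => //=.
  by move=> E; apply: Hdet; lra.
Qed.
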